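(* There is an absolute constant $C>0$ such that the following holds. Let $n\in\mathbb{N}$, let $G=(G_k)_{k=1}^n$ be a Hardy martingale on $\mathbb{T}^{\mathbb{N}}$ and let $U=(U_k)_{k=1}^n$ be its cosine martingale. Then for any adapted sequence $W=(w_k)$ of complex-valued functions satisfying $|w_k|=1$ for all $k$, $$\|U-\mathbb{E}(U\mid\mathcal{D})\|_{\mathcal{P}}\le C\,\|T_W(G-\mathbb{E}(G\mid\mathcal{D}))\|_{\mathcal{P}}^{1/2}\,\|G\|_{\mathcal{P}}^{1/2}.$$
   Context: Let $\mathbb{T}=\{e^{i\theta}:\theta\in[0,2\pi)\}$ carry normalized angular (Haar) measure, and let $\mathbb{T}^{\mathbb{N}}$ be its countable product with product Haar measure $\mathbb{P}$ and expectation $\mathbb{E}$. For $k\ge 1$, $\mathcal{F}_k$ is the $\sigma$-algebra on $\mathbb{T}^{\mathbb{N}}$ generated by the first $k$ coordinates; $\mathcal{F}_0$ is trivial. $\mathbb{E}_k$ denotes conditional expectation with respect to $\mathcal{F}_k$. Martingales are complex-valued, integrable and taken with respect to $(\mathcal{F}_k)$. For a martingale $F=(F_k)_{k=1}^n$ put $F_0=\mathbb{E}(F_1)$ and $\Delta F_k=\Delta_k F=F_k-F_{k-1}$ for $1\le k\le n$. A sequence $W=(w_k)$, $k\ge 0$, is adapted if each $w_k$ is $\mathcal{F}_k$-measurable. Previsible norm (with values in $[0,\infty]$): $\|F\|_{\mathcal{P}}=\left\|\left(\sum_{k}\mathbb{E}_{k-1}|\Delta F_k|^2\right)^{1/2}\right\|_{L^1}$.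 Hardy martingale: $H_0^1(\mathbb{T})$ is the space of integrable functions on $\mathbb{T}$ with vanishing mean whose harmonic extension to the unit disk is analytic. A martingale $G=(G_k)$ bounded in $L^1(\mathbb{T}^{\mathbb{N}})$ is a Hardy martingale if, conditioned on $\mathcal{F}_{k-1}$, $\Delta G_k$ defines an element of $H_0^1(\mathbb{T})$; that is, for every $k$ and almost every $x\in\mathbb{T}^{k-1}$, the function $y\mapsto\Delta G_k(x,y)$ belongs to $H_0^1(\mathbb{T})$. Cosine martingale: $U=(U_k)$ is the martingale with $U_0=G_0$ and $$\Delta U_k(x,y)=\tfrac12\left[\Delta G_k(x,y)+\Delta G_k(x,\overline{y})\right],\qquad x\in\mathbb{T}^{k-1},\ y\in\mathbb{T}.$$ Dyadic $\sigma$-algebra: for $x=(x_k)\in\mathbb{T}^{\mathbb{N}}$ let $\sigma_k(x)=\operatorname{sign}(\operatorname{Re}x_k)$; $\mathcal{D}$ is the $\sigma$-algebra generated by $\{\sigma_k:k\in\mathbb{N}\}$. For a martingale $F=(F_k)$, $\mathbb{E}(F\mid\mathcal{D})$ denotes the sequence $(\mathbb{E}(F_k\mid\mathcal{D}))_k$, which is again a martingale with respect to $(\mathcal{F}_k)$. Martingale transform: $T_W(F)=\operatorname{Im}\left[\sum_k w_{k-1}\Delta_kF\right]$, regarded as the martingale with differences $\operatorname{Im}(w_{k-1}\Delta_kF)$, so that $\|T_W(F)\|_{\mathcal{P}}=\mathbb{E}\left[\left(\sum_k\mathbb{E}_{k-1}|\operatorname{Im}(w_{k-1}\Delta_kF)|^2\right)^{1/2}\right]$.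 *)

(* Defs.v *)
From HB Require Import structures.
From mathcomp Require Import all_boot all_order all_algebra.
From mathcomp Require Import all_classical all_reals all_analysis.
From mathcomp Require Import measurable_realfun.
From mathcomp.real_closed Require Import complex.

Set Implicit Arguments.
Unset Strict Implicit.
Unset Printing Implicit Defensive.
Import Order.TTheory GRing.Theory Num.Theory.
Import numFieldNormedType.Exports.

Local Open Scope classical_set_scope.
Local Open Scope complex_scope.
Local Open Scope ring_scope.

Section complex_valued.
Context d (T : measurableType d) (R : realType).
Variable mu : {measure set T -> \bar R}.

Definition abs2 (z : R[i]) : R := complex.Re z ^+ 2 + complex.Im z ^+ 2.

Definition cintegrable (f : T -> R[i]) : Prop :=
  mu.-integrable setT (fun x => (complex.Re (f x))%:E) /\
  mu.-integrable setT (fun x => (complex.Im (f x))%:E).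

Definition cintegral (f : T -> R[i]) : R[i] :=
  \int[mu]_x complex.Re (f x) +i* \int[mu]_x complex.Im (f x).

End complex_valued.

Section circle.
Variable R : realType.

Definition circle := {z : R[i] | `|z| == 1}.

Fact expi_subproof (t : R) : `|cos t +i* sin t| == 1.
Proof. by rewrite normc_def /= cos2Dsin2 sqrtr1. Qed.

Definition expi (t : R) : circle :=
  exist (fun z : R[i] => `|z| == 1) _ (expi_subproof t).

HB.instance Definition _ := Choice.on circle.
HB.instance Definition _ := isPointed.Build circle (expi 0).

(* The Borel sigma-algebra of the circle is induced by its embedding in R * R. *)
Definition circle_coords (z : circle) : R * R :=
  (complex.Re (val z), complex.Im (val z)).

HB.instance Definition _ :=
  Measurable.copy circle (g_sigma_algebra_preimageType circle_coords).

(* [uniform_prob] is a measure on the alias [measurableTypeR R] of R, whose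
   display differs from that of R. *)
Lemma measurable_expi :
  @measurable_fun _ _ (measurableTypeR R) circle setT expi.
Proof.
move=> _ _ [B mB <-].
have mcs : measurable_fun [set: R] (fun t : R => (cos t, sin t)).
  apply: measurable_fun_pair; apply: continuous_measurable_fun.
    exact: continuous_cos.
  exact: continuous_sin.
by move: (mcs measurableT B mB); rewrite !setTI.
Qed.

Definition expi_mfun : {mfun measurableTypeR R >-> circle} :=
  @mfun_Sub _ _ (measurableTypeR R) circle expi (mem_set measurable_expi).

Fact two_pi_gt0 : 0 < 2 * pi :> R.
Proof. by rewrite mulr_gt0 ?pi_gt0. Qed.

Definition haar : probability circle R :=
  distribution (uniform_prob two_pi_gt0) expi_mfun.

Fact circle_conj_subproof (z : circle) : `|(val z)^*| == 1.
Proof. by case: z => -[a b]; rewrite /= !normc_def /= sqrrN. Qed.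

Definition circle_conj (z : circle) : circle :=
  exist (fun z : R[i] => `|z| == 1) _ (circle_conj_subproof z).

Definition poisson_kernel (z : R[i]) (y : circle) : R :=
  (1 - abs2 z) / abs2 (val y - z).

Definition harmonic_extension (f : circle -> R[i]) (z : R[i]) : R[i] :=
  cintegral haar (fun y => (poisson_kernel z y)%:C * f y).

(* Analyticity on the open unit disk is complex differentiability at each of
   its points: R[i] is seen here as a normed space over itself. *)
Definition H10 (f : circle -> R[i]) : Prop :=
  [/\ cintegrable haar f,
      cintegral haar f = 0 &
      forall z : R[i], `|z| < 1 ->
        derivable (harmonic_extension f : R[i]^o -> R[i]^o) z 1].

End circle.

Section torus.
Variable R : realType.

(* Coordinates are numbered from 0: the k-th coordinate of the usual
   numbering x = (x_1, x_2, ...) is [x k.-1]. *)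
Definition sequence_cylinders : set (set (nat -> circle R)) :=
  \bigcup_i preimage_set_system setT (fun x => x i) measurable.

Definition torus := g_sigma_algebraType sequence_cylinders.

(* The countable product of [haar] is the unique probability satisfying this
   product rule; the library has no infinite product measures. *)
Definition product_haar (P : probability torus R) : Prop :=
  forall (n : nat) (A : nat -> set (circle R)), (forall i, measurable (A i)) ->
    P [set x | forall i, (i < n)%N -> A i (x i)] =
    (\big[*%E/1%E]_(i < n) haar R (A i))%E.

(* The sigma-algebra F_k is generated by the first k coordinates. *)
Definition coord_filtration (k : nat) : set (set torus) :=
  <<s \bigcup_(i in `I_k)
        preimage_set_system setT (fun x : torus => x i) measurable >>.

Definition dyadic_sign (k : nat) (x : torus) : R :=
  Num.sg (complex.Re (val (x k))).

Definition dyadic : set (set torus) :=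
  <<s \bigcup_k preimage_set_system setT (dyadic_sign k) measurable >>.

Definition set_coord (x : torus) (k : nat) (y : circle R) : torus :=
  fun i => if i == k then y else x i.

End torus.

Section conditional_expectation.
Context d (T : measurableType d) (R : realType) (P : probability T R).
Variable S : set (set T).

(* [S] is meant to be a sigma-algebra contained in [measurable]. The notion is
   used for integrable [f] and for measurable [f] with values in [0, +oo]. *)
Definition is_cond_exp (f g : T -> \bar R) : Prop :=
  measurable_fun setT (g : g_sigma_algebraType S -> \bar R) /\
  forall A, S A -> (\int[P]_(x in A) g x = \int[P]_(x in A) f x)%E.

(* A version of the conditional expectation; it is unique up to P-null sets. *)
Definition cond_exp (f : T -> \bar R) : T -> \bar R :=
  xget (cst 0%E) [set g | is_cond_exp f g].

Definition ccond_exp (f : T -> R[i]) (x : T) : R[i] :=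
  fine (cond_exp (fun y => (complex.Re (f y))%:E) x) +i*
  fine (cond_exp (fun y => (complex.Im (f y))%:E) x).

Definition cmeasurable (f : T -> R[i]) : Prop :=
  measurable_fun setT
    (fun x : g_sigma_algebraType S => complex.Re (f x)) /\
  measurable_fun setT
    (fun x : g_sigma_algebraType S => complex.Im (f x)).

End conditional_expectation.

(* A process (F_k)_{1 <= k <= n} is a function on [nat] of which only the values
   at 1, ..., n are used. *)
Section processes.
Variables (R : realType) (P : probability (torus R) R).
Implicit Types (F G W : nat -> torus R -> R[i]) (n k : nat).

Local Notation Fil := (@coord_filtration R).

Definition martingale n F : Prop :=
  (forall k, (1 <= k <= n)%N -> cmeasurable (Fil k) (F k) /\
                                cintegrable P (F k)) /\
  (forall k, (1 <= k < n)%N ->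
    {ae P, forall x, ccond_exp P (Fil k) (F k.+1) x = F k x}).

Definition with_start F k (x : torus R) : R[i] :=
  if k is 0 then cintegral P (F 1) else F k x.

Definition mdiff F k (x : torus R) : R[i] :=
  with_start F k x - with_start F k.-1 x.

Definition previsible_norm n F : \bar R :=
  (\int[P]_x sqrte (\sum_(1 <= k < n.+1)
     cond_exp P (Fil k.-1) (fun y => (abs2 (mdiff F k y))%:E) x))%E.

(* Each Delta G_k depends on the first k coordinates only, so its restriction
   to the last of them at (x_1, ..., x_{k-1}) is read off by overwriting this
   coordinate in x. Boundedness in L^1 follows from [martingale] since the
   time horizon is finite. *)
Definition hardy_martingale n G : Prop :=
  martingale n G /\
  forall k, (1 <= k <= n)%N ->
    {ae P, forall x, H10 (fun y => mdiff G k (set_coord x k.-1 y))}.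

Definition cosine_martingale G k (x : torus R) : R[i] :=
  with_start G 0 x + \sum_(1 <= j < k.+1)
    2^-1 * (mdiff G j x + mdiff G j (set_coord x j.-1 (circle_conj (x j.-1)))).

Definition dyadic_expectation F k : torus R -> R[i] :=
  ccond_exp P (@dyadic R) (F k).

Definition adapted W : Prop := forall k, cmeasurable (Fil k) (W k).

(* The partial sums, so that the differences are Im (w_{k-1} Delta_k F). *)
Definition transform W F k (x : torus R) : R[i] :=
  (\sum_(1 <= j < k.+1) complex.Im (W j.-1 x * mdiff F j x))%:C.

End processes.

(* Main.v *)
Require Import Defs.
From HB Require Import structures.
From mathcomp Require Import all_boot all_order all_algebra.
From mathcomp Require Import all_classical all_reals all_analysis.
From mathcomp Require Import measurable_realfun.
From mathcomp.real_closed Require Import complex.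
From mathcomp Require Import ring lra.

Set Implicit Arguments.
Unset Strict Implicit.
Unset Printing Implicit Defensive.
Import Order.TTheory GRing.Theory Num.Theory.
Import numFieldNormedType.Exports.
Local Open Scope classical_set_scope.
Local Open Scope complex_scope.
Local Open Scope ring_scope.

Local Notation Re := complex.Re.
Local Notation Im := complex.Im.

(** Write h_k for the k-th difference of G, s_k for the sign of the real part of
    the k-th coordinate, a_k for the conditional expectation of s_k h_k given the
    first k - 1 coordinates, and b_k = E(a_k | D). Since s_k is independent of the
    past and h_k has conditional mean zero, the differences of E(G | D) are the
    s_k b_k ([cdyadic_mean_diff]); as s_k is even, those of E(U | D) are the same.
    Once the first k - 1 coordinates are fixed, all the terms of the previsible
    norms therefore come from a function h = h_k(x, .) of one circle variable,
    its even part u, and the numbers a, b and w = w_(k-1).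

    The inequality rests on a property of one variable. If p is integrable with
    vanishing moments of order n >= 0, the mean of (Re p)^2 is at most that of
    (Im p)^2 ([analytic_Re_le]). Apply it to the symmetrization
    (w h(y) + conj(w h(conj y))) / 2, whose imaginary part is the odd part of
    Im (w h) and whose real part is the even part of Re (w h). As s b is even,
    splitting Im (w (h - s b)) into its even and odd parts shows that its energy A
    dominates the sum of the energies of Im (w (u - s b)) and Re (w u). Hence
    ([one_variable_bounds])
      |u - s b|^2 has mean at most 2 (A + (Re (w b))^2), and
      (Re (w a))^2 + (Im (w (a - b)))^2 <= A.

    Now sum over k and write |c| for the Euclidean norm of a family c = (c_k). The
    first inequality bounds the left-hand side of the theorem by twice the norm of
    the transform plus twice the mean of |Re (w b)|. The second one gives
    |a| <= |Im (w b)| + (sum of the A_k)^(1/2), while the mean of |b| is at most that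
    of |a| by Jensen's inequality ([dyadic_mean_norm]). So the mean of
    |b| - |Im (w b)| is at most the norm of the transform, and the Cauchy-Schwarz
    inequality applied to
      |Re (w b)| = (|b| - |Im (w b)|)^(1/2) (|b| + |Im (w b)|)^(1/2)
    bounds the mean of |Re (w b)| by the geometric mean of that norm and of twice
    the mean of |a|, which is at most the norm of G ([interpolation_estimate]).

    Three facts make this rigorous. A function whose harmonic extension is analytic
    has vanishing moments ([H10_moments]): the antiholomorphic part of the extension
    is the power series of the moments. The conditional expectation on F_k of a
    function of the first k + 1 coordinates integrates the last of them out
    ([is_cond_exp_Fil]). The conditional expectation on D of a function of the first
    n coordinates is its integral against the product of the 1 + s_i(x) s_i(z)
    ([is_cond_exp_dyadic]). *)

(** * Bounded pointwise limits of an algebra of functions *)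

Section bounded_limits.
Context d (T : measurableType d) (R : realType).
Variable A : (T -> R) -> Prop.
Hypothesis A_cst : forall c : R, A (cst c).
Hypothesis A_add : forall f g, A f -> A g -> A (f \+ g).
Hypothesis A_mul : forall f g, A f -> A g -> A (f \* g).
Hypothesis A_bnd : forall f, A f -> exists M : R, forall x, `|f x| <= M.

(** The closure is transfinite: measurable functions are reached only after
    iterating sequential limits, whence an inductive predicate. The uniform
    bound is what makes dominated convergence available at each limit. *)
Inductive bp_closure : (T -> R) -> Prop :=
| bp_base f : A f -> bp_closure f
| bp_lim (f_ : nat -> T -> R) f (M : R) : (forall n, bp_closure (f_ n)) ->
    (forall n x, `|f_ n x| <= M) ->
    (forall x, f_ ^~ x @ \oo --> f x) -> bp_closure f.

Lemma lim_le_bound (u : nat -> R) (l M : R) :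
  (forall n, `|u n| <= M) -> u @ \oo --> l -> `|l| <= M.
Proof.
move=> uM ul; have nul : `|u n| @[n --> \oo] --> `|l| by apply: cvg_norm.
rewrite -(cvg_lim _ nul)//; apply: limr_le; first by apply/cvg_ex; exists `|l|.
by near=> n; exact: uM.
Unshelve. all: by end_near. Qed.

Lemma bp_bounded f : bp_closure f -> exists M : R, forall x, `|f x| <= M.
Proof.
elim=> [g /A_bnd//|f_ g M _ _ fM fg]; exists M => x.
exact: (lim_le_bound (fM ^~ x) (fg x)).
Qed.

(** Induction on both arguments: a limit on the left is added to a fixed
    closure element, and a base function on the left reduces to an induction
    on the right. *)
Lemma bpD f g : bp_closure f -> bp_closure g -> bp_closure (f \+ g).
Proof.
move=> cf cg; elim: cf => {f}[f Af|f_ f M cf_ IH fM ff]; last first.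
  have [N gN] := bp_bounded cg.
  apply: (@bp_lim (fun n => f_ n \+ g) _ (M + N)) => //.
    by move=> n x /=; rewrite (le_trans (ler_normD _ _))// lerD.
  by move=> x; apply: cvgD; [exact: ff|exact: cvg_cst].
elim: cg => {g}[g Ag|g_ g M cg_ IH gM gg]; first exact/bp_base/A_add.
have [N fN] := A_bnd Af.
apply: (@bp_lim (fun n => f \+ g_ n) _ (N + M)) => //.
  by move=> n x /=; rewrite (le_trans (ler_normD _ _))// lerD.
by move=> x; apply: cvgD; [exact: cvg_cst|exact: gg].
Qed.

Lemma bpM f g : bp_closure f -> bp_closure g -> bp_closure (f \* g).
Proof.
move=> cf cg; elim: cf => {f}[f Af|f_ f M cf_ IH fM ff]; last first.
  have [N gN] := bp_bounded cg.
  apply: (@bp_lim (fun n => f_ n \* g) _ (M * N)) => //.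
    by move=> n x /=; rewrite normrM ler_pM.
  by move=> x; apply: cvgM; [exact: ff|exact: cvg_cst].
elim: cg => {g}[g Ag|g_ g M cg_ IH gM gg]; first exact/bp_base/A_mul.
have [N fN] := A_bnd Af.
apply: (@bp_lim (fun n => f \* g_ n) _ (N * M)) => //.
  by move=> n x /=; rewrite normrM ler_pM.
by move=> x; apply: cvgM; [exact: cvg_cst|exact: gg].
Qed.

Lemma bp_cst c : bp_closure (cst c). Proof. exact: bp_base. Qed.

Lemma bpZ c f : bp_closure f -> bp_closure (fun x => c * f x).
Proof. by move=> cf; apply: bpM => //; exact: bp_cst. Qed.

Lemma bp_sum I (s : seq I) (f : I -> T -> R) :
  (forall i, bp_closure (f i)) -> bp_closure (fun x => \sum_(i <- s) f i x).
Proof.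
move=> cf; elim: s => [|i s IH].
  by under eq_fun do rewrite big_nil; exact: bp_cst.
by under eq_fun do rewrite big_cons; exact: bpD.
Qed.

(** Newton's iteration for the sign: its iterates are polynomials, which
    converge to the sign on [-1, 1]. *)
Fixpoint sign_newton (n : nat) (t : R) : R :=
  if n is m.+1 then let s := sign_newton m t in s * (3 - s ^+ 2) / 2 else t.

Lemma sign_newtonN n t : sign_newton n (- t) = - sign_newton n t.
Proof. by elim: n => //= n ->; rewrite sqrrN; field. Qed.

(** The error e satisfies e' = e ((1 - s) (2 + s) / 2), and the second factor
    is at most 1 - t / 2 as long as s >= t. *)
Lemma sign_newton_pos n (t : R) : 0 <= t <= 1 ->
  t <= sign_newton n t <= 1 /\ 1 - sign_newton n t <= (1 - t / 2) ^+ n.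
Proof.
move=> t01; elim: n => [|n []] /=; first by rewrite expr0; lra.
set s := sign_newton n t => ts IH.
have e : 1 - s * (3 - s ^+ 2) / 2 = (1 - s) * ((1 - s) * (2 + s) / 2) by field.
have [s1 st] : s <= 1 /\ 0 <= s by split; lra.
have h1 : 0 <= (1 - s) * (1 - s) by rewrite mulr_ge0 ?subr_ge0.
have h2 : 0 <= s * (1 - s) by rewrite mulr_ge0 ?subr_ge0.
have h3 : 0 <= s * (1 - s) * (1 + s) by rewrite mulr_ge0//; lra.
have h4 : 0 <= (1 - s) * (1 - s) * (2 + s) by rewrite mulr_ge0//; lra.
split.
  have -> : s * (3 - s ^+ 2) / 2 = s + s * (1 - s) * (1 + s) / 2 by field.
  by apply/andP; split; [lra|nra].
by rewrite e exprSr ler_pM//; [lra|nra|nra].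
Qed.

Lemma sign_newton_bound n (t : R) : `|t| <= 1 -> `|sign_newton n t| <= 1.
Proof.
have [t0|t0] := leP 0 t => t1.
  have : 0 <= t <= 1 by rewrite t0 -(ger0_norm t0).
  by move=> /(sign_newton_pos n)[? _]; rewrite ler_norml; lra.
have : 0 <= - t <= 1 by rewrite oppr_ge0 ltW// -(ltr0_norm t0).
move=> /(sign_newton_pos n)[+ _]; rewrite sign_newtonN.
by rewrite ler_norml; lra.
Qed.

Lemma cvg_sign_newton_pos (t : R) : 0 < t <= 1 ->
  sign_newton ^~ t @ \oo --> (1 : R).
Proof.
move=> t01; have t01' : 0 <= t <= 1 by lra.
have : (1 - (1 - t / 2) ^+ n) @[n --> \oo] --> (1 - 0 : R).
  apply: cvgB; first exact: cvg_cst.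
  by apply: cvg_expr; rewrite ger0_norm; lra.
rewrite subr0 => h; apply: (squeeze_cvgr _ h (cvg_cst (1 : R))).
apply: nearW => n; have [] := sign_newton_pos n t01'.
by set s := sign_newton n t; move=> ? ?; apply/andP; split; lra.
Qed.

Lemma cvg_sign_newton (t : R) : `|t| <= 1 -> sign_newton ^~ t @ \oo --> Num.sg t.
Proof.
case: (sgrP t) => [-> _|t0 t1|t0 t1].
- have -> : sign_newton ^~ 0 = cst 0 :> (nat -> R).
    by apply/funext => n; elim: n => //= n ->; rewrite !mul0r.
  exact: cvg_cst.
- by apply: cvg_sign_newton_pos; rewrite t0.
- have : 0 < - t <= 1 by rewrite oppr_gt0 t0.
  move=> /cvg_sign_newton_pos/cvgN; apply: cvg_trans.
  apply: near_eq_cvg; apply: nearW => n /=.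
  by transitivity (- sign_newton n (- t)) => //; rewrite sign_newtonN opprK.
Qed.

Lemma bp_sign_newton n f : bp_closure f ->
  bp_closure (fun x => sign_newton n (f x)).
Proof.
move=> cf; elim: n => //= n IH; have c0 := bpM IH (bpM IH IH).
have := bpD (bpZ (3 / 2) IH) (bpZ (- 1 / 2) c0).
by congr bp_closure; apply/funext => x /=; field.
Qed.

(** After scaling into [-1, 1], the sign is the limit of polynomials in f, all
    bounded by 1. *)
Lemma bp_sg f : bp_closure f -> bp_closure (fun x => Num.sg (f x)).
Proof.
move=> cf; have [M fM] := bp_bounded cf.
pose N := Num.max M 1; have N0 : 0 < N by rewrite lt_max ltr01 orbT.
have fN x : `|N^-1 * f x| <= 1.
  rewrite normrM normfV (gtr0_norm N0) mulrC ler_pdivrMr// mul1r.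
  by rewrite (le_trans (fM x))// le_max lexx.
have -> : (fun x => Num.sg (f x)) = fun x => Num.sg (N^-1 * f x).
  by apply/funext => x; rewrite sgrM (gtr0_sg (x := N^-1)) ?invr_gt0// mul1r.
apply: (@bp_lim (fun n x => sign_newton n (N^-1 * f x)) _ 1).
- by move=> n; apply/bp_sign_newton/bpZ.
- by move=> n x; exact: sign_newton_bound.
- by move=> x; exact: cvg_sign_newton.
Qed.

Definition bp_set (E : set T) : Prop := bp_closure (\1_E : T -> R).

Lemma bp_set_gt f (c : R) : bp_closure f -> bp_set [set x | c < f x].
Proof.
move=> cf; pose s := fun x => Num.sg (f x + (- c)).
have cs : bp_closure s by apply: bp_sg; apply: bpD => //; exact: bp_cst.
have := bpD (bpZ (1 / 2) (bpM cs cs)) (bpZ (1 / 2) cs).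
congr bp_closure; apply/funext => x /=; rewrite indicE.
have -> : (x \in [set x | c < f x]) = (c < f x).
  by apply/idP/idP; rewrite inE.
rewrite /s -subr_gt0 -/(f x - c).
by case: sgrP => _ /=; [field|field|ring].
Qed.

(** Products and complements stay in the closure of the algebra, and countable
    unions are limits of finite ones. *)
Lemma sigma_algebra_bp : sigma_algebra setT bp_set.
Proof.
split.
- by rewrite /bp_set indic0; exact: bp_cst.
- move=> E cE; have := bpD (bp_cst 1) (bpZ (- 1) cE).
  congr bp_closure; apply/funext => x /=.
  by rewrite setTD !indicE in_setC; case: (x \in E) => /=; ring.
move=> E cE.
have bpI F G : bp_set F -> bp_set G -> bp_set (F `&` G).
  move=> cF cG; have := bpM cF cG; congr bp_closure.
  by apply/funext => x; rewrite indicI.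
have bpC F : bp_set F -> bp_set (~` F).
  move=> cF; have := bpD (bp_cst 1) (bpZ (- 1) cF).
  congr bp_closure; apply/funext => x /=.
  by rewrite !indicE in_setC; case: (x \in F) => /=; ring.
have bpbig n : bp_set (\big[setU/set0]_(i < n) E i).
  elim: n => [|n IH].
    by rewrite big_ord0 /bp_set indic0; exact: bp_cst.
  rewrite big_ord_recr /=.
  have -> : \big[setU/set0]_(i < n) E i `|` E n =
    ~` (~` (\big[setU/set0]_(i < n) E i) `&` ~` E n) by rewrite setCI !setCK.
  by apply/bpC/bpI; apply: bpC.
apply: (@bp_lim (fun n => \1_(\big[setU/set0]_(i < n) E i)) _ 1) => //.
  by move=> n x; rewrite indicE; case: (_ \in _); rewrite ?normr1 ?normr0.
move=> x; rewrite [in X in _ --> X]indicE.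
have [|xE] := boolP (x \in _).
  rewrite inE => -[k _ Ekx] /=; apply: cvg_near_cst.
  exists k.+1 => // n /= kn; rewrite indicE mem_set//.
  by rewrite -bigcup_mkord; exists k.
apply: cvg_near_cst; apply: nearW => n /=; rewrite indicE memNset//.
rewrite -bigcup_mkord => -[k /= kn Ekx].
by move/negP: xE; apply; rewrite inE; exists k.
Qed.

Lemma bp_set_preimage f (B : set R) : bp_closure f -> measurable B ->
  bp_set (f @^-1` B).
Proof.
move=> cf mB; have [b0 bC bU] := sigma_algebra_bp.
have {}mB : (@RGenOInfty.G R).-sigma.-measurable B.
  by rewrite -RGenOInfty.measurableE.
apply: (@smallest_sub _ (sigma_algebra setT) (@RGenOInfty.G R)
  (fun B => bp_set (f @^-1` B))) => //.
- split.
  + by rewrite preimage_set0.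
  + by move=> C cC; rewrite setTD preimage_setC -setTD; exact: bC.
  + by move=> F cF; rewrite preimage_bigcup; exact: bU.
- move=> _ [c ->].
  have -> : f @^-1` `]c, +oo[ = [set x | c < f x].
    by apply/seteqP; split => x /=; rewrite in_itv/= andbT.
  exact: bp_set_gt.
Qed.

Import HBNNSimple.

(** Simple functions are in the closure as soon as indicators of measurable
    sets are; both parts of f are limits of such functions with the same
    bound. *)
Lemma bp_measurable_fun (f : T -> R) :
  (forall E, measurable E -> bp_set E) ->
  measurable_fun setT f -> (exists M : R, forall x, `|f x| <= M) -> bp_closure f.
Proof.
move=> msub mf [M fM].
have pos (g : T -> R) : measurable_fun setT g -> (forall x, 0 <= g x <= M) -> bp_closure g.
  move=> mg g0M.
  have mEg : measurable_fun setT (EFin \o g) by exact/measurable_EFinP.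
  have g0 x : (@setT T) x -> (0 <= (EFin \o g) x)%E.
    by move=> _; rewrite lee_fin; have /andP[] := g0M x.
  pose h := nnsfun_approx measurableT mEg.
  apply: (@bp_lim (fun n x => h n x) g M).
  - move=> n; have -> : (fun x => h n x) =
        fun x => \sum_(y \in range (h n)) y * \1_(h n @^-1` [set y]) x.
      by apply/funext => x; exact: fimfunE.
    have fin : finite_set (range (h n)) by [].
    under eq_fun do rewrite fsbig_finite//=.
    by apply: bp_sum => y; apply/bpZ/msub; exact: measurable_funPTI.
  - move=> n x; have hx : 0 <= h n x by [].
    rewrite ger0_norm//; have /andP[_] := g0M x; apply: le_trans.
    rewrite -lee_fin; by rewrite nnsfun_approxE; exact: (le_approx n g0).
  - move=> x; have := cvg_nnsfun_approx measurableT mEg g0 I.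
    by move=> /(_ x) /fine_cvg.
have -> : f = (f^\+)%R \+ (fun x => - 1 * (f^\-)%R x).
  by apply/funext => x /=; rewrite mulN1r -[in LHS](funrposBneg f).
apply: bpD.
  apply: pos; first exact: measurable_funrpos.
  move=> x; have := fM x; rewrite ler_norml /funrpos le_max lexx orbT ge_max /=.
  by move=> ?; apply/andP; split; lra.
apply/bpZ/pos; first exact: measurable_funrneg.
move=> x; have := fM x; rewrite ler_norml /funrneg le_max lexx orbT ge_max /=.
by move=> ?; apply/andP; split; lra.
Qed.

End bounded_limits.

(** * Complex-valued integrals *)

Section complex_parts.
Context (R : rcfType).
Implicit Types x y : R[i].

Lemma cReD x y : Re (x + y) = Re x + Re y. Proof. by case: x; case: y. Qed.
Lemma cImD x y : Im (x + y) = Im x + Im y. Proof. by case: x; case: y. Qed.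
Lemma cReN x : Re (- x) = - Re x. Proof. by case: x. Qed.
Lemma cImN x : Im (- x) = - Im x. Proof. by case: x. Qed.
Lemma cReM x y : Re (x * y) = Re x * Re y - Im x * Im y.
Proof. by case: x; case: y. Qed.
Lemma cImM x y : Im (x * y) = Re x * Im y + Im x * Re y.
Proof. by case: x; case: y. Qed.
Lemma cReJ x : Re x^* = Re x. Proof. by case: x. Qed.
Lemma cImJ x : Im x^* = - Im x. Proof. by case: x. Qed.
Lemma complex_ext x y : Re x = Re y -> Im x = Im y -> x = y.
Proof. by case: x; case: y => a b c d /= -> ->. Qed.

Lemma normc_le_parts x (M : R) :
  `|x| <= M%:C -> `|Re x| <= M /\ `|Im x| <= M.
Proof.
rewrite normc_def lecR => xM; split; apply: le_trans xM; rewrite -sqrtr_sqr.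
  by apply: ler_wsqrtr; rewrite lerDl sqr_ge0.
by apply: ler_wsqrtr; rewrite lerDr sqr_ge0.
Qed.

Lemma Re_scale (t : R) x : Re (t%:C * x) = t * Re x.
Proof. by rewrite cReM /= mul0r subr0. Qed.

Lemma Im_scale (t : R) x : Im (t%:C * x) = t * Im x.
Proof. by rewrite cImM /= mul0r addr0. Qed.

Lemma natC n : (n%:R : R)%:C = n%:R. Proof. exact: rmorph_nat. Qed.

Lemma halfC : 2^-1 = (2^-1 : R)%:C.
Proof. by rewrite fmorphV /= natC. Qed.

Lemma Re_half x : Re (2^-1 * x) = Re x / 2.
Proof. by rewrite halfC Re_scale mulrC. Qed.

Lemma Im_half x : Im (2^-1 * x) = Im x / 2.
Proof. by rewrite halfC Im_scale mulrC. Qed.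

Definition partsE := (cReD, cImD, cReN, cImN, cReM, cImM, cReJ, cImJ).

End complex_parts.

Section complex_integral.
Context d (T : measurableType d) (R : realType) (mu : {measure set T -> \bar R}).
Implicit Types f g : T -> R[i].

Definition cmeas f := measurable_fun setT (fun x => Re (f x)) /\
  measurable_fun setT (fun x => Im (f x)).

Lemma cmeasD f g : cmeas f -> cmeas g -> cmeas (fun x => f x + g x).
Proof.
move=> [? ?] [? ?]; split; under eq_fun do rewrite !partsE;
 exact: measurable_funD.
Qed.

Lemma cmeasN f : cmeas f -> cmeas (fun x => - f x).
Proof.
by move=> [? ?]; split; under eq_fun do rewrite !partsE; exact: measurable_funN.
Qed.

Lemma cmeasM f g : cmeas f -> cmeas g -> cmeas (fun x => f x * g x).
Proof.
move=> [? ?] [? ?]; split; under eq_fun do rewrite !partsE.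
  by apply: measurable_funB; exact: measurable_funM.
by apply: measurable_funD; exact: measurable_funM.
Qed.

Lemma cmeasJ f : cmeas f -> cmeas (fun x => (f x)^*).
Proof.
move=> [mR mI]; split; under eq_fun do rewrite !partsE; first exact: mR.
exact: measurable_funN.
Qed.

Lemma cmeas_cst c : cmeas (fun=> c). Proof. by []. Qed.

Lemma cmeasX f n : cmeas f -> cmeas (fun x => f x ^+ n).
Proof.
move=> mf; elim: n => [|n IH]; first exact: cmeas_cst.
by under eq_fun do rewrite exprS; exact: cmeasM.
Qed.

Lemma cintegrable_cmeas f : cintegrable mu f -> cmeas f.
Proof.
by move=> [/measurable_int/measurable_EFinP ? /measurable_int/measurable_EFinP ?].
Qed.

Lemma cintegrableD f g : cintegrable mu f -> cintegrable mu g ->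
  cintegrable mu (fun x => f x + g x).
Proof.
by move=> [? ?] [? ?]; split; under eq_fun do rewrite !partsE EFinD;
  exact: integrableD.
Qed.

Lemma cintegrableJ f : cintegrable mu f -> cintegrable mu (fun x => (f x)^*).
Proof.
move=> [iR iI]; split; under eq_fun do rewrite !partsE ?EFinN; first exact: iR.
exact: integrableN.
Qed.

Lemma cintegrableM f g (M : R) : cmeas g ->
  (forall x, `|Re (g x)| <= M) -> (forall x, `|Im (g x)| <= M) ->
  cintegrable mu f -> cintegrable mu (fun x => g x * f x).
Proof.
move=> [mRg mIg] RgM IgM [iRf iIf].
have bd (h : T -> R) k : measurable_fun setT h -> (forall x, `|h x| <= M) ->
    mu.-integrable setT (EFin \o k) ->
    mu.-integrable setT (fun x => (h x * k x)%:E).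
  move=> mh hM; apply: integrableMr => //.
  exists M; split; first exact: num_real.
  by move=> r Mr x _ /=; rewrite (le_trans (hM x))// ltW.
split; under eq_fun do rewrite !partsE ?EFinD ?EFinN.
  by apply: integrableB => //; exact: bd.
by apply: integrableD => //; exact: bd.
Qed.

Lemma cintegrableZ c f : cintegrable mu f -> cintegrable mu (fun x => c * f x).
Proof.
apply: (@cintegrableM _ _ (Num.max `|Re c| `|Im c|)) => [|_|_].
- exact: cmeas_cst.
- by rewrite le_max lexx.
- by rewrite le_max lexx orbT.
Qed.

Lemma cintegrableN f : cintegrable mu f -> cintegrable mu (fun x => - f x).
Proof.
by move=> /(cintegrableZ (-1)); under eq_fun do rewrite mulN1r.
Qed.

Lemma cintegrableB f g : cintegrable mu f -> cintegrable mu g ->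
  cintegrable mu (fun x => f x - g x).
Proof. by move=> ? ?; apply: cintegrableD => //; exact: cintegrableN. Qed.

Lemma cintegralD f g : cintegrable mu f -> cintegrable mu g ->
  cintegral mu (fun x => f x + g x) = cintegral mu f + cintegral mu g.
Proof.
move=> [? ?] [? ?]; apply: complex_ext; rewrite !partsE /=.
  by under eq_Rintegral do rewrite !partsE; rewrite RintegralD.
by under eq_Rintegral do rewrite !partsE; rewrite RintegralD.
Qed.

Lemma cintegralZ c f : cintegrable mu f ->
  cintegral mu (fun x => c * f x) = c * cintegral mu f.
Proof.
move=> [iR iI].
have iZ (r : R) h : mu.-integrable setT (EFin \o h) ->
  mu.-integrable setT (EFin \o (fun x => r * h x)) by exact: integrableZl.
apply: complex_ext; rewrite !partsE /=; under eq_Rintegral do rewrite !partsE.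
  by rewrite RintegralB ?RintegralZl//; exact: iZ.
by rewrite RintegralD ?RintegralZl//; exact: iZ.
Qed.

Lemma cintegralN f : cintegrable mu f ->
  cintegral mu (fun x => - f x) = - cintegral mu f.
Proof.
by move=> fi; under eq_fun do rewrite -mulN1r; rewrite cintegralZ ?mulN1r.
Qed.

Lemma cintegralB f g : cintegrable mu f -> cintegrable mu g ->
  cintegral mu (fun x => f x - g x) = cintegral mu f - cintegral mu g.
Proof.
by move=> ? ?; rewrite cintegralD ?cintegralN//; exact: cintegrableN.
Qed.

Lemma cintegralJ f : cintegrable mu f ->
  cintegral mu (fun x => (f x)^*) = (cintegral mu f)^*.
Proof.
move=> [? ?]; apply: complex_ext; rewrite !partsE /=.
  by under eq_Rintegral do rewrite !partsE.
under eq_Rintegral do rewrite !partsE -mulN1r.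
by rewrite RintegralZl// mulN1r.
Qed.

Lemma cintegral_le f (g : T -> R) : cintegrable mu f ->
  mu.-integrable setT (EFin \o g) ->
  (forall x, `|Re (f x)| <= g x) -> (forall x, `|Im (f x)| <= g x) ->
  `|cintegral mu f| <= (2 * \int[mu]_x g x)%:C.
Proof.
move=> [iR iI] ig Rg Ig.
have rle h : mu.-integrable setT (EFin \o h) -> (forall x, `|h x| <= g x) ->
    `|\int[mu]_x h x| <= \int[mu]_x g x.
  move=> ih hg; rewrite (le_trans (le_normr_Rintegral _ _))//.
  by apply: le_Rintegral => //; exact: integrable_norm.
have := rle _ iR Rg; have := rle _ iI Ig; rewrite normc_def lecR /=.
set a := \int[mu]_x Re _; set b := \int[mu]_x Im _; set c := \int[mu]_x g x.
move=> bc ac; have c0 : 0 <= c := le_trans (normr_ge0 _) ac.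
rewrite (_ : 2 * c = Num.sqrt ((2 * c) ^+ 2)); last first.
  by rewrite sqrtr_sqr ger0_norm// mulr_ge0.
by apply: ler_wsqrtr; move: ac bc; rewrite !ler_norml; nra.
Qed.

End complex_integral.

Lemma cintegrable_cst d (T : measurableType d) (R : realType) (P : probability T R)
  (c : R[i]) : cintegrable P (fun=> c).
Proof. by split; exact: finite_measure_integrable_cst. Qed.

Lemma cintegral_cst d (T : measurableType d) (R : realType) (P : probability T R)
  (c : R[i]) : cintegral P (fun=> c) = c.
Proof.
have P1 : fine (P setT) = 1 by rewrite probability_setT.
by apply: complex_ext; rewrite /= Rintegral_cst// P1 mulr1.
Qed.

(** * Trigonometric polynomials on the circle *)

Section trig_poly.
Variable R : realType.
Implicit Types (y : circle R) (Q : {poly R[i]}).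

(** On the circle the inverse of y is its conjugate, so the real parts of
    polynomials in y are all the real trigonometric polynomials. *)
Definition trig_poly (f : circle R -> R) :=
  exists Q, forall y, f y = Re Q.[val y].

Lemma circle_mulJ y : val y * (val y)^* = 1.
Proof. by rewrite -sqr_normc (eqP (valP y)) expr1n. Qed.

Lemma normV y : `|val y| = 1. Proof. exact/eqP/(valP y). Qed.

Lemma trig_cst c : trig_poly (cst c).
Proof. by exists (c%:C)%:P => y; rewrite hornerC. Qed.

Lemma trig_add f g : trig_poly f -> trig_poly g -> trig_poly (f \+ g).
Proof.
by move=> [Q fQ] [S gS]; exists (Q + S) => y /=; rewrite hornerD cReD fQ gS.
Qed.

(** Closure under products comes from this lemma: since y times its conjugate
    is 1, one factor y cancels against one conjugate at each step, and what is
    left is a polynomial in y or in its conjugate. *)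
Lemma trig_horner_conj Q S : trig_poly (fun y => Re (Q.[val y] * S.[val y]^*)).
Proof.
elim/poly_ind: S Q => [|S d IH] Q.
  by exists 0 => y; rewrite !horner0 rmorph0 mulr0.
elim/poly_ind: Q => [|Q e _].
  by exists 0 => y; rewrite !horner0 mul0r.
have [A hA] := IH Q.
exists (A + e^*%:P * ('X * S) + (d^*)%:P * (Q * 'X + e%:P)) => y.
rewrite !(hornerD, hornerM, hornerC, hornerX) !cReD -hA; have := circle_mulJ y.
move: (val y) Q.[_] S.[_] => z q s zz.
rewrite [X in _ = _ + X + _](_ : _ = Re (e * (z^* * s^*))); last first.
  by rewrite !partsE; ring.
rewrite -!cReD; congr Re; rewrite rmorphD /= rmorphM /=.
transitivity (q * s^* * (z * z^*) + e * (z^* * s^*) + d^* * (q * z + e)).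
  by ring.
by rewrite zz mulr1.
Qed.

(** Re q Re s = Re (q s + q conj(s)) / 2. *)
Lemma trig_mul f g : trig_poly f -> trig_poly g -> trig_poly (f \* g).
Proof.
move=> [Q fQ] [S gS]; have [A hA] := trig_horner_conj Q S.
exists ((2^-1)%:P * (Q * S + A)) => y /=; rewrite fQ gS.
rewrite hornerM hornerC hornerD hornerM Re_half cReD -hA !partsE.
by field.
Qed.

Lemma horner_circle_bounded Q : exists M : R, forall y,
  `|Re Q.[val y]| <= M /\ `|Im Q.[val y]| <= M.
Proof.
suff [M QM] : exists M : R, forall y, `|Q.[val y]| <= M%:C.
  by exists M => y; exact: normc_le_parts.
elim/poly_ind: Q => [|Q c [M QM]].
  by exists 0 => y; rewrite horner0 normr0.
exists (M + Re `|c|) => y; rewrite !hornerE rmorphD /=.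
rewrite (le_trans (ler_normD _ _))// lerD//.
  by rewrite normrM (eqP (valP y)) mulr1; exact: QM.
Qed.

Lemma trig_bounded f : trig_poly f -> exists M : R, forall y, `|f y| <= M.
Proof.
move=> [Q fQ]; have [M QM] := horner_circle_bounded Q.
by exists M => y; rewrite fQ; have [] := QM y.
Qed.

Lemma measurable_circle_coords :
  measurable_fun setT (@circle_coords R : circle R -> R * R).
Proof. by move=> _ B mB; rewrite setTI; exists B => //; rewrite setTI. Qed.

Lemma cmeas_circle : cmeas (fun y : circle R => val y).
Proof.
have := measurable_circle_coords; move=> /measurable_fun_pairP[]; by split.
Qed.

Lemma cmeas_horner Q : cmeas (fun y : circle R => Q.[val y]).
Proof.
elim/poly_ind: Q => [|Q c IH].
  by under eq_fun do rewrite horner0; exact: cmeas_cst.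
under eq_fun do rewrite !hornerE.
by apply: cmeasD; [apply: cmeasM|exact: cmeas_cst]; last exact: cmeas_circle.
Qed.

(** The Borel sets of the circle are generated by the two coordinates, which
    are trigonometric polynomials. *)
Lemma measurable_circle_bp E : measurable E -> bp_set (@trig_poly) E.
Proof.
pose bpS := sigma_algebra_bp trig_cst trig_add trig_mul trig_bounded.
have [b0 bC bU] := bpS.
move=> [B mB <-]; rewrite setTI.
have {}mB : <<s preimage_set_system setT (@fst R R) measurable `|`
  preimage_set_system setT (@snd R R) measurable >> B := mB.
move: B mB; apply: (@smallest_sub _ (sigma_algebra setT) _
  (fun B : set (R * R) => bp_set (@trig_poly) (@circle_coords R @^-1` B))) => //.
- split.
  + by rewrite preimage_set0.
  + by move=> C cC; rewrite setTD preimage_setC -setTD; exact: bC.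
  + by move=> F cF; rewrite preimage_bigcup; exact: bU.
have pre f B : trig_poly f -> measurable B -> bp_set (@trig_poly) (f @^-1` B).
  move=> tf; apply: (bp_set_preimage trig_cst trig_add trig_mul trig_bounded).
  exact: bp_base.
move=> _ [] [B mB <-]; rewrite setTI -comp_preimage.
  by apply: pre => //; exists 'X => y; rewrite hornerX.
apply: pre => //; exists ((- 'i)%:P * 'X) => y.
by rewrite !hornerE !partsE /=; ring.
Qed.

Lemma measurable_fun_circle_bp (f : circle R -> R) : measurable_fun setT f ->
  (exists M : R, forall y, `|f y| <= M) -> bp_closure (@trig_poly) f.
Proof.
apply: (bp_measurable_fun trig_cst trig_add trig_mul trig_bounded).
exact: measurable_circle_bp.
Qed.

End trig_poly.

(** * Real integrals on a probability space *)

Section real_integrals.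
Context d (T : measurableType d) (R : realType) (P : probability T R).
Implicit Types f g : T -> R.

Lemma bounded_integrable f (M : R) : measurable_fun setT f ->
  (forall x, `|f x| <= M) -> P.-integrable setT (EFin \o f).
Proof.
move=> mf fM; apply: measurable_bounded_integrable => //.
  by rewrite (@le_lt_trans _ _ 1%E) ?probability_le1// ltry.
exists M; split; first exact: num_real.
by move=> r Mr x _ /=; rewrite (le_trans (fM x))// ltW.
Qed.

Lemma integrable_mulb f g (M : R) : measurable_fun setT g ->
  (forall x, `|g x| <= M) -> P.-integrable setT (EFin \o f) ->
  P.-integrable setT (EFin \o (fun x => g x * f x)).
Proof.
move=> mg gM fi.
have : P.-integrable setT ((EFin \o g) \* (EFin \o f))%E.
  apply: integrableMr => //.
  exists M; split; first exact: num_real.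
  by move=> r Mr x _ /=; rewrite (le_trans (gM x))// ltW.
by [].
Qed.

Lemma integrable_mul_sqr f g : measurable_fun setT f -> measurable_fun setT g ->
  P.-integrable setT (EFin \o (fun x => f x ^+ 2)) ->
  P.-integrable setT (EFin \o (fun x => g x ^+ 2)) ->
  P.-integrable setT (EFin \o (fun x => f x * g x)).
Proof.
move=> mf mg f2 g2; apply: (le_integrable _ _ _ (integrableD _ f2 g2)) => //.
  exact/measurable_EFinP/measurable_funM.
move=> x _ /=; rewrite lee_fin (le_trans _ (ler_norm _))// ler_norml.
by apply/andP; split; nra.
Qed.

Lemma Rintegral_cauchy_schwarz f g :
  measurable_fun setT f -> measurable_fun setT g ->
  P.-integrable setT (EFin \o (fun x => f x ^+ 2)) ->
  P.-integrable setT (EFin \o (fun x => g x ^+ 2)) ->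
  (\int[P]_x (f x * g x)) ^+ 2 <=
  (\int[P]_x (f x ^+ 2)) * (\int[P]_x (g x ^+ 2)).
Proof.
move=> mf mg f2 g2; have fg := integrable_mul_sqr mf mg f2 g2.
set A := \int[P]_x (f x ^+ 2); set B := \int[P]_x (g x ^+ 2).
set D := \int[P]_x (f x * g x).
have iZ (r : R) h : P.-integrable setT (EFin \o h) ->
  P.-integrable setT (EFin \o (fun x => r * h x)) by exact: integrableZl.
(* The energy of f - s D g. For B = 0 a suitable s contradicts D <> 0. *)
have q (s : R) : 0 <= A - 2 * s * D ^+ 2 + s ^+ 2 * D ^+ 2 * B.
  have : 0 <= \int[P]_x ((f x - s * D * g x) ^+ 2).
    by apply: Rintegral_ge0 => x _; exact: sqr_ge0.
  congr (_ <= _).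
  transitivity (\int[P]_x (f x ^+ 2 +
    ((- 2 * s * D) * (f x * g x) + (s * D) ^+ 2 * g x ^+ 2))).
    by apply: eq_Rintegral => x _; ring.
  rewrite RintegralD//.
    rewrite RintegralD ?RintegralZl ?iZ// -/A -/B -/D; first by ring.
  by apply: (@integrableD _ _ _ _ _ _ (EFin \o _) (EFin \o _)); rewrite ?iZ.
have B0 : 0 <= B by apply: Rintegral_ge0 => x _; exact: sqr_ge0.
have A0 : 0 <= A by apply: Rintegral_ge0 => x _; exact: sqr_ge0.
have [B00|Bn0] := eqVneq B 0; last first.
  have Bp : 0 < B by rewrite lt_neqAle eq_sym Bn0.
  have := q B^-1; rewrite (_ : A - _ + _ = A - D ^+ 2 / B); last by field.
  by rewrite subr_ge0 ler_pdivrMr.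
rewrite B00 mulr0; have [->|D0] := eqVneq D 0; first by rewrite expr0n.
have := q ((A + 1) / (2 * D ^+ 2)); rewrite B00 mulr0 addr0.
have -> : A - 2 * ((A + 1) / (2 * D ^+ 2)) * D ^+ 2 = - 1 by field.
by rewrite oppr_ge0 ler10.
Qed.

Lemma dominated_Rintegral (f_ : nat -> T -> R) f g :
  (forall n, measurable_fun setT (f_ n)) ->
  (forall x, f_ ^~ x @ \oo --> f x) ->
  P.-integrable setT (EFin \o g) -> (forall n x, `|f_ n x| <= g x) ->
  (fun n => \int[P]_x f_ n x) @ \oo --> \int[P]_x f x.
Proof.
move=> mf_ ff gi fg; have mf : measurable_fun setT f.
  by apply: (@measurable_fun_cvg _ _ _ _ f_) => // x _; exact: ff.
have mE n : measurable_fun setT (EFin \o f_ n) by exact/measurable_EFinP.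
have mEf : measurable_fun setT (EFin \o f) by exact/measurable_EFinP.
have cE : {ae P, forall x, setT x -> (EFin \o f_ n) x @[n --> \oo] --> (f x)%:E}.
  by apply: aeW => x _; apply: cvg_EFin; [exact: nearW|exact: ff].
have bE : {ae P, forall x n, setT x -> (`|(EFin \o f_ n) x| <= (g x)%:E)%E}.
  by apply: aeW => x n _; rewrite lee_fin.
have [fi _ cf] := dominated_convergence measurableT mE mEf cE gi bE.
apply: fine_cvg; rewrite fineK//; exact: integrable_fin_num.
Qed.

Lemma integrable_ge0_lty f : measurable_fun setT f -> (forall x, 0 <= f x) ->
  (\int[P]_x (f x)%:E < +oo)%E -> P.-integrable setT (EFin \o f).
Proof.
move=> mf f0 foo; apply/integrableP; split; first exact/measurable_EFinP.
by under eq_integral do rewrite gee0_abs ?lee_fin//.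
Qed.

End real_integrals.

(** * Measures on the circle with vanishing moments *)

Section circle_moments.
Variable R : realType.
Implicit Types (mu nu : probability (circle R) R) (f : circle R -> R).

Definition zero_moments mu :=
  forall n, (0 < n)%N -> cintegral mu (fun y => val y ^+ n) = 0.

Lemma cintegrable_horner mu Q : cintegrable mu (fun y => Q.[val y]).
Proof.
have [M QM] := horner_circle_bounded Q; have [mR mI] := cmeas_horner Q.
by split; apply: (@bounded_integrable _ _ _ _ _ M) => // y; have [] := QM y.
Qed.

Lemma cintegrable_circleX mu n : cintegrable mu (fun y => val y ^+ n).
Proof.
have := cintegrable_horner mu 'X^n.
by under eq_fun do rewrite hornerXn.
Qed.

Lemma circleX_mul_integrable mu n g : cintegrable mu g ->
  cintegrable mu (fun y => val y ^+ n * g y).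
Proof.
have yn (y : circle R) : `|val y ^+ n| <= 1%:C by rewrite normrX normV expr1n.
apply: (cintegrableM (M := 1)) => [|y|y]; first exact/cmeasX/cmeas_circle.
  by have [] := normc_le_parts (yn y).
by have [] := normc_le_parts (yn y).
Qed.

Lemma zero_moments_hornerX mu Q k : zero_moments mu ->
  cintegral mu (fun y => val y ^+ k * Q.[val y]) = if k is 0 then Q.[0] else 0.
Proof.
move=> mu0; elim/poly_ind: Q k => [|Q c IH] k.
  under eq_fun do rewrite horner0 mulr0.
  by rewrite cintegral_cst horner0; case: k.
have -> : (fun y : circle R => val y ^+ k * (Q * 'X + c%:P).[val y]) =
    fun y => val y ^+ k.+1 * Q.[val y] + c * val y ^+ k.
  by apply/funext => y; rewrite !hornerE exprS; ring.
have iQ : cintegrable mu (fun y => val y ^+ k.+1 * Q.[val y]).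
  have := cintegrable_horner mu ('X^(k.+1) * Q).
  by under eq_fun do rewrite !hornerE.
rewrite cintegralD//; last exact/cintegrableZ/cintegrable_circleX.
rewrite cintegralZ; last exact: cintegrable_circleX.
rewrite IH add0r; case: k {iQ} => [|k]; last by rewrite mu0// mulr0.
under eq_fun do rewrite expr0.
by rewrite cintegral_cst !hornerE ?mulr1.
Qed.

Lemma zero_moments_horner mu Q : zero_moments mu ->
  cintegral mu (fun y => Q.[val y]) = Q.[0].
Proof.
move=> /(zero_moments_hornerX Q 0) <-.
by under [in RHS]eq_fun do rewrite expr0 mul1r.
Qed.

Lemma bp_trig_measurable f : bp_closure (@trig_poly R) f ->
  measurable_fun setT f /\ exists M : R, forall y, `|f y| <= M.
Proof.
move=> cf; split; last exact: (bp_bounded (@trig_bounded R)).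
elim: cf => {f}[f [Q fQ]|f_ f M _ mf_ _ ff].
  have -> : f = fun y => Re Q.[val y] by apply/funext.
  by have [] := cmeas_horner Q.
by apply: (@measurable_fun_cvg _ _ _ _ f_) => // x _; exact: ff.
Qed.

(** Integrals of trigonometric polynomials depend on the moments only. By
    dominated convergence equality extends to the bounded pointwise closure,
    that is, to all indicators. The common value of the moments is fixed here
    to that of the Haar measure. *)
Lemma zero_moments_unique mu nu E : zero_moments mu -> zero_moments nu ->
  measurable E -> mu E = nu E.
Proof.
move=> mu0 nu0 mE.
have eqi f : bp_closure (@trig_poly R) f -> \int[mu]_x f x = \int[nu]_x f x.
  elim => {f}[f [Q fQ]|f_ f M cf_ IH fM ff].
    under eq_Rintegral do rewrite fQ.
    under [RHS]eq_Rintegral do rewrite fQ.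
    rewrite -[LHS]/(Re (cintegral mu (fun y => Q.[val y]))).
    rewrite -[RHS]/(Re (cintegral nu (fun y => Q.[val y]))).
    by rewrite !zero_moments_horner.
  have mf_ n : measurable_fun setT (f_ n) by have [] := bp_trig_measurable (cf_ n).
  have iM (m : probability (circle R) R) :
      m.-integrable setT (EFin \o (cst M : circle R -> R)).
    by apply: (@bounded_integrable _ _ _ _ _ `|M|).
  have cmu := dominated_Rintegral mf_ ff (iM mu) fM.
  have cnu := dominated_Rintegral mf_ ff (iM nu) fM.
  have e : (fun n => \int[mu]_x f_ n x) = fun n => \int[nu]_x f_ n x.
    by apply/funext => n; exact: IH.
  by rewrite e in cmu; exact: (cvg_unique _ cmu cnu).
have := eqi _ (measurable_circle_bp mE).
rewrite /Rintegral !integral_indic// !setIT => e; have := congr1 EFin e.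
by rewrite !fineK// fin_num_measure.
Qed.

End circle_moments.

(** * Haar measure on the circle and the sign of the real part *)

Section haar_facts.
Variable R : realType.
Local Notation haar := (haar R).
Implicit Types (y : circle R) (f : circle R -> R).

Lemma val_expiX n (t : R) : val (expi t) ^+ n = cos (n%:R * t) +i* sin (n%:R * t).
Proof.
elim: n => [|n IH]; first by rewrite expr0 mul0r cos0 sin0.
rewrite exprS IH /= -natr1 mulrDl mul1r cosD sinD.
by apply: complex_ext => /=; ring.
Qed.

(** Adding 1 makes the integrand nonnegative, so that the formulas for the
    integral of nonnegative functions against a pushforward and a uniform law
    apply; the fundamental theorem of calculus is then used on t + G t. *)
Lemma haar_mean0 (g G : R -> R) (f : circle R -> R) :
  (forall t, is_derive t (1 : R) G (g t)) -> continuous g ->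
  G 0 = G (2 * pi) -> (forall y, `|f y| <= 1) ->
  measurable_fun setT f -> (forall t, f (expi t) = g t) ->
  \int[haar]_y f y = 0.
Proof.
move=> dG cg G02 g1 mf fg; have pi0 := two_pi_gt0 R.
have m1 : measurable_fun setT (fun y => (1 + f y)%:E).
  by apply/measurable_EFinP/measurable_funD.
have f0 y : 0 <= 1 + f y.
  by have := g1 y; rewrite ler_norml; lra.
have h : (\int[haar]_y (1 + f y)%:E = 1)%E.
  rewrite (ge0_integral_pushforward (@measurable_expi R))//=; last by move=> y _; rewrite lee_fin.
  rewrite preimage_setT integral_uniform//=.
  - under eq_integral do rewrite fg.
    rewrite (@continuous_FTC2 _ _ (fun t => t + G t))//.
    + rewrite -G02 -EFinB -EFinM; congr EFin.
      by rewrite !subr0 add0r addrK mulVf// gt_eqF.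
    + apply: continuous_subspaceT => t.
      by apply: cvgD; [exact: cvg_cst|exact: cg].
    + have dtG t : is_derive t (1 : R) (fun t => t + G t) (1 + g t).
        exact: is_deriveD.
      have cG t : {for t, continuous (fun t => t + G t)}.
        exact/differentiable_continuous/derivable1_diffP.
      split; first by move=> t _.
      * exact: (cvg_at_right_filter (cG _)).
      * exact: (cvg_at_left_filter (cG _)).
    + move=> t _; rewrite derive1E; exact: derive_val.
  - exact: (measurableT_comp m1 (@measurable_expi R)).
  - by move=> t; rewrite lee_fin.
have fi : haar.-integrable setT (EFin \o f) by exact: bounded_integrable g1.
have := congr1 fine h; rewrite -[LHS]/(\int[haar]_y (1 + f y)) RintegralD//.
  rewrite Rintegral_cst// (congr1 fine (probability_setT haar)) mulr1 => /eqP.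
  by rewrite -subr_eq0 addrAC subrr add0r => /eqP.
exact: finite_measure_integrable_cst.
Qed.

Lemma haar_zero_moments : zero_moments haar.
Proof.
move=> n n0; have nR0 : n%:R != 0 :> R by rewrite pnatr_eq0 -lt0n.
have yn1 y : `|Re (val y ^+ n)| <= 1 /\ `|Im (val y ^+ n)| <= 1.
  by apply: normc_le_parts; rewrite normrX (eqP (valP y)) expr1n.
have [mR mI] := cmeasX n (@cmeas_circle R).
have n2pi : n%:R * (2 * pi) = pi *+ 2 *+ n :> R.
  by rewrite -[RHS]mulr_natl -[in RHS](mulr_natl pi 2).
have cn (t : R) : {for t, continuous (fun t : R => n%:R * t)}.
  by apply: cvgM; [exact: cvg_cst|exact: cvg_id].
have dn (t : R) : is_derive t (1 : R) (fun t : R => n%:R * t) n%:R.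
  have := is_deriveZ n%:R (is_derive_id t (1 : R)).
  by rewrite /GRing.scale /= mulr1.
apply: complex_ext => /=.
  apply: (@haar_mean0 (fun t => cos (n%:R * t)) (fun t => sin (n%:R * t) / n%:R)).
  - move=> t.
    have := is_deriveZ n%:R^-1 (is_derive1_comp (is_derive_sin _) (dn t)).
    rewrite /GRing.scale /= mulrCA mulVf// mulr1.
    by congr is_derive; apply/funext => u; rewrite [RHS]mulrC.
  - by move=> t; apply: continuous_comp; [exact: cn|exact: continuous_cos].
  - rewrite mulr0 sin0 mul0r n2pi -(add0r (_ *+ n)) (periodicn (@sinD2pi R)).
    by rewrite sin0 mul0r.
  - by move=> y; have [] := yn1 y.
  - exact: mR.
  - by move=> t; rewrite val_expiX.
apply: (@haar_mean0 (fun t => sin (n%:R * t)) (fun t => - cos (n%:R * t) / n%:R)).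
- move=> t.
  have := is_deriveZ (- n%:R^-1) (is_derive1_comp (is_derive_cos _) (dn t)).
  have -> : - n%:R^-1 *: (- sin (n%:R * t) * n%:R) = sin (n%:R * t).
    by rewrite /GRing.scale /=; field.
  by congr is_derive; apply/funext => u; rewrite [RHS]mulrC mulrN -mulNr.
- by move=> t; apply: continuous_comp; [exact: cn|exact: continuous_sin].
- rewrite mulr0 n2pi -(add0r (pi *+ 2 *+ n)) (periodicn (@cosD2pi R)) //.
- by move=> y; have [] := yn1 y.
- exact: mI.
- by move=> t; rewrite val_expiX.
Qed.

Definition preserves_haar (t : circle R -> circle R) :=
  forall E, measurable E -> haar (t @^-1` E) = haar E.

(** Moments determine the measure, so invariance may be checked on powers of
    y, where it is algebra. *)
Lemma moments_preserve_haar (t : circle R -> circle R) : measurable_fun setT t ->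
  (forall n, (0 < n)%N -> cintegral haar (fun y => val (t y) ^+ n) = 0) ->
  preserves_haar t.
Proof.
move=> mt t0 E mE.
pose tm : {mfun circle R >-> circle R} :=
  @mfun_Sub _ _ _ _ t (mem_set mt).
pose nu : probability (circle R) R := distribution haar tm.
suff nu0 : zero_moments nu by exact: (zero_moments_unique nu0 haar_zero_moments mE).
move=> n n0; rewrite -[RHS](t0 n n0).
have nyb y : `|Re (val y ^+ n)| <= 1 /\ `|Im (val y ^+ n)| <= 1.
  by apply: normc_le_parts; rewrite normrX (eqP (valP y)) expr1n.
have [mR mI] := cmeasX n (@cmeas_circle R).
have tint (h : circle R -> R) : measurable_fun setT h -> (forall y, `|h y| <= 1) ->
    \int[nu]_y h y = \int[haar]_y h (t y).
  move=> mh hb; rewrite /Rintegral (integral_pushforward mt)//=.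
  - exact/measurable_EFinP.
  - rewrite preimage_setT; apply: (@bounded_integrable _ _ _ _ (h \o t) 1) => //.
      exact: measurableT_comp.
    by move=> y; exact: hb.
apply: complex_ext; apply: tint => //.
- by move=> y; have [] := nyb y.
- by move=> y; have [] := nyb y.
Qed.

Lemma preserves_haar_ge0 (t : circle R -> circle R) (f : circle R -> \bar R) :
  measurable_fun setT t -> preserves_haar t -> measurable_fun setT f ->
  (forall y, 0 <= f y)%E ->
  (\int[haar]_y f (t y) = \int[haar]_y f y)%E.
Proof.
move=> mt th mf f0; have := @ge0_integral_pushforward _ _ _ _ _ _ mt haar setT f.
rewrite preimage_setT => <- //.
by apply: eq_measure_integral => E mE _; exact: th.
Qed.

Lemma preserves_haar_integrable (t : circle R -> circle R) f :
  measurable_fun setT t -> preserves_haar t ->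
  haar.-integrable setT (EFin \o f) ->
  haar.-integrable setT (EFin \o (f \o t)).
Proof.
move=> mt th /integrableP[mf foo]; apply/integrableP; split.
  exact: (measurableT_comp mf mt).
rewrite (preserves_haar_ge0 (f := fun y => `|(f y)%:E|%E)) => //.
exact: measurableT_comp.
Qed.

Lemma preserves_haar_Rintegral (t : circle R -> circle R) f :
  measurable_fun setT t -> preserves_haar t ->
  haar.-integrable setT (EFin \o f) ->
  \int[haar]_y f (t y) = \int[haar]_y f y.
Proof.
move=> mt th fi; congr fine.
have /measurable_int/measurable_EFinP mf := fi.
have := @integral_pushforward _ _ _ _ _ _ mt haar setT (EFin \o f).
rewrite preimage_setT => <- //.
- by apply: eq_measure_integral => E mE _; exact: th.
- exact/measurable_EFinP.
- exact: preserves_haar_integrable.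
Qed.

Lemma measurable_to_circle d (T : measurableType d) (t : T -> circle R) :
  cmeas (fun x => val (t x)) -> measurable_fun setT t.
Proof.
move=> [mR mI] _ _ [B mB <-]; rewrite setTI.
have mRI : measurable_fun setT (fun x => (Re (val (t x)), Im (val (t x)))).
  exact: measurable_fun_pair.
by have := mRI measurableT B mB; rewrite !setTI.
Qed.

Lemma measurable_circle_conj : measurable_fun setT (@circle_conj R).
Proof. by apply: measurable_to_circle; apply: cmeasJ; exact: cmeas_circle. Qed.

Lemma haar_conj : preserves_haar (@circle_conj R).
Proof.
apply: moments_preserve_haar => [|n n0]; first exact: measurable_circle_conj.
under eq_fun do rewrite -[val _]/((val _)^*) -rmorphXn.
rewrite cintegralJ ?haar_zero_moments ?rmorph0//.
exact: cintegrable_circleX.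
Qed.

Fact circle_neg_subproof y : `|- val y| == 1.
Proof. by rewrite normrN; exact: (valP y). Qed.

Definition circle_neg y : circle R :=
  exist (fun z : R[i] => `|z| == 1) _ (circle_neg_subproof y).

Lemma measurable_circle_neg : measurable_fun setT circle_neg.
Proof. by apply: measurable_to_circle; apply: cmeasN; exact: cmeas_circle. Qed.

Lemma haar_neg : preserves_haar circle_neg.
Proof.
apply: moments_preserve_haar => [|n n0]; first exact: measurable_circle_neg.
under eq_fun do rewrite -[val _]/(- val _) -mulN1r exprMn.
rewrite cintegralZ ?haar_zero_moments ?mulr0//.
exact: cintegrable_circleX.
Qed.

Definition csign y : R := Num.sg (Re (val y)).

Lemma csign_conj y : csign (circle_conj y) = csign y.
Proof. by rewrite /csign cReJ. Qed.

Lemma csign_bound y : `|csign y| <= 1.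
Proof. by rewrite /csign; case: sgrP; rewrite ?normr0 ?normr1 ?normrN1. Qed.

(** A pointwise limit of polynomials in Re y. *)
Lemma measurable_csign : measurable_fun setT csign.
Proof.
have [mR _] := @cmeas_circle R.
apply: (measurable_fun_cvg (h := fun n y => sign_newton n (Re (val y)))).
  move=> n; elim: n => [|n IH]; first exact: mR.
  apply: measurable_funM => //; apply: measurable_funM => //.
  by apply: measurable_funB => //; exact: measurable_funX.
move=> y _; apply: cvg_sign_newton.
by have /normc_le_parts[] : `|val y| <= 1%:C by rewrite (eqP (valP y)).
Qed.

Lemma csign_integrable : haar.-integrable setT (EFin \o csign).
Proof. exact: (bounded_integrable _ measurable_csign csign_bound). Qed.

Lemma csign_mean0 : \int[haar]_y csign y = 0.
Proof.
have := preserves_haar_Rintegral measurable_circle_neg haar_neg csign_integrable.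
under eq_Rintegral do rewrite /csign cReN sgrN -/(csign _) -mulN1r.
rewrite RintegralZl//; last exact: csign_integrable.
by move=> /eqP; rewrite mulN1r eq_sym -addr_eq0 -mulr2n mulrn_eq0 => /eqP.
Qed.

(** The cosine vanishes at two points of [0, 2 pi] only. *)
Lemma haar_Re0 : haar [set y | Re (val y) = 0] = 0%E.
Proof.
have mE : measurable [set y : circle R | Re (val y) = 0].
  have [mR _] := @cmeas_circle R; have := mR measurableT [set 0].
  by rewrite setTI; apply; exact: measurable_set1.
have mN := @measurable_expi R measurableT _ mE; rewrite setTI in mN.
set N := @expi R @^-1` _ in mN.
rewrite -[LHS]/(uniform_prob (two_pi_gt0 R) N) /uniform_prob.
rewrite integral_uniform_pdf.
have mI : measurable (`[0, 2 * pi]%classic : set (measurableTypeR R)) by [].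
apply: null_set_integral; first exact: measurableI.
- apply/measurable_EFinP/measurable_funTS; exact: measurable_uniform_pdf.
apply/eqP; rewrite eq_le measure_ge0 andbT.
have m2 : measurable ([set pi / 2; 3 * pi / 2] : set (measurableTypeR R)).
  by apply: measurableU; exact: measurable_set1.
apply: (@le_trans _ _ (lebesgue_measure [set pi / 2; 3 * pi / 2])); last first.
  rewrite countable_lebesgue_measure0//; apply: finite_set_countable.
  exact: finite_set2.
apply: le_measure; rewrite ?inE//; first exact: measurableI.
move=> t [] /=; rewrite in_itv /= => ct /andP[t0 t2].
have pi0 := pi_gt0 R; have {}ct : cos t = 0 := ct.
have [tp|tp] := leP t pi; [left|right].
  apply: (@cos_inj R); rewrite ?in_itv /= ?cos_pihalf ?t0//.
  by apply/andP; split; lra.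
have : t - pi = pi / 2.
  apply: (@cos_inj R); rewrite ?in_itv /=; [by apply/andP; split; lra..|].
  rewrite cos_pihalf; have := cosDpi (t - pi).
  by rewrite subrK ct => /eqP; rewrite eq_sym oppr_eq0 => /eqP.
by move=> h; lra.
Qed.

(** The sign takes the value 0 on the imaginary axis, which is a null set. *)
Lemma csign_sqr_ae : {ae haar, forall y, csign y ^+ 2 = 1}.
Proof.
exists [set y | Re (val y) = 0]; split.
- have [mR _] := @cmeas_circle R; have := mR measurableT [set 0].
  by rewrite setTI; apply; exact: measurable_set1.
- exact: haar_Re0.
- move=> y /=; rewrite /csign; apply: contra_notP.
  by case: sgrP => // _ _; rewrite ?sqrrN expr1n.
Qed.

End haar_facts.

(** * Real and imaginary parts of analytic functions *)

Section analytic.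
Variable R : realType.
Local Notation haar := (haar R).
Variable p : circle R -> R[i].
Hypothesis ip : cintegrable haar p.
Hypothesis p0 : forall n, cintegral haar (fun y => val y ^+ n * p y) = 0.

Lemma cintegrable_horner_mul Q : cintegrable haar (fun y => Q.[val y] * p y).
Proof.
have [M QM] := horner_circle_bounded Q.
by apply: (cintegrableM (M := M)) => //; [exact: cmeas_horner| |];
  move=> y; have [] := QM y.
Qed.

(** Multiplication by a polynomial preserves analyticity. *)
Lemma analytic_horner Q k :
  cintegral haar (fun y => val y ^+ k * (Q.[val y] * p y)) = 0.
Proof.
elim/poly_ind: Q k => [|Q c IH] k.
  under eq_fun do rewrite horner0 mul0r mulr0.
  by apply: complex_ext; rewrite /= Rintegral_cst ?mul0r.
have -> : (fun y : circle R => val y ^+ k * ((Q * 'X + c%:P).[val y] * p y)) =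
    fun y => val y ^+ k.+1 * (Q.[val y] * p y) + c * (val y ^+ k * p y).
  by apply/funext => y; rewrite hornerMXaddC exprS; ring.
have i1 : cintegrable haar (fun y => val y ^+ k.+1 * (Q.[val y] * p y)).
  have := cintegrable_horner_mul ('X^(k.+1) * Q).
  by under eq_fun do rewrite !hornerE -mulrA.
have i2 : cintegrable haar (fun y => val y ^+ k * p y).
  have := cintegrable_horner_mul 'X^k.
  by under eq_fun do rewrite !hornerE.
rewrite cintegralD//; last exact: cintegrableZ.
by rewrite cintegralZ// IH p0 mulr0 addr0.
Qed.

Let f y := Re (p y).
Let g y := Im (p y).
Hypothesis g2 : haar.-integrable setT (EFin \o (fun y => g y ^+ 2)).
Let M := \int[haar]_y (g y ^+ 2).

Let mf : measurable_fun setT f. Proof. by have [] := cintegrable_cmeas ip. Qed.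
Let mg : measurable_fun setT g. Proof. by have [] := cintegrable_cmeas ip. Qed.

(** Let psi = Re Q with Q(0) real. As the mean of Q p vanishes, pairing Re p
    with Re Q is pairing Im p with Im Q. The mean of Q^2 is Q(0)^2 >= 0, so Im
    Q has at most the energy of Re Q, and the Cauchy-Schwarz inequality
    concludes. *)
Lemma analytic_trig_bound psi : trig_poly psi ->
  (\int[haar]_y (f y * psi y)) ^+ 2 <= M * \int[haar]_y (psi y ^+ 2).
Proof.
(* Subtracting an imaginary constant makes Q(0) real without changing Re Q. *)
move=> [Q0 psiQ0]; pose Q := Q0 - ('i * (Im Q0.[0])%:C)%:P.
have Q00 : Im Q.[0] = 0 by rewrite !hornerE !partsE /=; ring.
have psiQ y : psi y = Re Q.[val y] by rewrite psiQ0 !hornerE !partsE /=; ring.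
have [B QB] := horner_circle_bounded Q.
have [mRQ mIQ] := cmeas_horner Q.
have RQ (y : circle R) : `|Re Q.[val y]| <= B by have [] := QB y.
have IQ (y : circle R) : `|Im Q.[val y]| <= B by have [] := QB y.
have [if_ ig_] := ip.
have -> : \int[haar]_y (f y * psi y) = \int[haar]_y (g y * Im Q.[val y]).
  have e0 : cintegral haar (fun y => Q.[val y] * p y) = 0.
    have := analytic_horner Q 0.
    by under eq_fun do rewrite expr0 mul1r.
  have e : \int[haar]_y (Re Q.[val y] * f y - Im Q.[val y] * g y) = 0.
    rewrite -[RHS](congr1 (@complex.Re R) e0).
    by apply: eq_Rintegral => y _; rewrite cReM.
  have i1 := integrable_mulb mRQ RQ if_; have i2 := integrable_mulb mIQ IQ ig_.
  move: e; rewrite RintegralB// => /eqP; rewrite subr_eq0 => /eqP e.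
  under eq_Rintegral do rewrite psiQ mulrC.
  by under [RHS]eq_Rintegral do rewrite mulrC.
have sq (h : circle R -> R) : measurable_fun setT h -> (forall y, `|h y| <= B) ->
    haar.-integrable setT (EFin \o (fun y => h y ^+ 2)).
  move=> mh hB; apply: (@bounded_integrable _ _ _ _ _ (B ^+ 2)).
    exact: measurable_funX.
  by move=> y; rewrite normrX lerXn2r ?nnegrE// (le_trans _ (hB y)).
have RQ2 := sq _ mRQ RQ; have IQ2 := sq _ mIQ IQ.
apply: (le_trans (Rintegral_cauchy_schwarz mg mIQ g2 IQ2)).
rewrite -/M ler_wpM2l//; first by apply: Rintegral_ge0 => y _; exact: sqr_ge0.
rewrite -subr_ge0.
under eq_Rintegral do rewrite psiQ.
rewrite -RintegralB//.
have e := congr1 (@complex.Re R)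
  (zero_moments_horner (Q ^+ 2) (@haar_zero_moments R)).
have -> : \int[haar]_y (Re Q.[val y] ^+ 2 - Im Q.[val y] ^+ 2) = Re (Q ^+ 2).[0].
  by rewrite -e; apply: eq_Rintegral => y _; rewrite horner_exp expr2 cReM -!expr2.
by rewrite horner_exp expr2 cReM Q00 mulr0 subr0 -expr2 sqr_ge0.
Qed.

Lemma analytic_bp_bound psi : bp_closure (@trig_poly R) psi ->
  (\int[haar]_y (f y * psi y)) ^+ 2 <= M * \int[haar]_y (psi y ^+ 2).
Proof.
elim=> {psi}[psi /analytic_trig_bound//|psi_ psi B cpsi IH psiB psic].
have B0 : 0 <= B by rewrite (le_trans _ (psiB 0%N (expi 0))).
have mpsi n : measurable_fun setT (psi_ n) by have [] := bp_trig_measurable (cpsi n).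
have [if_ _] := ip.
have c1 : (fun n => \int[haar]_y (f y * psi_ n y)) @ \oo -->
    \int[haar]_y (f y * psi y).
  apply: (@dominated_Rintegral _ _ _ _ _ _ (fun y => B * `|f y|)).
  - by move=> n; exact: measurable_funM.
  - by move=> y; apply: cvgM; [exact: cvg_cst|exact: psic].
  - have ifn := integrable_norm if_.
    exact: (integrableZl measurableT B ifn).
  - by move=> n y; rewrite normrM mulrC ler_wpM2r.
have c2 : (fun n => \int[haar]_y (psi_ n y ^+ 2)) @ \oo -->
    \int[haar]_y (psi y ^+ 2).
  apply: (@dominated_Rintegral _ _ _ _ _ _ (fun y => B ^+ 2)).
  - by move=> n; exact: measurable_funX.
  - move=> y; under eq_fun do rewrite expr2; rewrite expr2.
    by apply: cvgM; exact: psic.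
  - apply: (@bounded_integrable _ _ _ _ (cst (B ^+ 2)) (B ^+ 2)) => // y /=.
    by rewrite ger0_norm// sqr_ge0.
  - by move=> n y; rewrite normrX lerXn2r ?nnegrE.
have c3 : (fun n => (\int[haar]_y (f y * psi_ n y)) ^+ 2) @ \oo -->
    (\int[haar]_y (f y * psi y)) ^+ 2.
  by rewrite expr2; under eq_fun do rewrite expr2; exact: cvgM.
have c4 : (fun n => M * \int[haar]_y (psi_ n y ^+ 2)) @ \oo -->
    M * \int[haar]_y (psi y ^+ 2) by apply: cvgM => //; exact: cvg_cst.
apply: (ler_cvg_to c3 c4); apply: nearW => n; exact: IH.
Qed.

(** Take for psi the truncation of Re p at level n: the pairing is then the
    energy of psi itself, so that this energy is at most M for every n. *)
Lemma analytic_Re_le : (\int[haar]_y (f y ^+ 2)%:E <= M%:E)%E.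
Proof.
(* The truncation of f at level n, bounded and converging upwards in square. *)
pose h (n : nat) y := f y * \1_[set y | `|f y| <= n%:R] y.
have mS n : measurable [set y | `|f y| <= n%:R].
  have -> : [set y | `|f y| <= n%:R] = f @^-1` `[- n%:R, n%:R].
    by apply/seteqP; split => y /=; rewrite in_itv/= ler_norml.
  by rewrite -[X in measurable X]setTI; exact: mf.
have mh n : measurable_fun setT (h n).
  by apply: measurable_funM => //; exact: measurable_indic.
have hE n y : h n y = if `|f y| <= n%:R then f y else 0.
  rewrite /h indicE; case: ifPn => fn; first by rewrite mem_set ?mulr1.
  by rewrite memNset ?mulr0//; exact/negP.
have hb n y : `|h n y| <= n%:R.
  by rewrite hE; case: ifPn => // _; rewrite normr0.
have hh n y : f y * h n y = h n y ^+ 2.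
  by rewrite hE; case: ifPn => _; rewrite ?mulr0 ?expr0n// expr2.
have h2M n : (\int[haar]_y (h n y ^+ 2)%:E <= M%:E)%E.
  have ih : haar.-integrable setT (EFin \o (fun y => h n y ^+ 2)).
    apply: (@bounded_integrable _ _ _ _ _ (n%:R ^+ 2)); first exact: measurable_funX.
    by move=> y; rewrite normrX lerXn2r ?nnegrE.
  rewrite -(fineK (integrable_fin_num _ ih))// lee_fin.
  rewrite -/(Rintegral _ _ _).
  have cb : bp_closure (@trig_poly R) (h n).
    by apply: measurable_fun_circle_bp => //; exists n%:R.
  have := analytic_bp_bound cb; under eq_Rintegral do rewrite hh.
  set J := \int[haar]_x _; have J0 : 0 <= J.
    by apply: Rintegral_ge0 => y _; exact: sqr_ge0.
  rewrite expr2 => JJ; have [->|Jn] := eqVneq J 0.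
    by apply: Rintegral_ge0 => y _; exact: sqr_ge0.
  by rewrite -(ler_pM2r (x := J))// lt_neqAle eq_sym Jn.
have cv : (fun n => \int[haar]_y (h n y ^+ 2)%:E)%E @ \oo -->
    (\int[haar]_y (f y ^+ 2)%:E)%E.
  have -> : (\int[haar]_y (f y ^+ 2)%:E =
      \int[haar]_y limn (fun n => (h n y ^+ 2)%:E))%E.
    apply: eq_integral => y _; apply/esym/cvg_lim => //.
    apply: cvg_near_cst.
    near=> n; rewrite hE ifT//.
    near: n; exact: nbhs_infty_ger.
  apply: cvg_monotone_convergence => //.
  - by move=> n; apply/measurable_EFinP; exact: measurable_funX.
  - by move=> n y _; rewrite lee_fin sqr_ge0.
  - move=> y _ m n mn; rewrite lee_fin !hE.
    case: (leP `|f y| m%:R) => [fm|_]; last by rewrite expr0n sqr_ge0.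
    by rewrite ifT// (le_trans fm)// ler_nat.
rewrite -(cvg_lim _ cv)//; apply: lime_le; first by apply/cvg_ex; eexists; exact: cv.
exact: nearW.
Unshelve. all: by end_near. Qed.

End analytic.

(** * Vanishing moments in the Hardy space *)

Section hardy_moments.
Variable R : realType.
Local Notation haar := (haar R).

Lemma cmeasV d (T : measurableType d) (f : T -> R[i]) :
  cmeas f -> cmeas (fun x => (f x)^-1).
Proof.
move=> [mR mI].
have mn : measurable_fun setT
    (fun x => (complex.Re (f x) ^+ 2 + complex.Im (f x) ^+ 2) `^ (- 1)).
  have m2 : measurable_fun setT
      (fun x => complex.Re (f x) ^+ 2 + complex.Im (f x) ^+ 2).
    by apply: measurable_funD; exact: measurable_funX.
  exact: (measurableT_comp (measurable_powR (-1)) m2).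
have e x : (f x)^-1 =
    (complex.Re (f x) * (complex.Re (f x) ^+ 2 + complex.Im (f x) ^+ 2) `^ (- 1)) +i*
    (- complex.Im (f x) * (complex.Re (f x) ^+ 2 + complex.Im (f x) ^+ 2) `^ (- 1)).
  rewrite powR_inv1 ?addr_ge0 ?sqr_ge0//.
  by case: (f x) => a b; apply: complex_ext; rewrite /= ?mulNr.
split; under eq_fun do rewrite e /=; apply: measurable_funM => //.
exact: measurable_funN.
Qed.

Lemma cintegral_mul_le d (T : measurableType d) (mu : {measure set T -> \bar R})
    (f g : T -> R[i]) (M : R) : cintegrable mu f -> cmeas g ->
  (forall x, `|g x| <= M%:C) ->
  `|cintegral mu (fun x => g x * f x)| <=
    (2 * (M * \int[mu]_x (`|Re (f x)| + `|Im (f x)|)))%:C.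
Proof.
move=> fi mg gM.
have RM x : `|Re (g x)| <= M by have [] := normc_le_parts (gM x).
have IM x : `|Im (g x)| <= M by have [] := normc_le_parts (gM x).
have gfi := cintegrableM mg RM IM fi; have [fR fI] := fi.
have ni : mu.-integrable setT (EFin \o (fun x => `|Re (f x)| + `|Im (f x)|)).
  have := integrableD measurableT (integrable_norm fR) (integrable_norm fI).
  by [].
rewrite -RintegralZl//; apply: cintegral_le => //.
- exact: (integrableZl measurableT M ni).
- move=> x; rewrite cReM (le_trans (ler_normB _ _))// !normrM mulrDr.
  by rewrite lerD// ler_wpM2r.
- move=> x; rewrite cImM (le_trans (ler_normD _ _))// !normrM mulrDr addrC.
  by rewrite lerD// ler_wpM2r.
Qed.

Lemma abs2E (z : R[i]) : (abs2 z)%:C = z * z^*.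
Proof. by rewrite /abs2 add_Re2_Im2 normCK. Qed.

Lemma conjc_inj_real (s : R) : (s%:C)^* = s%:C.
Proof. by rewrite conj_Creal// complex_real. Qed.

Lemma norm_subr1_ge (x : R[i]) : `|x| <= 2^-1 -> 2^-1 <= `|1 - x|.
Proof.
move=> x2; rewrite (le_trans _ (lerB_dist _ _))// normr1.
by rewrite lerBrDr [leRHS]splitr !mul1r lerD2l.
Qed.

Lemma subr1_neq0 (x : R[i]) : `|x| <= 2^-1 -> 1 - x != 0.
Proof.
move=> /norm_subr1_ge x2; rewrite -normr_gt0 (lt_le_trans _ x2)//.
Qed.

Lemma norm_inv_subr1 (x : R[i]) : `|x| <= 2^-1 -> `|(1 - x)^-1| <= 2.
Proof.
move=> x2; have h := norm_subr1_ge x2.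
have p : 0 < `|1 - x| by rewrite (lt_le_trans _ h)// invr_gt0.
by rewrite normfV -[leRHS]invrK lef_pV2// posrE// invr_gt0.
Qed.

(** The Poisson kernel is the sum of a holomorphic and an antiholomorphic
    function of z; for |z| <= 1/2 the denominators stay away from 0, uniformly
    in y. *)
Lemma poisson_kernelE (z : R[i]) (y : circle R) : `|z| <= 2^-1 ->
  (poisson_kernel z y)%:C =
  (1 - z * (val y)^*)^-1 + (1 - z^* * val y)^-1 - 1.
Proof.
move=> z2; have y1 := circle_mulJ y; move: (eqP (valP y)).
set u := val y in y1 *; set v := u^* in y1 *; set w := z^* => nu.
have nv : `|v| = 1 by rewrite norm_conjC.
have nw : `|w| = `|z| by rewrite norm_conjC.
have d1 : 1 - z * v != 0 by apply: subr1_neq0; rewrite normrM nv mulr1.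
have d2 : 1 - w * u != 0 by apply: subr1_neq0; rewrite normrM nu mulr1 nw.
have v0 : v != 0 by rewrite -normr_eq0 nv oner_eq0.
have u0 : u != 0 by rewrite -normr_eq0 nu oner_eq0.
rewrite /poisson_kernel rmorphM rmorphB /= fmorphV /= !abs2E rmorphB /= -/v -/w.
have ev : v = u^-1 by rewrite -[RHS]mul1r -y1 mulrC mulKf.
have e1 : u - z = u * (1 - z * v) by rewrite ev; field.
have e2 : v - w = v * (1 - w * u) by rewrite ev; field.
rewrite e1 e2 ev in d1 *; field.
by rewrite -/w d2 u0 e1 ev mulf_neq0.
Qed.

(** The remainder of the expansion of x |-> (1 - x)^-1 at order 2. *)
Definition geom_rem (x d : R[i]) : R[i] := ((1 - x) ^+ 2 * (1 - (x + d)))^-1.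

Lemma geom_expand (x d : R[i]) : `|x| <= 2^-1 -> `|x + d| <= 2^-1 ->
  (1 - (x + d))^-1 - (1 - x)^-1 =
  d / (1 - x) ^+ 2 + d ^+ 2 * geom_rem x d.
Proof.
move=> x2 xd2; have h1 := subr1_neq0 x2; have h2 := subr1_neq0 xd2.
rewrite /geom_rem; field; rewrite h1 andbT.
by move: h2; congr (_ != 0); ring.
Qed.

Lemma geom_rem_le (x d : R[i]) : `|x| <= 2^-1 -> `|x + d| <= 2^-1 ->
  `|geom_rem x d| <= 8.
Proof.
move=> x2 xd2; rewrite /geom_rem invfM -exprVn normrM normrX.
have h1 := norm_inv_subr1 x2; have h2 := norm_inv_subr1 xd2.
rewrite (_ : 8 = 2 ^+ 2 * 2); last by rewrite -exprSr -natrX.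
by rewrite ler_pM// ?exprn_ge0// lerXn2r ?nnegrE.
Qed.

Variable p : circle R -> R[i].
Hypothesis ip : cintegrable haar p.
Let N := \int[haar]_y (`|Re (p y)| + `|Im (p y)|).
Let F := harmonic_extension p.

Lemma cmeas_subr1V (c : R[i]) (h : circle R -> R[i]) : cmeas h ->
  cmeas (fun y => (1 - c * h y)^-1).
Proof.
move=> mh; apply/cmeasV/cmeasD; first exact: cmeas_cst.
by apply/cmeasN/cmeasM => //; exact: cmeas_cst.
Qed.

Let cmV := @cmeas_circle R.

Lemma norm_realC (s : R) : `|s%:C| = `|s|%:C.
Proof. by rewrite normc_def /= expr0n addr0 sqrtr_sqr. Qed.

Lemma cintegrable_mul (g : circle R -> R[i]) (M : R) : cmeas g ->
  (forall y, `|g y| <= M%:C) -> cintegrable haar (fun y => g y * p y).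
Proof.
move=> mg gM; apply: (cintegrableM (M := M)) => // y.
  by have [] := normc_le_parts (gM y).
by have [] := normc_le_parts (gM y).
Qed.

Lemma half_realC (s : R) : s <= 2^-1 -> s%:C <= 2^-1 :> R[i].
Proof.
by move=> s2; rewrite halfC lecR.
Qed.

(** The antiholomorphic derivative of the Poisson kernel at the real point s. *)
Definition cauchy_kernel (s : R) (y : circle R) : R[i] :=
  val y / (1 - s%:C * val y) ^+ 2.

Lemma cmeas_cauchy_kernel s : cmeas (cauchy_kernel s).
Proof.
apply: cmeasM; first exact: cmV.
apply/cmeasV/cmeasX/cmeasD; first exact: cmeas_cst.
by apply/cmeasN/cmeasM; [exact: cmeas_cst|exact: cmV].
Qed.

(** The combination f(s + t) - f(s) + i (f(s + i t) - f(s)) kills the first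
    order term of a holomorphic f and doubles that of an antiholomorphic one.
    Each of the four second order remainders is at most 8 t^2. *)
Lemma dbar_kernel_bound (s t : R) (u v : R[i]) : 0 <= s <= 4^-1 ->
  0 <= t <= 4^-1 -> `|u| = 1 -> `|v| = 1 ->
  `|((1 - (s%:C + t%:C) * v)^-1 + (1 - (s%:C + t%:C) * u)^-1 - 1) -
    ((1 - s%:C * v)^-1 + (1 - s%:C * u)^-1 - 1) +
    'i * (((1 - (s%:C + 'i * t%:C) * v)^-1 +
           (1 - (s%:C - 'i * t%:C) * u)^-1 - 1) -
          ((1 - s%:C * v)^-1 + (1 - s%:C * u)^-1 - 1)) -
    (2 * t)%:C * (u / (1 - s%:C * u) ^+ 2)| <= (32 * t ^+ 2)%:C.
Proof.
move=> s4 t4 nu nv.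
have s2 : `|s%:C : R[i]| <= 2^-1.
  by rewrite norm_realC half_realC// ger0_norm; lra.
have st2 : `|s%:C + t%:C : R[i]| <= 2^-1.
  by rewrite -rmorphD /= norm_realC half_realC// ger0_norm; lra.
have sit2 (c : R[i]) : `|c| = 1 -> `|s%:C + c * t%:C : R[i]| <= 2^-1.
  move=> c1; rewrite (le_trans (ler_normD _ _))// normrM c1 mul1r !norm_realC.
  by rewrite -rmorphD /= half_realC// !ger0_norm; lra.
have i1 : `|'i : R[i]| = 1 by rewrite normCi.
have j1 : `|- 'i : R[i]| = 1 by rewrite normrN normCi.
have ii : 'i * 'i = -1 :> R[i] by rewrite -expr2 sqrCi.
have bd (z c w : R[i]) : `|w| = 1 -> `|z| <= 2^-1 -> `|z + c| <= 2^-1 ->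
    exists2 a, (1 - (z + c) * w)^-1 =
      (1 - z * w)^-1 + c * w / (1 - z * w) ^+ 2 + (c * w) ^+ 2 * a & `|a| <= 8.
  move=> w1 z2 zc2; exists (geom_rem (z * w) (c * w)).
    rewrite -addrA -geom_expand -?mulrDl ?normrM ?w1 ?mulr1//.
    by rewrite addrC subrK.
  by apply: geom_rem_le; rewrite -?mulrDl normrM w1 mulr1.
have [a1 -> b1] := bd _ _ _ nv s2 st2.
have [a2 -> b2] := bd _ _ _ nu s2 st2.
have [a3 -> b3] := bd _ _ _ nv s2 (sit2 _ i1).
have [a4 + b4] := bd _ _ _ nu s2 (sit2 _ j1).
rewrite mulNr => ->.
have -> : (2 * t)%:C = 2 * t%:C by rewrite rmorphM /= natC.
have -> : (32 * t ^+ 2)%:C = t%:C ^+ 2 * (8 + 8 + 8 + 8).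
  by rewrite rmorphM /= natC rmorphXn /=; ring.
set T := t%:C; set D1 := (1 - s%:C * v); set D2 := (1 - s%:C * u).
rewrite [X in `|X|](_ : _ =
  T ^+ 2 * (v ^+ 2 * a1 + u ^+ 2 * a2 - 'i * (v ^+ 2 * a3) - 'i * (u ^+ 2 * a4))).
  have nT : `|T ^+ 2| = T ^+ 2 by rewrite normrX norm_realC ger0_norm//; lra.
  rewrite normrM nT ler_wpM2l// ?exprn_ge0 ?ler0c//; first lra.
  have h (w a : R[i]) : `|w| = 1 -> `|a| <= 8 -> `|w ^+ 2 * a| <= 8.
    by move=> w1 a8; rewrite normrM normrX w1 expr1n mul1r.
  have hi (w a : R[i]) : `|w| = 1 -> `|a| <= 8 -> `|'i * (w ^+ 2 * a)| <= 8.
    by move=> w1 a8; rewrite normrM i1 mul1r; exact: h.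
  rewrite (le_trans (ler_normB _ _))// lerD ?hi//.
  rewrite (le_trans (ler_normB _ _))// lerD ?hi//.
  by rewrite (le_trans (ler_normD _ _))// lerD ?h.
transitivity (T * v / D1 ^+ 2 + ('i * 'i) * (T * v / D1 ^+ 2) +
  T * u / D2 ^+ 2 - ('i * 'i) * (T * u / D2 ^+ 2) - 2 * T * (u / D2 ^+ 2) +
  T ^+ 2 * (v ^+ 2 * a1 + u ^+ 2 * a2 + ('i * 'i) * ('i * (v ^+ 2 * a3)) +
    ('i * 'i) * ('i * (u ^+ 2 * a4)))).
  by ring.
by rewrite ii; ring.
Qed.

(** The previous bound integrated against p: the combination of increments of
    the harmonic extension equals 2 t times the integral of the Cauchy kernel,
    up to O(t^2). *)
Lemma harmonic_extension_dbar (s t : R) : 0 <= s <= 4^-1 -> 0 <= t <= 4^-1 ->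
  `|F (s%:C + t%:C) - F s%:C + 'i * (F (s%:C + 'i * t%:C) - F s%:C) -
    (2 * t)%:C * cintegral haar (fun y => cauchy_kernel s y * p y)| <=
  (2 * (32 * t ^+ 2 * N))%:C.
Proof.
move=> s4 t4.
pose P (z : R[i]) (y : circle R) := (1 - z * (val y)^*)^-1 + (1 - z^* * val y)^-1 - 1.
have mP z : cmeas (P z).
  apply: cmeasD; last by apply: cmeasN; exact: cmeas_cst.
  by apply: cmeasD; apply: cmeas_subr1V; [exact: cmeasJ cmV|exact: cmV].
have bz (z : R[i]) : `|z| <= 2^-1 -> F z = cintegral haar (fun y => P z y * p y).
  move=> z2; congr cintegral; apply/funext => y.
  by rewrite poisson_kernelE.
have s2 : `|s%:C : R[i]| <= 2^-1.
  by rewrite norm_realC half_realC// ger0_norm; lra.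
have st2 : `|s%:C + t%:C : R[i]| <= 2^-1.
  by rewrite -rmorphD /= norm_realC half_realC// ger0_norm; lra.
have sit2 : `|s%:C + 'i * t%:C : R[i]| <= 2^-1.
  rewrite (le_trans (ler_normD _ _))// normrM normCi mul1r !norm_realC -rmorphD /=.
  by rewrite half_realC// !ger0_norm; lra.
rewrite !bz//.
have iP z : `|z| <= 2^-1 -> cintegrable haar (fun y => P z y * p y).
  move=> z2; apply: (@cintegrable_mul _ 5); first exact: mP.
  move=> y; rewrite (le_trans (ler_normB _ _))// normr1.
  have h1 : `|(1 - z * (val y)^*)^-1| <= 2.
    by apply: norm_inv_subr1; rewrite normrM norm_conjC normV mulr1.
  have h2 : `|(1 - z^* * val y)^-1| <= 2.
    by apply: norm_inv_subr1; rewrite normrM norm_conjC normV mulr1.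
  rewrite (_ : 5%:C = 2 + 2 + 1); last by rewrite natC; ring.
  by rewrite lerD// (le_trans (ler_normD _ _))// lerD.
have iC : cintegrable haar (fun y => cauchy_kernel s y * p y).
  apply: (@cintegrable_mul _ 4).
    exact: cmeas_cauchy_kernel.
  move=> y; rewrite normrM normV mul1r -exprVn normrX.
  have h1 : `|(1 - s%:C * val y)^-1| <= 2.
    by apply: norm_inv_subr1; rewrite normrM normV mulr1.
  rewrite (_ : 4%:C = 2 ^+ 2); last by rewrite natC; ring.
  by rewrite lerXn2r ?nnegrE.
have iB z w : `|z| <= 2^-1 -> `|w| <= 2^-1 ->
    cintegrable haar (fun y => P z y * p y - P w y * p y).
  by move=> z2 w2; apply: cintegrableB; exact: iP.
pose e (y : circle R) := P (s%:C + t%:C) y - P s%:C y +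
  'i * (P (s%:C + 'i * t%:C) y - P s%:C y) - (2 * t)%:C * cauchy_kernel s y.
rewrite (_ : _ - _ = cintegral haar (fun y => e y * p y)); last first.
  have -> : (fun y => e y * p y) = fun y =>
      (P (s%:C + t%:C) y * p y - P s%:C y * p y) +
      'i * (P (s%:C + 'i * t%:C) y * p y - P s%:C y * p y) -
      (2 * t)%:C * (cauchy_kernel s y * p y).
    by apply/funext => y; rewrite /e; ring.
  have i1 := iB _ _ st2 s2; have i2 := iB _ _ sit2 s2.
  have i3 := cintegrableZ 'i i2; have i4 := cintegrableZ (2 * t)%:C iC.
  rewrite (cintegralB (cintegrableD i1 i3) i4) (cintegralD i1 i3).
  rewrite (cintegralZ _ i2) (cintegralZ _ iC).
  by rewrite (cintegralB (iP _ st2) (iP _ s2)) (cintegralB (iP _ sit2) (iP _ s2)).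
have mPB z w : cmeas (fun y => P z y - P w y).
  by apply: cmeasD; [exact: mP|apply: cmeasN; exact: mP].
apply: cintegral_mul_le; first exact: ip.
  apply: cmeasD; last first.
    by apply/cmeasN/cmeasM; [exact: cmeas_cst|exact: cmeas_cauchy_kernel].
  apply: cmeasD; first exact: mPB.
  by apply: cmeasM; [exact: cmeas_cst|exact: mPB].
move=> y; have nu := normV y; have nv : `|(val y)^*| = 1 by rewrite norm_conjC.
have e1 : (s%:C + t%:C)^* = s%:C + t%:C.
  by rewrite rmorphD /= !conjc_inj_real.
have e2 : (s%:C + 'i * t%:C)^* = s%:C - 'i * t%:C.
  by rewrite rmorphD rmorphM /= conjCi !conjc_inj_real mulNr.
rewrite /e /P /cauchy_kernel e1 e2 conjc_inj_real.
exact: dbar_kernel_bound.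
Qed.

Lemma norm_small_eq0 (x : R[i]) (K d : R) : 0 < d ->
  (forall s : R, 0 < s <= d -> `|x| <= (s * K)%:C) -> x = 0.
Proof.
move=> d0; have nxE : `|x| = (Re `|x|)%:C by apply/esym/RRe_real/normr_real.
rewrite nxE => h; apply/eqP; rewrite -normr_eq0 nxE; apply/eqP; congr (_%:C).
have r0 : 0 <= Re `|x| by rewrite -ler0c -nxE.
move: (Re `|x|) r0 h => r r0 h.
have [//|rn] := eqVneq r 0; have rp : 0 < r by rewrite lt_neqAle eq_sym rn.
have [K1 K10 KK1] : exists2 K1 : R, 0 < K1 & K <= K1.
  exists (`|K| + 1); first by rewrite ltr_wpDl.
  by rewrite (le_trans (ler_norm K))// lerDl.
pose s := Num.min d (r / (K1 + K1)).
have s0 : 0 < s <= d by rewrite lt_min d0 ge_min lexx divr_gt0// addr_gt0.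
have := h s s0; rewrite lecR.
have : s <= r / (K1 + K1) by rewrite ge_min lexx orbT.
rewrite ler_pdivlMr ?addr_gt0//.
by case/andP: s0 => s0 _; nra.
Qed.

Lemma derivable_increment (f : R[i] -> R[i]) (z : R[i]) :
  derivable (f : R[i]^o -> R[i]^o) z 1 -> exists l : R[i], forall e : R, 0 < e ->
  exists2 d : R, 0 < d & forall h : R[i], `|h| < d%:C ->
    `|f (z + h) - f z - h * l| <= e%:C * `|h|.
Proof.
move=> /cvg_ex[l] /cvgrPdist_lt fl; exists l => e e0.
have /fl : (0 : R)%:C < e%:C by rewrite ltcR.
move=> /nbhs_ballP[d /= d0 dP]; have dR : d = (Re d)%:C.
  by apply/esym/RRe_real; exact: gtr0_real.
exists (Re d) => [|h hd]; first by rewrite -ltcR -dR.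
have [->|h0] := eqVneq h 0.
  by rewrite addr0 subrr mul0r subr0 normr0 mulr0.
have := dP h; rewrite -ball_normE /= sub0r normrN dR => /(_ hd h0).
rewrite /GRing.scale /= mulr1 => /ltW le_e.
have -> : f (z + h) - f z - h * l = h * - (l - h^-1 * (f (z + h) - f z)).
  by field.
by rewrite normrM normrN mulrC (addrC z) ler_wpM2r.
Qed.

Hypothesis dF : forall z : R[i], `|z| < 1 -> derivable (F : R[i]^o -> R[i]^o) z 1.

(** For a complex differentiable extension the same combination of increments
    is o(t), as t l + i (i t) l = 0. Comparing with its expansion and letting
    t tend to 0 gives the value 0. *)
Lemma cauchy_kernel_integral (s : R) : 0 <= s <= 4^-1 ->
  cintegral haar (fun y => cauchy_kernel s y * p y) = 0.
Proof.
move=> s4; set I := cintegral _ _.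
have s1 : `|s%:C| < 1 :> R[i].
  by rewrite norm_realC -[1]/(1%:C) ltcR ger0_norm; lra.
have [l lP] := derivable_increment (dF s1).
have N0 : 0 <= N by apply: Rintegral_ge0 => y _; exact: addr_ge0.
have hI (e : R) : 0 < e -> `|I| <= (2 * e)%:C.
  move=> e0; have [d d0 dP] := lP e e0.
  (* The step is small enough for the expansion, for the differentiability
     estimate and for the remainder 32 N t^2 to be at most e t. *)
  pose t := Num.min 4^-1 (Num.min (d / 2) (e / (32 * N + 1))).
  have D0 : 0 < 32 * N + 1 by lra.
  have t0 : 0 < t by rewrite !lt_min invr_gt0 !divr_gt0//; lra.
  have t4 : t <= 4^-1 by rewrite ge_min lexx.
  have td : t < d.
    have : t <= d / 2 by rewrite !ge_min lexx orbT.
    by move=> ?; lra.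
  have te : 32 * N * t <= e.
    have : t <= e / (32 * N + 1) by rewrite !ge_min lexx !orbT.
    by rewrite ler_pdivlMr// => ?; lra.
  have nt : `|t%:C| = t%:C :> R[i] by rewrite norm_realC gtr0_norm.
  have nit : `|'i * t%:C| = t%:C :> R[i] by rewrite normrM normCi mul1r nt.
  have hA := dP t%:C; rewrite nt ltcR in hA; have {}hA := hA td.
  have hB := dP ('i * t%:C); rewrite nit ltcR in hB; have {}hB := hB td.
  have t04 : 0 <= t <= 4^-1 by rewrite ltW.
  have hD := harmonic_extension_dbar s4 t04; rewrite -/I in hD.
  move: hA hB hD; rewrite -/F.
  set A := F _ - F _ - _; set B := F _ - F _ - _ => hA hB hD.
  have iB : `|'i * B| <= e%:C * t%:C by rewrite normrM normCi mul1r.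
  have eD : (2 * t)%:C * I = A + 'i * B -
      (F (s%:C + t%:C) - F s%:C + 'i * (F (s%:C + 'i * t%:C) - F s%:C) -
      (2 * t)%:C * I).
    (* The derivative contributes t l + i (i t) l = 0. *)
    transitivity ((2 * t)%:C * I - (1 + 'i * 'i) * (t%:C * l)).
      by rewrite -expr2 sqrCi subrr mul0r subr0.
    by rewrite /A /B; ring.
  have : `|(2 * t)%:C * I| <= e%:C * t%:C + e%:C * t%:C + (2 * (32 * t ^+ 2 * N))%:C.
    rewrite eD (le_trans (ler_normB _ _))// lerD//.
    by rewrite (le_trans (ler_normD _ _))// lerD.
  rewrite -!rmorphM -!rmorphD /= normrM norm_realC.
  have -> : `|2 * t| = 2 * t by rewrite ger0_norm//; lra.
  rewrite [`|I|]normc_def -rmorphM /= !lecR.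
  set r := Num.sqrt _; move=> hr.
  have : 2 * t * r <= 2 * t * (2 * e) by nra.
  by rewrite ler_pM2l//; lra.
apply: (@norm_small_eq0 _ 2 1) => // e /andP[e0 _].
by rewrite mulrC; exact: hI.
Qed.

(** The sum of j s^(j - m) y^j over j >= m. Closed forms replace power series:
    integrating against p gives E_m(s) with E_m(s) = m b_m + s E_(m+1)(s),
    where b_m is the m-th moment. *)
Definition moment_kernel (m : nat) (s : R) (y : circle R) : R[i] :=
  val y ^+ m * (m%:R + (1 - m%:R) * (s%:C * val y)) / (1 - s%:C * val y) ^+ 2.

Lemma moment_kernelS m (s : R) y : 0 <= s <= 4^-1 ->
  moment_kernel m s y = m%:R * val y ^+ m + s%:C * moment_kernel m.+1 s y.
Proof.
move=> s4; have h : `|s%:C * val y| <= 2^-1.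
  by rewrite normrM normV mulr1 norm_realC half_realC// ger0_norm; lra.
rewrite /moment_kernel -natr1 (exprS _ m); have := subr1_neq0 h.
by move: (val y) => u n0; field.
Qed.

Lemma cmeas_moment_kernel m s : cmeas (moment_kernel m s).
Proof.
have mc c := @cmeas_cst _ (circle R) R c.
have msV : cmeas (fun y : circle R => s%:C * val y) := cmeasM (mc _) cmV.
apply: cmeasM; last by apply/cmeasV/cmeasX/cmeasD; [exact: mc|exact: cmeasN].
apply: cmeasM; first exact/cmeasX/cmV.
by apply: cmeasD; [exact: mc|apply: cmeasM; [exact: mc|exact: msV]].
Qed.

Lemma moment_kernel_bounded m : exists M : R, forall (s : R) y, 0 <= s <= 4^-1 ->
  `|moment_kernel m s y| <= M%:C.
Proof.
exists ((m%:R + (1 + m%:R)) * 4) => s y s4.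
have h : `|s%:C * val y| <= 2^-1.
  by rewrite normrM normV mulr1 norm_realC half_realC// ger0_norm; lra.
rewrite /moment_kernel rmorphM !normrM normrX normV expr1n mul1r -exprVn normrX.
rewrite /= natC (_ : 4 = 2 ^+ 2 :> R[i]); last by ring.
apply: ler_pM => //.
  rewrite rmorphD rmorphD /= !natC (_ : 1%:C = 1)//.
  rewrite (le_trans (ler_normD _ _))// normr_nat lerD2l normrM.
  rewrite -[leRHS]mulr1 ler_pM//.
    by rewrite (le_trans (ler_normB _ _))// normr1 normr_nat.
  by rewrite (le_trans h)// invf_le1 ?ler1n ?ltr0n.
by rewrite lerXn2r ?nnegrE// norm_inv_subr1.
Qed.

(** The function E_1 vanishes on [0, 1/4] by the previous results. If E_m
    vanishes for small s > 0, the recurrence gives m b_m = O(s), hence b_m =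
    0, and then E_(m+1) vanishes as well: the coefficients of the power series
    vanish one after the other. *)
Lemma moments0 m : (0 < m)%N -> cintegral haar (fun y => val y ^+ m * p y) = 0.
Proof.
move=> m0; have iX k := circleX_mul_integrable k ip.
have iE k (s : R) : 0 <= s <= 4^-1 -> cintegrable haar (fun y => moment_kernel k s y * p y).
  have [M MP] := moment_kernel_bounded k.
  move=> s4; apply: (@cintegrable_mul _ M); first exact: cmeas_moment_kernel.
  by move=> y; exact: MP.
pose E k s := cintegral haar (fun y => moment_kernel k s y * p y).
have ES k (s : R) : 0 <= s <= 4^-1 ->
    E k s = k%:R * cintegral haar (fun y => val y ^+ k * p y) + s%:C * E k.+1 s.
  move=> s4; rewrite -cintegralZ// -cintegralZ; last exact: iE.
  rewrite -cintegralD; [|exact: cintegrableZ|by apply/cintegrableZ/iE].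
  congr cintegral; apply/funext => y.
  by rewrite moment_kernelS//; ring.
have b0 k : (0 < k)%N -> (forall s : R, 0 < s <= 4^-1 -> E k s = 0) ->
    cintegral haar (fun y => val y ^+ k * p y) = 0.
  move=> k0 Ek; set b := cintegral _ _.
  have [M MP] := moment_kernel_bounded k.+1.
  have N0 : 0 <= N by apply: Rintegral_ge0 => y _; exact: addr_ge0.
  have M0 : 0 <= M.
    rewrite -lecR (le_trans (normr_ge0 _) (MP 0 (expi 0) _))//.
    by lra.
  have hb (s : R) : 0 < s <= 4^-1 -> `|k%:R * b| <= (s * (2 * (M * N)))%:C.
    move=> s4; have s4' : 0 <= s <= 4^-1 by lra.
    have := ES k s s4'; rewrite Ek// => /esym/eqP; rewrite addr_eq0 => /eqP ->.
    rewrite normrN normrM norm_realC rmorphM /= ger0_norm; last lra.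
    rewrite ler_wpM2l//; first by rewrite lecR; lra.
    apply: cintegral_mul_le; [exact: ip|exact: cmeas_moment_kernel|].
    by move=> y; exact: MP.
  suff : k%:R * b = 0.
    by move=> /eqP; rewrite mulf_eq0 pnatr_eq0 gtn_eqF//= => /eqP.
  by apply: (@norm_small_eq0 _ (2 * (M * N)) 4^-1); rewrite ?invr_gt0.
apply: (b0 _ m0); elim: m m0 => // -[_ _ s s4|m IH _ s s4].
  have s4' : 0 <= s <= 4^-1 by lra.
  rewrite -[RHS](cauchy_kernel_integral s4'); congr cintegral.
  apply/funext => y; congr (_ * _).
  by rewrite /moment_kernel /cauchy_kernel subrr mul0r addr0 mulr1 expr1.
have s4' : 0 <= s <= 4^-1 by lra.
have := ES m.+1 s s4'; rewrite IH// b0//; last by move=> ? ?; exact: IH.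
rewrite mulr0 add0r => /esym/eqP; rewrite mulf_eq0 => /orP[|/eqP//].
by rewrite -[0]/(0%:C) (inj_eq (@complexI R)) gt_eqF//; lra.
Qed.

End hardy_moments.

(** The moment of order 0 vanishes by the definition of the Hardy space, the
    others by analyticity. *)
Lemma H10_moments (R : realType) (p : circle R -> R[i]) n : H10 p ->
  cintegral (haar R) (fun y => val y ^+ n * p y) = 0.
Proof.
move=> [ip p0 dp]; case: n => [|n]; last exact: moments0.
by under eq_fun do rewrite expr0 mul1r.
Qed.

(** * Estimates in one variable *)

Section one_variable.
Variable R : realType.
Local Notation haar := (haar R).
Implicit Types (f q : circle R -> R) (h p : circle R -> R[i]).

Definition energy f : \bar R := (\int[haar]_y (f y ^+ 2)%:E)%E.

Lemma haar_integral_cst (c : R) : (\int[haar]_y c%:E = c%:E)%E.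
Proof.
rewrite integral_cst// [X in (_ * X)%E](_ : _ = 1%E) ?mule1//.
exact: (probability_setT haar).
Qed.

Lemma energyD (f q : circle R -> R) : measurable_fun setT f ->
  measurable_fun setT q ->
  (energy f + energy q = \int[haar]_y (f y ^+ 2 + q y ^+ 2)%:E)%E.
Proof.
move=> mf mq; rewrite /energy -ge0_integralD//.
- by move=> y _; rewrite lee_fin sqr_ge0.
- by apply/measurable_EFinP; exact: measurable_funX.
- by move=> y _; rewrite lee_fin sqr_ge0.
- by apply/measurable_EFinP; exact: measurable_funX.
Qed.

Lemma haar_integral_le (k l : circle R -> R) :
  measurable_fun setT k -> measurable_fun setT l ->
  (forall y, 0 <= k y) -> (forall y, k y <= l y) ->
  (\int[haar]_y (k y)%:E <= \int[haar]_y (l y)%:E)%E.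
Proof.
move=> mk ml k0 kl; apply: ge0_le_integral => //.
- by move=> y _; rewrite lee_fin.
- exact/measurable_EFinP.
- exact/measurable_EFinP.
- by move=> y _; rewrite lee_fin.
Qed.

(** The parallelogram identity and the invariance of the measure under
    conjugation. *)
Lemma energy_even_odd q : measurable_fun setT q ->
  energy q = (energy (fun y => (q y + q (circle_conj y)) / 2)%R +
              energy (fun y => (q y - q (circle_conj y)) / 2)%R)%E.
Proof.
move=> mq; have mc := @measurable_circle_conj R.
have mqc : measurable_fun setT (fun y => q (circle_conj y)).
  exact: (measurableT_comp mq mc).
rewrite energyD; last 2 first.
- by apply: measurable_funM => //; exact: measurable_funD.
- by apply: measurable_funM => //; exact: measurable_funB.
pose k y := (q y ^+ 2 / 2)%:E.
have mk : measurable_fun setT k.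
  by apply/measurable_EFinP/measurable_funM => //; exact: measurable_funX.
have k0 y : (0 <= k y)%E by rewrite lee_fin divr_ge0 ?sqr_ge0.
transitivity (\int[haar]_y k y + \int[haar]_y k y)%E.
  rewrite -ge0_integralD//; apply: eq_integral => y _.
  by rewrite -EFinD -splitr.
rewrite -{2}(preserves_haar_ge0 mc (@haar_conj R) mk k0) -ge0_integralD//.
  by apply: eq_integral => y _; rewrite -EFinD; congr EFin; field.
exact: (measurableT_comp mk mc).
Qed.

Lemma analytic_energy p : cintegrable haar p ->
  (forall n, cintegral haar (fun y => val y ^+ n * p y) = 0) ->
  (energy (fun y => Re (p y)) <= energy (fun y => Im (p y)))%E.
Proof.
move=> ip p0; have [mR mI] := cintegrable_cmeas ip.
have [->|eoo] := eqVneq (energy (fun y => Im (p y))) +oo%E; first exact: leey.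
have i2 : haar.-integrable setT (EFin \o (fun y => Im (p y) ^+ 2)).
  apply: integrable_ge0_lty => [|y|]; [exact: measurable_funX|exact: sqr_ge0|].
  by rewrite ltey.
apply: (le_trans (analytic_Re_le ip p0 i2)).
by rewrite /Rintegral fineK//; exact: (integrable_fin_num _ i2).
Qed.

(** The Cauchy-Schwarz inequality. Energies take values in [0, +oo], which
    covers sections that are not square integrable. *)
Lemma sqr_mean_le f (phi : circle R -> R) : haar.-integrable setT (EFin \o f) ->
  measurable_fun setT phi -> (forall y, `|phi y| <= 1) ->
  (((\int[haar]_y (phi y * f y)) ^+ 2)%:E <= energy f)%E.
Proof.
move=> fi mphi phi1; have /measurable_int/measurable_EFinP mf := fi.
have [->|eoo] := eqVneq (energy f) +oo%E; first exact: leey.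
have f2 : haar.-integrable setT (EFin \o (fun y => f y ^+ 2)).
  apply: integrable_ge0_lty => [|y|]; [exact: measurable_funX|exact: sqr_ge0|].
  by rewrite ltey.
have phi2b y : phi y ^+ 2 <= 1.
  by rewrite -real_normK ?num_real// expr_le1.
have phi2 : haar.-integrable setT (EFin \o (fun y => phi y ^+ 2)).
  apply: (@bounded_integrable _ _ _ _ _ 1); first exact: measurable_funX.
  by move=> y; rewrite ger0_norm ?sqr_ge0.
have -> : energy f = (\int[haar]_y (f y ^+ 2))%:E.
  by rewrite /Rintegral fineK//; exact: (integrable_fin_num _ f2).
rewrite lee_fin (le_trans (Rintegral_cauchy_schwarz mphi mf phi2 f2))//.
rewrite -[leRHS]mul1r ler_wpM2r//.
  by apply: Rintegral_ge0 => y _; exact: sqr_ge0.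
have c1 : \int[haar]_y (1 : R) = 1.
  by rewrite Rintegral_cst// (congr1 fine (probability_setT haar)) mulr1.
rewrite -[leRHS]c1; apply: le_Rintegral => //.
exact: finite_measure_integrable_cst.
Qed.

Definition even_part h (y : circle R) : R[i] := 2^-1 * (h y + h (circle_conj y)).

Definition sign_coef h : R[i] := cintegral haar (fun y => (csign y)%:C * h y).

Variable h : circle R -> R[i].
Hypothesis ih : cintegrable haar h.

Let mc := @measurable_circle_conj R.
Let ms := @measurable_csign R.

Let ihc : cintegrable haar (fun y => h (circle_conj y)).
Proof.
by case: ih => iR iI; split;
  [exact: (preserves_haar_integrable mc (@haar_conj R) iR)
  |exact: (preserves_haar_integrable mc (@haar_conj R) iI)].
Qed.

Lemma even_part_integrable : cintegrable haar (even_part h).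
Proof. exact/cintegrableZ/cintegrableD. Qed.

Lemma csignC_integrable g : cintegrable haar g ->
  cintegrable haar (fun y => (csign y)%:C * g y).
Proof.
apply: (cintegrableM (M := 1)) => [|y|y] /=.
- by split => //=; exact: measurable_cst.
- exact: csign_bound.
- by rewrite normr0.
Qed.

Lemma cintegral_haar_conj g : cintegrable haar g ->
  cintegral haar (fun y => g (circle_conj y)) = cintegral haar g.
Proof.
move=> [iR iI]; apply: complex_ext.
  exact: (preserves_haar_Rintegral mc (@haar_conj R) iR).
exact: (preserves_haar_Rintegral mc (@haar_conj R) iI).
Qed.

(** The sign is invariant under conjugation. *)
Lemma sign_coef_even : sign_coef (even_part h) = sign_coef h.
Proof.
rewrite /sign_coef; have i1 := csignC_integrable ih.
have i2 := csignC_integrable ihc.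
have -> : (fun y => (csign y)%:C * even_part h y) =
    fun y => 2^-1 * ((csign y)%:C * h y + (csign y)%:C * h (circle_conj y)).
  by apply/funext => y; rewrite /even_part; ring.
rewrite cintegralZ; last exact: cintegrableD.
rewrite cintegralD// -(cintegral_haar_conj i1).
have -> : (fun y => (csign y)%:C * h (circle_conj y)) =
    fun y => (csign (circle_conj y))%:C * h (circle_conj y).
  by apply/funext => y; rewrite csign_conj.
by set X := cintegral _ _; field.
Qed.

(** The square of the sign is 1 almost everywhere. *)
Lemma sign_coef_sub (g : circle R -> R[i]) (b : R[i]) : cintegrable haar g ->
  sign_coef (fun y => g y - (csign y)%:C * b) = sign_coef g - b.
Proof.
move=> ig; rewrite /sign_coef.
have ib := cintegrable_cst haar b.
have isb := csignC_integrable ib; have issb := csignC_integrable isb.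
have -> : (fun y => (csign y)%:C * (g y - (csign y)%:C * b)) =
    fun y => (csign y)%:C * g y - (csign y)%:C * ((csign y)%:C * b).
  by apply/funext => y; rewrite mulrBr.
rewrite cintegralB//; last exact: csignC_integrable.
congr (_ - _); rewrite -[RHS](cintegral_cst haar b).
have s2 c : \int[haar]_y (csign y * (csign y * c)) = \int[haar]_y c.
  congr fine; apply: ae_eq_integral => //.
  - apply/measurable_EFinP/measurable_funM => //; exact: measurable_funM.
  - apply: filterS (@csign_sqr_ae R) => y s2 _.
    by rewrite mulrA -expr2 s2 mul1r.
by apply: complex_ext => /=; under eq_Rintegral do rewrite !partsE /= !mul0r
  ?subr0 ?addr0; rewrite ?s2.
Qed.

Lemma cmeas_sub_csign (g : circle R -> R[i]) (b : R[i]) : cmeas g ->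
  cmeas (fun y => g y - (csign y)%:C * b).
Proof.
move=> mg; apply: cmeasD => //; apply: cmeasN; apply: cmeasM; last exact: cmeas_cst.
by split => //=; exact: measurable_cst.
Qed.

Lemma cintegrable_sub_csign (g : circle R -> R[i]) (b : R[i]) :
  cintegrable haar g -> cintegrable haar (fun y => g y - (csign y)%:C * b).
Proof.
move=> ig; apply: cintegrableB => //; apply: csignC_integrable.
exact: cintegrable_cst.
Qed.

Definition cenergy (g : circle R -> R[i]) : \bar R :=
  (\int[haar]_y (abs2 (g y))%:E)%E.

Lemma cenergyE (g : circle R -> R[i]) : cmeas g ->
  cenergy g = (energy (fun y => Re (g y)) + energy (fun y => Im (g y)))%E.
Proof. by move=> [? ?]; rewrite energyD. Qed.

Lemma abs2_sign_coef_le : ((abs2 (sign_coef h))%:E <= cenergy h)%E.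
Proof.
have [iR iI] := ih; rewrite cenergyE; last exact: cintegrable_cmeas ih.
rewrite /abs2 EFinD leeD//.
  have := sqr_mean_le iR ms (@csign_bound R).
  by under eq_Rintegral do rewrite -Re_scale.
have := sqr_mean_le iI ms (@csign_bound R).
by under eq_Rintegral do rewrite -Im_scale.
Qed.

Hypothesis h0 : forall n, cintegral haar (fun y => val y ^+ n * h y) = 0.

(* The symmetrization of h: its real part is that of u, its imaginary part the
   odd part of Im h. Its moments vanish, as those of h do. *)
Let p y := 2^-1 * (h y + (h (circle_conj y))^*).

Let ip : cintegrable haar p.
Proof. by apply/cintegrableZ/cintegrableD => //; exact: cintegrableJ. Qed.

Let p0 n : cintegral haar (fun y => val y ^+ n * p y) = 0.
Proof.
have iX g := @circleX_mul_integrable R haar n g.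
have -> : (fun y => val y ^+ n * p y) = fun y =>
    2^-1 * (val y ^+ n * h y + val y ^+ n * (h (circle_conj y))^*).
  by apply/funext => y; rewrite /p; ring.
have iJ := iX _ (cintegrableJ ihc).
rewrite cintegralZ; last by apply: cintegrableD => //; exact: iX.
rewrite (cintegralD (iX _ ih) iJ) h0 add0r.
have -> : (fun y => val y ^+ n * (h (circle_conj y))^*) =
    fun y => (val (circle_conj y) ^+ n * h (circle_conj y))^*.
  by apply/funext => y; rewrite rmorphM rmorphXn /= conjCK.
rewrite cintegralJ; last first.
  by have := cintegrableJ iJ; under eq_fun do rewrite rmorphM rmorphXn /= conjCK.
by rewrite (cintegral_haar_conj (iX _ ih)) h0 rmorph0 mulr0.
Qed.

(** The first term is the even part of Im (h - s b); the second one is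
    dominated by its odd part, which is Im p for the symmetrization p with Re
    p = Re u. *)
Lemma energy_split (b : R[i]) :
  (energy (fun y => Im (even_part h y - (csign y)%:C * b)%R) +
   energy (fun y => Re (even_part h y)) <=
   energy (fun y => Im (h y - (csign y)%:C * b)%R))%E.
Proof.
have mh := cintegrable_cmeas ih; have [_ mq] := cmeas_sub_csign b mh.
rewrite [leRHS](energy_even_odd mq).
have -> : (fun y => Im (even_part h y - (csign y)%:C * b)%R) =
    fun y => (Im (h y - (csign y)%:C * b)%R +
      Im (h (circle_conj y) - (csign (circle_conj y))%:C * b)) / 2.
  apply/funext => y; rewrite csign_conj /even_part !cImD !cImN Im_half cImD.
  by rewrite Im_scale; field.
apply: leeD => //; have := analytic_energy ip p0.
have -> : (fun y => Re (p y)) = fun y => Re (even_part h y).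
  by apply/funext => y; rewrite /p /even_part !Re_half !cReD cReJ.
have -> : (fun y => Im (p y)) = fun y => (Im (h y - (csign y)%:C * b)%R -
    Im (h (circle_conj y) - (csign (circle_conj y))%:C * b)) / 2 => //.
apply/funext => y; rewrite /p Im_half csign_conj !cImD cImJ cImN.
by congr (_ / _); ring.
Qed.

(** Both terms of the preceding lemma are bounded below by squared pairings
    with the sign. *)
Lemma sign_coef_energy (b : R[i]) :
  ((Re (sign_coef h) ^+ 2 + Im (sign_coef h - b) ^+ 2)%:E <=
   energy (fun y => Im (h y - (csign y)%:C * b)%R))%E.
Proof.
apply: le_trans (energy_split b); rewrite addrC EFinD.
have iu := even_part_integrable; have iub := cintegrable_sub_csign b iu.
rewrite -sign_coef_even -sign_coef_sub//; apply: leeD.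
  have [_ iI] := iub; have := sqr_mean_le iI ms (@csign_bound R).
  by under eq_Rintegral do rewrite -Im_scale.
have [iR _] := iu; have := sqr_mean_le iR ms (@csign_bound R).
by under eq_Rintegral do rewrite -Re_scale.
Qed.

(** Re (u - s b) is controlled by Re u and Re b separately, as s is bounded by
    1. *)
Lemma even_energy_le (b : R[i]) :
  (cenergy (fun y => even_part h y - (csign y)%:C * b)%R <=
   2%:E * (energy (fun y => Im (h y - (csign y)%:C * b)%R) + (Re b ^+ 2)%:E))%E.
Proof.
have iu := even_part_integrable; have mu := cintegrable_cmeas iu.
have [mRu mIu] := mu; have [mRb mIb] := cmeas_sub_csign b mu.
apply: (@le_trans _ _ (2%:E * (energy (fun y => Im (even_part h y - (csign y)%:C * b)%R) +
   energy (fun y => Re (even_part h y)) + (Re b ^+ 2)%:E))%E); last first.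
  by rewrite lee_pmul2l ?lte_fin//; apply: leeD => //; exact: energy_split.
have -> : (Re b ^+ 2)%:E = (\int[haar]_y (Re b ^+ 2)%:E)%E.
  by rewrite haar_integral_cst.
rewrite energyD// -ge0_integralD//; last 3 first.
- by move=> y _; rewrite lee_fin addr_ge0 ?sqr_ge0.
- by apply/measurable_EFinP; apply: measurable_funD; exact: measurable_funX.
- by move=> y _; rewrite lee_fin sqr_ge0.
rewrite -ge0_integralZl//; last 2 first.
- apply: emeasurable_funD => //.
  by apply/measurable_EFinP; apply: measurable_funD; exact: measurable_funX.
- by move=> y _; rewrite -EFinD lee_fin !addr_ge0 ?sqr_ge0.
under [leRHS]eq_integral do rewrite -EFinD -EFinM.
apply: haar_integral_le.
- by apply: measurable_funD; exact: measurable_funX.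
- apply: measurable_funM => //; apply: measurable_funD => //.
  by apply: measurable_funD; exact: measurable_funX.
- by move=> y; rewrite addr_ge0 ?sqr_ge0.
move=> y; rewrite /abs2; set q := Im (_ - _); rewrite cReD cReN Re_scale.
set u := Re _; have s1 := csign_bound y; set s := csign y in s1 *.
have : s ^+ 2 <= 1 by rewrite -real_normK ?num_real// expr_le1.
have := sqr_ge0 (u + s * Re b); have := sqr_ge0 q; have := sqr_ge0 (Re b).
by nra.
Qed.

Lemma energy_Im_le (b : R[i]) :
  (energy (fun y => Im (h y - (csign y)%:C * b)%R) <=
   2%:E * (cenergy h + (abs2 b)%:E))%E.
Proof.
have mh := cintegrable_cmeas ih.
have [mRh mIh] := mh; have [mRb mIb] := cmeas_sub_csign b mh.
have -> : (abs2 b)%:E = (\int[haar]_y (abs2 b)%:E)%E.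
  by rewrite haar_integral_cst.
have mab : measurable_fun setT (fun y => (abs2 (h y))%:E).
  by apply/measurable_EFinP; apply: measurable_funD; exact: measurable_funX.
have ab0 z : (0 <= (abs2 z)%:E :> \bar R)%E.
  by rewrite lee_fin addr_ge0 ?sqr_ge0.
rewrite -ge0_integralD// -ge0_integralZl//; last 2 first.
- exact: emeasurable_funD.
- by move=> y _; rewrite adde_ge0.
under [leRHS]eq_integral do rewrite -EFinD -EFinM.
apply: haar_integral_le.
- exact: measurable_funX.
- by apply: measurable_funM => //; apply: measurable_funD => //; exact/measurable_EFinP.
- by move=> y; rewrite sqr_ge0.
move=> y; rewrite /abs2 cImD cImN Im_scale.
have s1 := csign_bound y; set s := csign y in s1 *.
have : s ^+ 2 <= 1 by rewrite -real_normK ?num_real// expr_le1.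
have := sqr_ge0 (Im (h y) + s * Im b); have := sqr_ge0 (Re b).
have := sqr_ge0 (Re (h y)); have := sqr_ge0 (Im b).
by nra.
Qed.

End one_variable.

Section rotated_one_variable.
Variable R : realType.
Local Notation haar := (haar R).
Variables (h : circle R -> R[i]) (w b : R[i]).
Hypothesis ih : cintegrable haar h.
Hypothesis h0 : forall n, cintegral haar (fun y => val y ^+ n * h y) = 0.
Hypothesis w1 : `|w| = 1.

Lemma abs2M (z t : R[i]) : abs2 (z * t) = abs2 z * abs2 t.
Proof. by rewrite /abs2 cReM cImM; ring. Qed.

Lemma abs2_unit (z : R[i]) : `|z| = 1 -> abs2 z = 1.
Proof.
move=> z1; apply: (@complexI R); rewrite /= /abs2 add_Re2_Im2 z1.
by rewrite expr1n.
Qed.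

(** Multiplying h and b by the unimodular w reduces the general case to w = 1. *)
Lemma one_variable_bounds :
  let A := energy (fun y => Im (w * (h y - (csign y)%:C * b))%R) in
  [/\ ((Re (w * sign_coef h) ^+ 2 + Im (w * (sign_coef h - b)) ^+ 2)%:E <= A)%E,
      (cenergy (fun y => even_part h y - (csign y)%:C * b)%R <=
        2%:E * (A + (Re (w * b) ^+ 2)%:E))%E,
      (A <= 2%:E * (cenergy h + (abs2 b)%:E))%E &
      ((abs2 (sign_coef h))%:E <= cenergy h)%E].
Proof.
have iwh : cintegrable haar (fun y => w * h y) by exact: cintegrableZ.
have wh0 n : cintegral haar (fun y => val y ^+ n * (w * h y)) = 0.
  have -> : (fun y => val y ^+ n * (w * h y)) = fun y => w * (val y ^+ n * h y).
    by apply/funext => y; ring.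
  by rewrite cintegralZ ?h0 ?mulr0//; exact: circleX_mul_integrable.
have ab2 := abs2_unit w1.
have swh : sign_coef (fun y => w * h y) = w * sign_coef h.
  rewrite /sign_coef -cintegralZ; last exact: csignC_integrable.
  by congr cintegral; apply/funext => y; ring.
have rot (g : circle R -> R[i]) :
    (fun y => w * (g y - (csign y)%:C * b)) = fun y => w * g y - (csign y)%:C * (w * b).
  by apply/funext => y; ring.
have crot (g : circle R -> R[i]) : cenergy g = cenergy (fun y => w * g y).
  by apply: eq_integral => y _; rewrite abs2M ab2 mul1r.
have erot : (fun y => Im (w * (h y - (csign y)%:C * b))) =
    fun y => Im (w * h y - (csign y)%:C * (w * b)).
  by apply/funext => y; congr Im; ring.
rewrite /= erot; split.
- have := sign_coef_energy iwh wh0 (w * b).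
  by rewrite swh -mulrBr.
- rewrite crot rot; have := even_energy_le iwh wh0 (w * b).
  congr (cenergy _ <= _)%E; apply/funext => y.
  by rewrite /even_part; ring.
- have := energy_Im_le iwh (w * b).
  by rewrite -crot abs2M ab2 mul1r.
- exact: abs2_sign_coef_le.
Qed.

End rotated_one_variable.

(** * Integrals over products and changes of variables *)

Section real_fubini.
Context d1 d2 (T1 : measurableType d1) (T2 : measurableType d2) (R : realType).
Variables (m1 : probability T1 R) (m2 : probability T2 R) (F : T1 * T2 -> R).
Hypothesis iF : (m1 \x m2)%E.-integrable setT (EFin \o F).

Let mF2 : measurable_fun setT (fun x => fine (\int[m2]_y (F (x, y))%:E)).
Proof. apply: (measurableT_comp (fine_measurable _)) => //; exact: (measurable_fubini_F iF). Qed.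

Lemma prod_inner_integrable :
  m1.-integrable setT (EFin \o (fun x => \int[m2]_y F (x, y))).
Proof.
apply: le_integrable (integrable_fubini_F iF) => //.
  exact/measurable_EFinP.
move=> x _ /=; rewrite /fubini_F /Rintegral.
by case: (\int[m2]_y (EFin \o F) (x, y))%E => [r||] //=; rewrite normr0 leey.
Qed.

Lemma prod_Rintegral1 :
  \int[m1]_x \int[m2]_y F (x, y) = \int[(m1 \x m2)%E]_z F z.
Proof.
rewrite [RHS]/Rintegral -(integral12_prod_meas1 iF); congr fine.
apply: ae_eq_integral => //.
- exact/measurable_EFinP.
- exact: (measurable_fubini_F iF).
- apply: filterS (ae_integrable1 iF) => x ix _.
  by rewrite /= fineK//; exact: (integrable_fin_num _ ix).
Qed.

End real_fubini.

Section real_fubini_swap.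
Context d1 d2 (T1 : measurableType d1) (T2 : measurableType d2) (R : realType).
Variables (m1 : probability T1 R) (m2 : probability T2 R) (F : T1 * T2 -> R).
Hypothesis iF : (m1 \x m2)%E.-integrable setT (EFin \o F).

(** The inner integrals are finite almost everywhere only; elsewhere the real-
    valued integral takes its default value, so that Fubini's theorem is first
    applied with extended real values. *)
Lemma Rintegral_swap :
  \int[m1]_x \int[m2]_y F (x, y) = \int[m2]_y \int[m1]_x F (x, y).
Proof.
rewrite (prod_Rintegral1 iF) /Rintegral -(integral21_prod_meas1 iF); congr fine.
apply: ae_eq_integral => //.
- exact: (measurable_fubini_G iF).
- apply/measurable_EFinP/(measurableT_comp (fine_measurable _)) => //.
  exact: (measurable_fubini_G iF).
- apply: filterS (ae_integrable2 iF) => y iy _.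
  by rewrite /= fineK//; exact: (integrable_fin_num _ iy).
Qed.

End real_fubini_swap.

Section product_law.
Context d1 d2 d3 (T1 : measurableType d1) (T2 : measurableType d2)
  (T3 : measurableType d3) (R : realType).
Variables (m1 : probability T1 R) (m2 : probability T2 R) (P : probability T3 R).
Variable t : T1 * T2 -> T3.
Hypothesis mt : measurable_fun setT t.
Hypothesis law : forall E, measurable E -> (m1 \x m2)%E (t @^-1` E) = P E.

(** Change of variables along t, followed by Tonelli's theorem. *)
Lemma product_law_ge0 (f : T3 -> \bar R) : measurable_fun setT f ->
  (forall x, 0 <= f x)%E ->
  (\int[P]_x f x = \int[m1]_x \int[m2]_y f (t (x, y)))%E.
Proof.
move=> mf f0.
have -> : (\int[P]_x f x = \int[pushforward (m1 \x m2)%E t]_x f x)%E.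
  by apply: eq_measure_integral => E mE _; rewrite -[RHS]/((m1 \x m2)%E _) law.
rewrite (ge0_integral_pushforward mt)// preimage_setT.
have mft : measurable_fun setT (f \o t) by exact: measurableT_comp.
by apply: (@fubini_tonelli1 _ _ _ _ _ m1 m2 (f \o t) mft) => zx; exact: f0.
Qed.

Variable f : T3 -> R.
Hypothesis fi : P.-integrable setT (EFin \o f).

Lemma product_law_integrable : (m1 \x m2)%E.-integrable setT (EFin \o (f \o t)).
Proof.
have mf := measurable_int _ fi; have mft : measurable_fun setT ((EFin \o f) \o t).
  exact: measurableT_comp.
apply/(integrable12ltyP _ _ mft).
have maf : measurable_fun setT (abse \o (EFin \o f)) by exact: measurableT_comp.
rewrite -[X in (X < _)%E](product_law_ge0 maf (fun=> abse_ge0 _)).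
by have /integrableP[] := fi.
Qed.

Lemma product_law_Rintegral :
  \int[P]_x f x = \int[m1]_x \int[m2]_y f (t (x, y)).
Proof.
rewrite (prod_Rintegral1 product_law_integrable); congr fine.
have -> : (\int[P]_x (f x)%:E = \int[pushforward (m1 \x m2)%E t]_x (f x)%:E)%E.
  by apply: eq_measure_integral => E mE _; rewrite -[RHS]/((m1 \x m2)%E _) law.
rewrite (integral_pushforward mt) ?preimage_setT//.
- exact: (measurable_int _ fi).
- exact: product_law_integrable.
Qed.

End product_law.

(** * Laws on the infinite torus *)

Section torus_laws.
Variable R : realType.
Local Notation torus := (torus R).
Implicit Types (E : set torus) (n m k : nat).

Definition rect n (A : nat -> set (circle R)) : set torus :=
  [set x | forall i, (i < n)%N -> A i (x i)].

Definition rects : set (set torus) :=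
  [set E | exists n A, (forall i, measurable (A i)) /\ E = rect n A].

Lemma measurable_coord i : measurable_fun setT (fun x : torus => x i).
Proof.
move=> _ B mB; rewrite setTI; apply: sub_sigma_algebra.
by exists i => //; exists B => //; rewrite setTI.
Qed.

Lemma measurable_rect n A : (forall i, measurable (A i)) -> measurable (rect n A).
Proof.
move=> mA; have -> : rect n A = \bigcap_(i in `I_n) (fun x : torus => x i) @^-1` A i.
  by apply/seteqP; split => x.
apply: bigcap_measurableType => i _.
by have := @measurable_coord i measurableT _ (mA i); rewrite setTI.
Qed.

Lemma measurable_torusE : @measurable _ torus = <<s rects >>.
Proof.
rewrite eqEsubset; split.
- apply: smallest_sub; first exact: smallest_sigma_algebra.
  move=> E [i _ [B mB <-]]; rewrite setTI; apply: sub_sigma_algebra.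
  exists i.+1, (fun j => if j == i then B else setT); split.
    by move=> j; case: ifP => _ //; exact: measurableT.
  apply/seteqP; split => x /=.
    by move=> Bx j _; case: eqP => [->|].
  by move=> /(_ i (ltnSn i)); rewrite eqxx.
- apply: smallest_sub; first exact: sigma_algebra_measurable.
  by move=> E [n [A [mA ->]]]; exact: measurable_rect.
Qed.

Lemma rects_setI : setI_closed rects.
Proof.
move=> _ _ [n [A [mA ->]]] [m [B [mB ->]]].
exists (maxn n m), (fun i => (if (i < n)%N then A i else setT) `&`
  (if (i < m)%N then B i else setT)); split.
  by move=> i; apply: measurableI; case: ifP => // _; exact: measurableT.
apply/seteqP; split => x /=.
  move=> [Ax Bx] i _; split; case: ifP => // h; [exact: Ax|exact: Bx].
move=> h; split => i hi.
  by have [] := h i; rewrite ?leq_max ?hi//.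
by have [] := h i; rewrite ?leq_max ?hi ?orbT//.
Qed.

Lemma measurable_to_torus d (T : measurableType d) (t : T -> torus) :
  (forall i, measurable_fun setT (fun x => t x i)) -> measurable_fun setT t.
Proof.
move=> mt; refine (@measurability _ _ _ torus setT t (@sequence_cylinders R) erefl _).
move=> _ [_ [i _ [B mB <-]] <-]; rewrite !setTI.
by have := mt i measurableT B mB; rewrite setTI.
Qed.

Variable P : probability torus R.
Hypothesis HP : product_haar P.

Lemma rect_prob n A : (forall i, measurable (A i)) ->
  P (rect n A) = (\big[*%E/1%E]_(i < n) haar R (A i))%E.
Proof. by move=> mA; exact: HP. Qed.

(** Finite rectangles are stable under intersection and generate the sigma-
    algebra of the torus. *)
Lemma law_unique d (T : measurableType d) (Q : probability T R) (t : T -> torus) :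
  measurable_fun setT t ->
  (forall n A, (forall i, measurable (A i)) ->
    Q (t @^-1` rect n A) = (\big[*%E/1%E]_(i < n) haar R (A i))%E) ->
  forall E, measurable E -> Q (t @^-1` E) = P E.
Proof.
move=> mt tA E mE; rewrite -[LHS]/(pushforward Q t E).
pose tm : {mfun T >-> torus} := @mfun_Sub _ _ _ _ t (mem_set mt).
apply: (measure_unique (fun E => rects E) (fun=> setT) measurable_torusE rects_setI
  _ _ (distribution Q tm)) => //.
- by move=> _; exists 0%N, (fun=> setT); split => //; apply/seteqP; split.
- by rewrite bigcup_const.
- by move=> _ [n [A [mA ->]]]; rewrite -[LHS]/(Q (t @^-1` rect n A)) tA//;
  apply/esym; exact: HP.
- by move=> _; exact: (le_lt_trans (probability_le1 (distribution Q tm) measurableT) (ltry _)).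
Qed.

Definition mix (s : pred nat) (z x : torus) : torus :=
  fun i => if s i then z i else x i.

Lemma measurable_mix s : measurable_fun setT (fun zx : torus * torus => mix s zx.1 zx.2).
Proof.
apply: measurable_to_torus => i; rewrite /mix /=; case: (s i).
  exact: (measurableT_comp (@measurable_coord i) measurable_fst).
exact: (measurableT_comp (@measurable_coord i) measurable_snd).
Qed.

Lemma mix_law s E : measurable E ->
  (P \x P)%E ((fun zx => mix s zx.1 zx.2) @^-1` E) = P E.
Proof.
apply: law_unique; first exact: measurable_mix.
move=> n A mA; pose B i := if s i then A i else setT.
pose C i := if s i then setT else A i.
have mB i : measurable (B i) by rewrite /B; case: ifP => // _; exact: measurableT.
have mC i : measurable (C i) by rewrite /C; case: ifP => // _; exact: measurableT.
have -> : (fun zx => mix s zx.1 zx.2) @^-1` rect n A = rect n B `*` rect n C.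
  apply/seteqP; split => -[z x] /=; rewrite /rect /mix /B /C /=.
    by move=> h; split => i /h; case: ifP.
  by move=> [h1 h2] i hi; have := h1 i hi; have := h2 i hi; case: ifP.
transitivity (P (rect n B) * P (rect n C))%E.
  by apply: product_measure1E; exact: measurable_rect.
rewrite (rect_prob n mB) (rect_prob n mC) -big_split; apply: eq_bigr => i _.
transitivity (haar R (B i) * haar R (C i))%E => //.
rewrite /B /C; have h1 := probability_setT (haar R).
by case: (s i); [rewrite [X in (_ * X)%E]h1 mule1|rewrite [X in (X * _)%E]h1 mul1e].
Qed.

Lemma coord_law m (B : set (circle R)) : measurable B ->
  P ((fun x => x m) @^-1` B) = haar R B.
Proof.
move=> mB; pose A i := if i == m then B else setT.
have mA i : measurable (A i) by rewrite /A; case: ifP => // _; exact: measurableT.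
have -> : (fun x : torus => x m) @^-1` B = rect m.+1 A.
  apply/seteqP; split => x /=; rewrite /rect /A.
    by move=> Bx i _; case: eqP => [->|].
  by move=> /(_ m (ltnSn m)); rewrite eqxx.
rewrite (rect_prob m.+1 mA) big_ord_recr /= {2}/A eqxx big1 ?mul1e// => i _.
by rewrite /A ltn_eqF//; exact: (probability_setT (haar R)).
Qed.

Lemma measurable_set_coord m :
  measurable_fun setT (fun xy : torus * circle R => set_coord xy.1 m xy.2).
Proof.
apply: measurable_to_torus => i; rewrite /set_coord /=; case: (i == m).
  exact: measurable_snd.
exact: (measurableT_comp (@measurable_coord i) measurable_fst).
Qed.

Lemma measurable_set_coord2 m (x : torus) : measurable_fun setT (set_coord x m).
Proof.
apply: measurable_to_torus => i; rewrite /set_coord /=; case: (i == m).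
  exact: measurable_id.
exact: measurable_cst.
Qed.

End torus_laws.

(** * Integration against the dyadic kernel *)

Section dyadic_kernel.
Variable R : realType.
Local Notation torus := (torus R).
Local Notation haar := (haar R).
Implicit Types (x z : torus) (n m k : nat) (f phi : torus -> R).
Variable P : probability torus R.
Hypothesis HP : product_haar P.

(** Both laws agree on finite rectangles: the factor of index m comes from the
    second point instead of the first, and these points have the same
    marginal. *)
Lemma set_coord_law m E : measurable E ->
  (P \x haar)%E ((fun xy => set_coord xy.1 m xy.2) @^-1` E) = P E.
Proof.
apply: (law_unique HP); first exact: measurable_set_coord.
move=> n A mA; pose B i := if i == m then setT else A i.
pose C := if (m < n)%N then A m else setT.
have mB i : measurable (B i) by rewrite /B; case: ifP => // _; exact: measurableT.
have mC : measurable C by rewrite /C; case: ifP => // _; exact: measurableT.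
have -> : (fun xy => set_coord xy.1 m xy.2) @^-1` rect n A = rect n B `*` C.
  apply/seteqP; split => -[x y] /=; rewrite /rect /set_coord /B /C /=.
    move=> h; split => [i hi|].
      by have := h i hi; case: eqP.
    by case: ifP => // mn; have := h m mn; rewrite eqxx.
  move=> [h1 h2] i hi; have := h1 i hi; case: eqP => [im _|//].
  by move: h2; rewrite -im hi.
transitivity (P (rect n B) * haar C)%E.
  by apply: product_measure1E => //; exact: measurable_rect.
rewrite (rect_prob HP n mB); have h1 := probability_setT haar.
have eB (i : nat) : i != m -> haar (B i) = haar (A i).
  by move=> /negbTE im; rewrite /B im.
have [mn|nm] := ltnP m n; last first.
  rewrite /C ltnNge nm /= [X in (_ * X)%E]h1 mule1; apply: eq_bigr => i _.
  by apply: eB; rewrite ltn_eqF// (leq_trans (ltn_ord i)).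
rewrite /C mn (bigD1 (Ordinal mn))//= [in RHS](bigD1 (Ordinal mn))//= muleC.
rewrite {1}/B eqxx [X in (_ * (X * _))%E]h1 mul1e; congr (_ * _)%E.
by apply: eq_bigr => i im; apply: eB.
Qed.

Lemma ae_eq_Rintegral f g : measurable_fun setT f -> measurable_fun setT g ->
  {ae P, forall x, f x = g x} -> \int[P]_x f x = \int[P]_x g x.
Proof.
move=> mf mg fg; congr fine; apply: ae_eq_integral => //.
- exact/measurable_EFinP.
- exact/measurable_EFinP.
- by apply: filterS fg => x /= -> _.
Qed.

Lemma resample_section_integrable m f : P.-integrable setT (EFin \o f) ->
  {ae P, forall x, haar.-integrable setT (EFin \o (fun y => f (set_coord x m y)))}.
Proof.
move=> fi; exact: (ae_integrable1
  (product_law_integrable (@measurable_set_coord R m) (@set_coord_law m) fi)).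
Qed.

Lemma resample_inner_integrable m f : P.-integrable setT (EFin \o f) ->
  P.-integrable setT (EFin \o (fun x => \int[haar]_y f (set_coord x m y))).
Proof.
move=> fi; exact: (prod_inner_integrable
  (product_law_integrable (@measurable_set_coord R m) (@set_coord_law m) fi)).
Qed.

Lemma resample m f : P.-integrable setT (EFin \o f) ->
  \int[P]_x f x = \int[P]_x \int[haar]_y f (set_coord x m y).
Proof.
move=> fi; exact: (product_law_Rintegral (@measurable_set_coord R m)
  (@set_coord_law m) fi).
Qed.

(** In the applications phi is a kernel in the earlier signs and psi is built
    from the sign of the coordinate that is integrated out. *)
Lemma coord_integral m f phi (psi : circle R -> R) (M N : R) :
  P.-integrable setT (EFin \o f) ->
  measurable_fun setT phi -> (forall x, `|phi x| <= M) ->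
  (forall x y, phi (set_coord x m y) = phi x) ->
  measurable_fun setT psi -> (forall y, `|psi y| <= N) ->
  \int[P]_x (phi x * (psi (x m) * f x)) =
  \int[P]_x (phi x * \int[haar]_y (psi y * f (set_coord x m y))).
Proof.
move=> fi mphi phiM phim mpsi psiN.
have mpsim : measurable_fun setT (fun x => psi (x m)).
  exact: (measurableT_comp mpsi (@measurable_coord R m)).
have psif := integrable_mulb mpsim (fun x => psiN (x m)) fi.
have gi := integrable_mulb mphi phiM psif.
rewrite (resample m gi); apply: ae_eq_Rintegral.
- by have /measurable_int/measurable_EFinP := resample_inner_integrable m gi.
- apply: measurable_funM => //.
  have /measurable_int/measurable_EFinP := resample_inner_integrable m psif.
  rewrite [X in measurable_fun _ X -> _](_ : _ = fun x =>
    \int[haar]_y (psi y * f (set_coord x m y)))//.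
  apply/funext => x; apply: eq_Rintegral => y _.
  by rewrite {1}/set_coord eqxx.
- apply: filterS (resample_section_integrable m psif) => x ix.
  have ix' : haar.-integrable setT (EFin \o (fun y => psi y * f (set_coord x m y))).
    apply: eq_integrable ix => // y _ /=.
    by rewrite {1}/set_coord eqxx.
  rewrite -RintegralZl//; apply: eq_Rintegral => y _.
  by rewrite phim {1}/set_coord eqxx.
Qed.

(** The density, with respect to P, of the law of a point z conditioned to
    have the first n signs of x. *)
Definition dyadic_kernel n x z : R := \prod_(i < n) (1 + csign (x i) * csign (z i)).

Lemma dyadic_kernelS n x z :
  dyadic_kernel n.+1 x z = dyadic_kernel n x z * (1 + csign (x n) * csign (z n)).
Proof. by rewrite /dyadic_kernel big_ord_recr. Qed.

Lemma csign_pair_bound (u v : circle R) : 0 <= 1 + csign u * csign v <= 2.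
Proof.
have := csign_bound u; have := csign_bound v; rewrite !ler_norml.
by move: (csign u) (csign v) => s t; nra.
Qed.

Lemma dyadic_kernel_ge0 n x z : 0 <= dyadic_kernel n x z.
Proof. by apply: prodr_ge0 => i _; have /andP[] := csign_pair_bound (x i) (z i). Qed.

Lemma dyadic_kernel_le n x z : `|dyadic_kernel n x z| <= 2 ^+ n.
Proof.
rewrite ger0_norm ?dyadic_kernel_ge0//.
rewrite -[X in 2 ^+ X](card_ord n) -prodr_const; apply: ler_prod => i _.
exact: csign_pair_bound.
Qed.

Lemma dyadic_kernelC n x z : dyadic_kernel n x z = dyadic_kernel n z x.
Proof. by apply: eq_bigr => i _; rewrite mulrC. Qed.

Lemma measurable_csign_coord i : measurable_fun setT (fun x : torus => csign (x i)).
Proof. exact: (measurableT_comp (@measurable_csign R) (@measurable_coord R i)). Qed.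

Lemma measurable_dyadic_kernel2 n :
  measurable_fun setT (fun xz : torus * torus => dyadic_kernel n xz.1 xz.2).
Proof.
apply: measurable_prod => i _; apply: measurable_funD => //.
have mc := measurable_csign_coord i; apply: measurable_funM.
  exact: (measurableT_comp mc measurable_fst).
exact: (measurableT_comp mc measurable_snd).
Qed.

Lemma measurable_dyadic_kernel n x : measurable_fun setT (dyadic_kernel n x).
Proof.
apply: measurable_prod => i _; apply: measurable_funD => //.
by apply: measurable_funM => //; exact: measurable_csign_coord.
Qed.

Lemma dyadic_kernel_set_coord n m x z y : (n <= m)%N ->
  dyadic_kernel n x (set_coord z m y) = dyadic_kernel n x z.
Proof.
move=> nm; apply: eq_bigr => i _; rewrite /set_coord ltn_eqF//.
exact: leq_trans nm.
Qed.

Definition dyadic_mean n f x : R := \int[P]_z (dyadic_kernel n x z * f z).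

Lemma dyadic_integrand_integrable n f x : P.-integrable setT (EFin \o f) ->
  P.-integrable setT (EFin \o (fun z => dyadic_kernel n x z * f z)).
Proof.
by apply: (integrable_mulb (M := 2 ^+ n)); [exact: measurable_dyadic_kernel|
  exact: dyadic_kernel_le].
Qed.

Lemma csign_coord_integrable i f : P.-integrable setT (EFin \o f) ->
  P.-integrable setT (EFin \o (fun z => csign (z i) * f z)).
Proof.
by apply: (integrable_mulb (M := 1)); [exact: measurable_csign_coord|
  move=> z; exact: csign_bound].
Qed.

Lemma dyadic_meanS n f x : P.-integrable setT (EFin \o f) ->
  dyadic_mean n.+1 f x = dyadic_mean n f x +
    csign (x n) * dyadic_mean n (fun z => csign (z n) * f z) x.
Proof.
move=> fi; have sfi := csign_coord_integrable n fi.
have i1 := dyadic_integrand_integrable n x fi.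
have i2 := dyadic_integrand_integrable n x sfi.
rewrite /dyadic_mean -RintegralZl// -RintegralD//.
  by apply: eq_Rintegral => z _; rewrite dyadic_kernelS; ring.
exact: (integrableZl measurableT (csign (x n)) i2).
Qed.

(** The sign of a coordinate on which f does not depend has mean 0, so the
    additional factor of the kernel averages to 1. *)
Lemma dyadic_mean_peel n f x : P.-integrable setT (EFin \o f) ->
  (forall z y, f (set_coord z n y) = f z) ->
  dyadic_mean n.+1 f x = dyadic_mean n f x.
Proof.
move=> fi fn; rewrite dyadic_meanS//.
rewrite /dyadic_mean (coord_integral (M := 2 ^+ n) (N := 1) fi).
- rewrite [X in _ + _ * X](_ : _ = \int[P]_z (0 : R)).
    by rewrite Rintegral_cst ?mul0r ?mulr0 ?addr0.
  apply: eq_Rintegral => z _.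
  rewrite (@eq_Rintegral _ _ _ _ setT (fun y => f z * csign y)); last first.
    by move=> y _; rewrite fn mulrC.
  by rewrite RintegralZl ?csign_mean0 ?mulr0//; exact: csign_integrable.
- exact: measurable_dyadic_kernel.
- exact: dyadic_kernel_le.
- by move=> z y; rewrite dyadic_kernel_set_coord.
- exact: measurable_csign.
- exact: csign_bound.
Qed.

Lemma dyadic_mean_peels n m f x : P.-integrable setT (EFin \o f) -> (n <= m)%N ->
  (forall k, (n <= k)%N -> forall z y, f (set_coord z k y) = f z) ->
  dyadic_mean m f x = dyadic_mean n f x.
Proof.
move=> fi nm fk; elim: m nm => [|m IH]; first by rewrite leqn0 => /eqP ->.
rewrite leq_eqVlt => /predU1P[->//|nm].
by rewrite dyadic_mean_peel ?IH//; exact: fk.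
Qed.

Lemma dyadic_mean_cst n c x : dyadic_mean n (cst c) x = c.
Proof.
rewrite (@dyadic_mean_peels 0 n)//; last exact: finite_measure_integrable_cst.
rewrite /dyadic_mean (@eq_Rintegral _ _ _ _ setT (fun=> c)).
  by rewrite Rintegral_cst// (congr1 fine (probability_setT P)) mulr1.
by move=> z _; rewrite /dyadic_kernel big_ord0 mul1r.
Qed.

(** Integrating the last coordinate out of 1 + s_n(x) s_n(z) times h kills the
    constant term, since h has conditional mean 0, and turns s_n(z) h into its
    sign coefficient. *)
Lemma dyadic_mean_diff n h alpha x : P.-integrable setT (EFin \o h) ->
  {ae P, forall z, \int[haar]_y h (set_coord z n y) = 0} ->
  measurable_fun setT alpha ->
  {ae P, forall z, \int[haar]_y (csign y * h (set_coord z n y)) = alpha z} ->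
  dyadic_mean n.+1 h x = csign (x n) * dyadic_mean n alpha x.
Proof.
move=> hi h0 ma ha; rewrite dyadic_meanS//.
have mK := @measurable_dyadic_kernel n x; have Kb := @dyadic_kernel_le n x.
have Kn z y := @dyadic_kernel_set_coord n n x z y (leqnn n).
have m1 : measurable_fun setT (fun z => \int[haar]_y h (set_coord z n y)).
  by have /measurable_int/measurable_EFinP := resample_inner_integrable n hi.
have ms : measurable_fun setT (fun z => \int[haar]_y (csign y * h (set_coord z n y))).
  have /measurable_int/measurable_EFinP :=
    resample_inner_integrable n (csign_coord_integrable n hi).
  rewrite [X in measurable_fun _ X -> _](_ : _ = fun z =>
    \int[haar]_y (csign y * h (set_coord z n y)))//.
  apply/funext => z; apply: eq_Rintegral => y _.
  by rewrite {1}/set_coord eqxx.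
have -> : dyadic_mean n h x = 0.
  rewrite /dyadic_mean.
  have := coord_integral (N := 1) (psi := cst 1) hi mK Kb Kn.
  rewrite (@eq_Rintegral _ _ _ _ setT (fun z => dyadic_kernel n x z * h z)); last first.
    by move=> z _; rewrite /= mul1r.
  move=> ->; [|exact: measurable_cst|by move=> y /=; rewrite normr1].
  rewrite (@ae_eq_Rintegral _ (cst 0)) ?Rintegral_cst ?mul0r//.
    apply: measurable_funM => //; rewrite [X in measurable_fun _ X](_ : _ =
      fun z => \int[haar]_y h (set_coord z n y))//.
    by apply/funext => z; apply: eq_Rintegral => y _; rewrite /= mul1r.
  apply: filterS h0 => z hz; rewrite (@eq_Rintegral _ _ _ _ setT (fun y => h (set_coord z n y))).
    by rewrite hz mulr0.
  by move=> y _; rewrite /= mul1r.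
rewrite add0r /dyadic_mean (coord_integral (N := 1) hi mK Kb Kn).
- congr (_ * _); apply: ae_eq_Rintegral; [exact: measurable_funM..|].
  by apply: filterS ha => z ->.
- exact: measurable_csign.
- exact: csign_bound.
Qed.

End dyadic_kernel.

(** * Conditional expectations *)

Section cond_exp_unique.
Context d (T : measurableType d) (R : realType) (P : probability T R).
Variable S : set (set T).
Hypothesis sS : sigma_algebra setT S.
Hypothesis Sm : S `<=` measurable.
Implicit Types f g : T -> \bar R.

Local Notation Smeas g := (measurable_fun setT (g : g_sigma_algebraType S -> \bar R)).

Lemma sub_sigma_preimage g B : Smeas g -> measurable B -> S (g @^-1` B).
Proof.
move=> mg mB; have := mg measurableT B mB; rewrite setTI.
by rewrite /measurable /= (sigma_algebra_id sS).
Qed.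

Lemma sub_sigma_measurable_fun g : Smeas g -> measurable_fun setT g.
Proof. by move=> mg _ B mB; rewrite setTI; apply/Sm/sub_sigma_preimage. Qed.

Lemma le_integral_measurable f g A : measurable A ->
  measurable_fun A f -> measurable_fun A g ->
  (forall x, A x -> f x <= g x)%E ->
  (\int[P]_(x in A) f x <= \int[P]_(x in A) g x)%E.
Proof.
move=> mA mf mg fg; rewrite integralE [leRHS]integralE; apply: leeB.
- apply: ge0_le_integral => //; [exact: measurable_funepos..|].
  by move=> x Ax; apply: (@funepos_le _ _ A) => [z|]; rewrite inE//; exact: fg.
- apply: ge0_le_integral => //; [exact: measurable_funeneg..|].
  by move=> x Ax; apply: (@funeneg_le _ _ A) => [z|]; rewrite inE//; exact: fg.
Qed.

(** On the event A that g1 <= q and r <= g2, both integrals equal that of f,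
    so r P(A) <= q P(A). *)
Lemma cond_exp_gap f g1 g2 (q r : R) : is_cond_exp P S f g1 ->
  is_cond_exp P S f g2 -> q < r ->
  P.-negligible [set x | (g1 x <= q%:E)%E /\ (r%:E <= g2 x)%E].
Proof.
move=> [m1 i1] [m2 i2] qr; set A := [set x | _].
have SA : S A.
  have -> : A = g1 @^-1` `]-oo, q%:E] `&` g2 @^-1` `[r%:E, +oo[.
    by apply/seteqP; split => x /=; rewrite !in_itv /= andbT.
  have := sigma_algebra_id sS => <-.
  apply: (@measurableI _ (g_sigma_algebraType S));
    rewrite /measurable /= (sigma_algebra_id sS); apply: sub_sigma_preimage => //;
    exact: emeasurable_itv.
have mA := Sm SA; exists A; split => //.
have mg1 : measurable_fun A g1.
  exact/measurable_funTS/sub_sigma_measurable_fun.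
have mg2 : measurable_fun A g2.
  exact/measurable_funTS/sub_sigma_measurable_fun.
have h1 : (\int[P]_(x in A) g1 x <= \int[P]_(x in A) q%:E)%E.
  by apply: le_integral_measurable => // x [].
have h2 : (\int[P]_(x in A) r%:E <= \int[P]_(x in A) g2 x)%E.
  by apply: le_integral_measurable => // x [].
have := le_trans h2 (le_trans _ h1); rewrite i1// i2// lexx => /(_ isT).
rewrite !integral_cst// => rq.
have fA : P A \is a fin_num by exact: fin_num_measure.
have pE : P A = (fine (P A))%:E by rewrite fineK.
have p0 : 0 <= fine (P A) by exact: fine_ge0.
have {rq} : (r%:E * P A <= q%:E * P A)%E by exact: rq.
rewrite pE -!EFinM lee_fin => rq; congr EFin.
by have [//|pn] := eqVneq (fine (P A)) 0; nra.
Qed.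

Lemma ereal_gap (x y : \bar R) : (x < y)%E ->
  exists q r : rat, q < r /\ ((x <= (ratr q : R)%:E)%E /\ ((ratr r : R)%:E <= y)%E).
Proof.
move=> xy.
have [c [c' [cc' [xc cy]]]] : exists c c' : R, c < c' /\ (x <= c%:E)%E /\ (c'%:E <= y)%E.
  case: x y xy => [x| |] [y| |] //= xy.
  - by exists x, y.
  - by exists x, (x + 1); rewrite ltrDl lexx leey.
  - by exists (y - 1), y; rewrite ltrBlDr ltrDl lexx leNye.
  - by exists 0, 1; rewrite leNye leey.
have [q qc] := rat_in_itvoo cc'; move: qc; rewrite in_itv /= => /andP[cq qc'].
have [r rc] := rat_in_itvoo qc'; move: rc; rewrite in_itv /= => /andP[qr rc'].
exists q, r; split; first by rewrite -(ltr_rat R).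
by split; [rewrite (le_trans xc)// lee_fin ltW|rewrite (le_trans _ cy)// lee_fin ltW].
Qed.

(** The event that g1 < g2 is covered by countably many gaps with rational
    ends. No integrability is assumed, so that g1 - g2 may not be formed. *)
Lemma cond_exp_le f g1 g2 : is_cond_exp P S f g1 -> is_cond_exp P S f g2 ->
  {ae P, forall x, (g2 x <= g1 x)%E}.
Proof.
move=> c1 c2; pose E (n : nat) : set T :=
  if @unpickle (rat * rat)%type n is Some (q, r) then
    if q < r then [set x | (g1 x <= (ratr q : R)%:E)%E /\ ((ratr r : R)%:E <= g2 x)%E]
    else set0
  else set0.
have : P.-negligible (\bigcup_n E n).
  apply: negligible_bigcup => n; rewrite /E.
  case: unpickle => [[q r]|]; last exact: negligible_set0.
  case: ifP => qr; last exact: negligible_set0.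
  by apply: (cond_exp_gap c1 c2); rewrite ltr_rat.
apply: negligibleS => x /= /negP; rewrite -ltNge => /ereal_gap[q [r [qr [h1 h2]]]].
exists (pickle (q, r)); first exact: I.
by rewrite /E pickleK qr; split.
Qed.

(** Hence any explicit conditional expectation can be computed with, whatever
    version the choice operator selects. *)
Lemma cond_exp_unique f g1 g2 : is_cond_exp P S f g1 -> is_cond_exp P S f g2 ->
  {ae P, forall x, g1 x = g2 x}.
Proof.
move=> c1 c2; apply: filterS2 (cond_exp_le c1 c2) (cond_exp_le c2 c1) => x h1 h2.
by apply/eqP; rewrite eq_le h1 h2.
Qed.

Lemma cond_exp_spec f g : is_cond_exp P S f g -> is_cond_exp P S f (cond_exp P S f).
Proof.
move=> fg; rewrite /cond_exp.
exact: (xgetPex (P := [set g | is_cond_exp P S f g]) (cst 0%E) (ex_intro _ g fg)).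
Qed.

Lemma cond_exp_ae f g : is_cond_exp P S f g ->
  {ae P, forall x, cond_exp P S f x = g x}.
Proof. by move=> fg; apply: (cond_exp_unique (cond_exp_spec fg)). Qed.

Lemma measurable_cond_exp f g : is_cond_exp P S f g ->
  measurable_fun setT (cond_exp P S f).
Proof. by move=> /cond_exp_spec[m _]; exact: sub_sigma_measurable_fun. Qed.

Lemma is_cond_exp_congr f f' g : measurable_fun setT f -> measurable_fun setT f' ->
  {ae P, forall x, f x = f' x} -> is_cond_exp P S f' g -> is_cond_exp P S f g.
Proof.
move=> mf mf' ff' [mg ig]; split => // A SA; rewrite ig//.
apply: ae_eq_integral; [exact: Sm|exact: measurable_funTS|exact: measurable_funTS|].
by apply: filterS ff' => x -> _.
Qed.

End cond_exp_unique.

Section coordinate_sigma.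
Variable R : realType.
Local Notation torus := (torus R).
Local Notation haar := (haar R).
Local Notation Fil := (@coord_filtration R).
Implicit Types (x z : torus) (n m k : nat).

(** Sets that do not separate related points form a sigma-algebra. *)
Lemma sigma_invariant (T : Type) (G : set (set T)) (r : T -> T -> Prop) :
  (forall x y : T, r x y -> r y x) ->
  (forall A, G A -> forall x y : T, r x y -> A x -> A y) ->
  forall A, <<s G >> A -> forall x y : T, r x y -> A x -> A y.
Proof.
move=> rsym rG; apply: (@smallest_sub _ (sigma_algebra setT) G
  (fun A => forall x y : T, r x y -> A x -> A y)) => //.
split => //.
- by move=> A rA x y rxy [_ nAx]; split => // Ay; apply/nAx/(rA y) => //; exact: rsym.
- by move=> F rF x y rxy [n _ Fx]; exists n => //; exact: (rF n x y).
Qed.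

Lemma Fil_sigma k : sigma_algebra setT (Fil k).
Proof. exact: smallest_sigma_algebra. Qed.

Lemma Fil_measurable k : Fil k `<=` @measurable _ torus.
Proof.
apply: smallest_sub; first exact: sigma_algebra_measurable.
move=> E [i _ [B mB <-]]; apply: measurableI => //.
by have := @measurable_coord R i measurableT B mB; rewrite setTI.
Qed.

Lemma Fil_set_invariant k A x z : Fil k A ->
  (forall i, (i < k)%N -> x i = z i) -> A x -> A z.
Proof.
move=> FA xz; apply: (@sigma_invariant _ _
  (fun x z : torus => forall i, (i < k)%N -> x i = z i) _ _ _ FA) => //.
  by move=> ? ? h i ik; rewrite h.
by move=> _ [i ik [B _ <-]] u v uv [_ Bu]; split => //; rewrite /= -uv.
Qed.

Lemma Fil_fun_invariant k (f : torus -> R) x z :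
  measurable_fun setT (f : g_sigma_algebraType (Fil k) -> R) ->
  (forall i, (i < k)%N -> x i = z i) -> f x = f z.
Proof.
move=> mf xz; have := mf measurableT [set f x] (measurable_set1 _).
rewrite setTI /measurable /= (sigma_algebra_id (Fil_sigma k)) => FA.
by have := Fil_set_invariant FA xz; move=> /(_ erefl).
Qed.

Lemma Fil_fun_measurable k (f : torus -> R) :
  measurable_fun setT (f : g_sigma_algebraType (Fil k) -> R) -> measurable_fun setT f.
Proof.
move=> mf _ B mB; have := mf measurableT B mB; rewrite setTI.
by rewrite /measurable /= (sigma_algebra_id (Fil_sigma k)) => /Fil_measurable.
Qed.

(** A measurable function that depends on the first k coordinates only factors
    through the truncation of sequences, which is measurable for F_k. *)
Lemma Fil_fun_criterion k (g : torus -> \bar R) : measurable_fun setT g ->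
  (forall x z, (forall i, (i < k)%N -> x i = z i) -> g x = g z) ->
  measurable_fun setT (g : g_sigma_algebraType (Fil k) -> \bar R).
Proof.
move=> mg gk; pose t (x : torus) : torus := fun i => if (i < k)%N then x i else expi 0.
have mt : measurable_fun setT (t : g_sigma_algebraType (Fil k) -> torus).
  apply: measurable_to_torus => i; rewrite /t; case ik : (i < k)%N; last exact: measurable_cst.
  move=> _ B mB; rewrite setTI; apply: sub_sigma_algebra; apply: sub_sigma_algebra.
  by exists i => //; exists B => //; rewrite setTI.
have -> : g = g \o t.
  by apply/funext => x; apply: gk => i ik; rewrite /t ik.
exact: (measurableT_comp mg mt).
Qed.

Variable P : probability torus R.
Hypothesis HP : product_haar P.

Lemma integral_indic_mul A (f : torus -> R) : measurable A ->
  (\int[P]_(x in A) (f x)%:E = \int[P]_x (\1_A x * f x)%:E)%E.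
Proof.
move=> mA; rewrite integral_mkcond; apply: eq_integral => x _.
rewrite patchE indicE; case: ifPn => _; first by rewrite mul1r.
by rewrite mul0r.
Qed.

Lemma measurable_section_integral m (H : torus -> R) : measurable_fun setT H ->
  (forall x, 0 <= H x) ->
  measurable_fun setT (fun x => \int[haar]_y (H (set_coord x m y))%:E)%E.
Proof.
move=> mH H0.
have mHt : measurable_fun setT
    (fun xy : torus * circle R => (H (set_coord xy.1 m xy.2))%:E).
  by apply/measurable_EFinP; exact: (measurableT_comp mH (@measurable_set_coord R m)).
apply: (measurable_fun_fubini_tonelli_F _ mHt) => xy.
by rewrite lee_fin.
Qed.

(** The last coordinate is independent of F_k, so conditioning on F_k
    integrates it out. *)
Lemma is_cond_exp_Fil k (H : torus -> R) : measurable_fun setT H ->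
  (forall x, 0 <= H x) ->
  (forall x z, (forall i, (i < k.+1)%N -> x i = z i) -> H x = H z) ->
  is_cond_exp P (Fil k) (EFin \o H)
    (fun x => \int[haar]_y (H (set_coord x k y))%:E)%E.
Proof.
move=> mH H0 Hk; split.
  apply: Fil_fun_criterion; first exact: measurable_section_integral.
  move=> x z xz; apply: eq_integral => y _; congr EFin; apply: Hk => i ik.
  rewrite /set_coord; case: eqP => // /eqP nik; apply: xz.
  by rewrite ltn_neqAle nik -ltnS.
move=> A FA; have mA := Fil_measurable FA; rewrite integral_indic_mul//.
have mAH : measurable_fun setT (fun x => \1_A x * H x).
  by apply: measurable_funM => //; exact: measurable_indic.
rewrite (product_law_ge0 (@measurable_set_coord R k) (@set_coord_law R P HP k)); last 2 first.
- exact/measurable_EFinP.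
- by move=> x; rewrite lee_fin mulr_ge0.
rewrite integral_mkcond; apply: eq_integral => x _.
rewrite patchE; have AE y : \1_A (set_coord x k y) = \1_A x :> R.
  have e i : (i < k)%N -> x i = set_coord x k y i.
    by move=> ik; rewrite /set_coord ltn_eqF.
  rewrite !indicE; congr (_%:R); congr nat_of_bool; apply/idP/idP; rewrite !inE => h.
    by apply: (Fil_set_invariant FA _ h) => i ik; rewrite -e.
  exact: (Fil_set_invariant FA e h).
under [RHS]eq_integral do rewrite /= AE.
rewrite indicE; case: ifPn => xA.
  by under [RHS]eq_integral do rewrite mul1r.
by under [RHS]eq_integral do rewrite mul0r; rewrite integral0.
Qed.

End coordinate_sigma.

(** * Euclidean norms of finite families *)

Section euclidean_norm.
Variables (R : realType) (I : Type).
Implicit Types (r : seq I) (a b : I -> R[i]).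

Definition enorm r a : R := Num.sqrt (\sum_(i <- r) abs2 (a i)).

Lemma abs2_ge0 (z : R[i]) : 0 <= abs2 z.
Proof. by rewrite addr_ge0 ?sqr_ge0. Qed.

Lemma enorm_ge0 r a : 0 <= enorm r a. Proof. exact: sqrtr_ge0. Qed.

Lemma enorm_sqr r a : enorm r a ^+ 2 = \sum_(i <- r) abs2 (a i).
Proof. by rewrite sqr_sqrtr// sumr_ge0// => i _; exact: abs2_ge0. Qed.

Lemma enorm_cons i r a : enorm (i :: r) a = Num.sqrt (abs2 (a i) + enorm r a ^+ 2).
Proof. by rewrite enorm_sqr /enorm big_cons. Qed.

(** By induction, each step being the inequality in dimension 3 with the norms
    of the tails as third coordinates. *)
Lemma enorm_cauchy_schwarz r a b :
  \sum_(i <- r) (Re (a i) * Re (b i) + Im (a i) * Im (b i)) <= enorm r a * enorm r b.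
Proof.
elim: r => [|i r IH]; first by rewrite big_nil mulr_ge0 ?enorm_ge0.
rewrite big_cons !enorm_cons; apply: le_trans (lerD (lexx _) IH) _.
rewrite /abs2; move: (Re (a i)) (Im (a i)) (Re (b i)) (Im (b i)) => p q s t.
move: (enorm r a) (enorm r b) => A B.
rewrite -sqrtrM ?addr_ge0 ?sqr_ge0//; apply: le_trans (ler_norm _) _.
rewrite -sqrtr_sqr ler_wsqrtr// -subr_ge0.
have -> : (p ^+ 2 + q ^+ 2 + A ^+ 2) * (s ^+ 2 + t ^+ 2 + B ^+ 2) -
    (p * s + q * t + A * B) ^+ 2 =
  (p * t - q * s) ^+ 2 + (p * B - A * s) ^+ 2 + (q * B - A * t) ^+ 2 by ring.
by rewrite !addr_ge0 ?sqr_ge0.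
Qed.

Lemma enormD r a b : enorm r (fun i => a i + b i) <= enorm r a + enorm r b.
Proof.
rewrite -ler_sqr ?nnegrE ?addr_ge0 ?enorm_ge0// sqrrD !enorm_sqr.
rewrite (_ : \sum_(i <- r) abs2 (a i + b i) = \sum_(i <- r) abs2 (a i) +
  \sum_(i <- r) (Re (a i) * Re (b i) + Im (a i) * Im (b i)) *+ 2 +
  \sum_(i <- r) abs2 (b i)).
  by rewrite !lerD2r lerD2l sumrMnl lerMn2r enorm_cauchy_schwarz orbT.
rewrite -!big_split /=; apply: eq_bigr => i _.
by rewrite /abs2 cReD cImD; ring.
Qed.

Lemma ler_enorm r a b : (forall i, abs2 (a i) <= abs2 (b i)) -> enorm r a <= enorm r b.
Proof. by move=> ab; apply/ler_wsqrtr/ler_sum => i _; exact: ab. Qed.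

End euclidean_norm.

Lemma enorm_integrable d (T : measurableType d) (R : realType) (P : probability T R)
    (I : Type) (r : seq I) (a : I -> T -> R[i]) : (forall i, cintegrable P (a i)) ->
  P.-integrable setT (EFin \o (fun x => enorm r (fun i => a i x))).
Proof.
move=> ai; elim: r => [|i r IH].
  rewrite (_ : EFin \o _ = EFin \o cst 0); first exact: finite_measure_integrable_cst.
  by apply/funext => x; rewrite /= /enorm big_nil sqrtr0.
have [iR iI] := ai i.
have iS : P.-integrable setT (fun x => `|(Re (a i x))%:E| + `|(Im (a i x))%:E| +
    (enorm r (fun j => a j x))%:E)%E.
  by apply: integrableD => //; apply: integrableD => //; exact: integrable_abse.
apply: le_integrable iS => //.
  apply/measurable_EFinP; rewrite (_ : (fun x => _) = fun x =>
    Num.sqrt (abs2 (a i x) + enorm r (fun j => a j x) ^+ 2)).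
    apply: (measurableT_comp (continuous_measurable_fun (@sqrt_continuous R))).
    apply: measurable_funD; last first.
      by apply: measurable_funX; have /measurable_int/measurable_EFinP := IH.
    by have [mR mI] := cintegrable_cmeas (ai i); apply: measurable_funD;
      exact: measurable_funX.
  by apply/funext => x; rewrite enorm_cons.
move=> x _; rewrite /= lee_fin [leRHS]ger0_norm ?addr_ge0 ?enorm_ge0//.
rewrite ger0_norm ?enorm_ge0// enorm_cons; have N0 := enorm_ge0 r (fun j => a j x).
rewrite -[leRHS]ger0_norm ?addr_ge0// -sqrtr_sqr ler_wsqrtr// /abs2.
rewrite -(real_normK (num_real (Re _))) -(real_normK (num_real (Im _))).
have p0 := normr_ge0 (Re (a i x)); have q0 := normr_ge0 (Im (a i x)).
move: p0 q0 N0; move: `|Re _| `|Im _| (enorm r _) => p q N p0 q0 N0.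
have := mulr_ge0 p0 q0; have := mulr_ge0 p0 N0; have := mulr_ge0 q0 N0.
by nra.
Qed.

(** * Conditional expectation on the dyadic signs *)

Section dyadic_expectation.
Variable R : realType.
Local Notation torus := (torus R).
Local Notation haar := (haar R).
Local Notation dyadic := (@dyadic R).
Implicit Types (x z : torus) (n m k : nat) (f phi : torus -> R).

Lemma dyadic_sigma : sigma_algebra setT dyadic.
Proof. exact: smallest_sigma_algebra. Qed.

Lemma dyadic_measurable : dyadic `<=` @measurable _ torus.
Proof.
apply: smallest_sub; first exact: sigma_algebra_measurable.
move=> E [i _ [B mB <-]]; apply: measurableI => //.
by have := @measurable_csign_coord R i measurableT B mB; rewrite setTI.
Qed.

Lemma dyadic_set_invariant A x z : dyadic A ->
  (forall i, csign (x i) = csign (z i)) -> A x -> A z.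
Proof.
move=> DA xz; apply: (@sigma_invariant _ _
  (fun x z : torus => forall i, csign (x i) = csign (z i)) _ _ _ DA) => //.
move=> _ [i _ [B _ <-]] u v uv [_ Bu]; split => //=.
by rewrite /dyadic_sign -[Num.sg _]/(csign (v i)) -uv.
Qed.

Lemma measurable_csign_dyadic i :
  measurable_fun setT (fun x : g_sigma_algebraType dyadic => csign (x i)).
Proof.
move=> _ B mB; rewrite setTI; apply: sub_sigma_algebra; apply: sub_sigma_algebra.
by exists i => //; exists B => //; rewrite setTI.
Qed.

Variable P : probability torus R.
Hypothesis HP : product_haar P.

(** Peeling the factors of the kernel off one at a time shows that its average
    is a polynomial in the signs of x. *)
Lemma dyadic_mean_measurable n f : P.-integrable setT (EFin \o f) ->
  measurable_fun setT (dyadic_mean P n f : g_sigma_algebraType dyadic -> R).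
Proof.
elim: n f => [|n IH] f fi.
  rewrite (_ : dyadic_mean _ _ _ = cst (\int[P]_z f z)); first exact: measurable_cst.
  apply/funext => x; rewrite /dyadic_mean; apply: eq_Rintegral => z _.
  by rewrite /dyadic_kernel big_ord0 mul1r.
rewrite (_ : dyadic_mean _ _ _ = fun x => dyadic_mean P n f x +
    csign (x n) * dyadic_mean P n (fun z => csign (z n) * f z) x); last first.
  by apply/funext => x; rewrite dyadic_meanS.
apply: measurable_funD; first exact: IH.
by apply: measurable_funM; [exact: measurable_csign_dyadic|
  apply: IH; exact: csign_coord_integrable].
Qed.

(** For fixed z, weighting x by the kernel conditions its first n signs to be
    those of z. As phi depends on signs only, the first n coordinates of x may
    just as well be replaced by those of z. *)
Lemma dyadic_kernel_mix n phi (M : R) z : measurable_fun setT phi ->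
  (forall x, `|phi x| <= M) ->
  (forall x x', (forall i, csign (x i) = csign (x' i)) -> phi x = phi x') ->
  (forall i, (i < n)%N -> csign (z i) ^+ 2 = 1) ->
  \int[P]_x (phi x * dyadic_kernel n x z) =
  \int[P]_x phi (mix (fun i => (i < n)%N) z x).
Proof.
move=> mphi phiM phis zs; elim: n phi mphi phiM phis zs => [|n IH] phi mphi phiM phis zs.
  by apply: eq_Rintegral => x _; rewrite /dyadic_kernel big_ord0 mulr1.
pose psi (y : circle R) := 1 + csign y * csign (z n).
have mpsi : measurable_fun setT psi.
  by apply: measurable_funD => //; apply: measurable_funM => //; exact: measurable_csign.
have psi2 y : `|psi y| <= 2.
  by have /andP[p0 p2] := csign_pair_bound y (z n); rewrite ger0_norm.
have iphi := bounded_integrable P mphi phiM.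
pose K x := dyadic_kernel n x z.
have KE : K = dyadic_kernel n z by apply/funext => x; rewrite /K dyadic_kernelC.
have mK : measurable_fun setT K by rewrite KE; exact: measurable_dyadic_kernel.
have Kb x : `|K x| <= 2 ^+ n by exact: dyadic_kernel_le.
have Kn x y : K (set_coord x n y) = K x by rewrite KE dyadic_kernel_set_coord.
(* Where the sign of y differs from that of z n the weight psi vanishes;
   elsewhere y may be replaced by z n, as phi sees signs only. *)
pose phi' x := phi (set_coord x n (z n)).
have mphi' : measurable_fun setT phi'.
  apply: (measurableT_comp mphi); apply: measurable_to_torus => i.
  rewrite /set_coord; case: (i == n); first exact: measurable_cst.
  exact: measurable_coord.
transitivity (\int[P]_x (phi' x * K x)).
  transitivity (\int[P]_x (K x * (psi (x n) * phi x))).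
    by apply: eq_Rintegral => x _; rewrite dyadic_kernelS /K /psi; ring.
  rewrite (coord_integral HP iphi mK Kb Kn mpsi psi2); apply: eq_Rintegral => x _.
  rewrite mulrC; congr (_ * _).
  transitivity (\int[haar]_y (phi' x * psi y)).
    have mphix : measurable_fun setT (fun y => phi (set_coord x n y)).
      exact: (measurableT_comp mphi (@measurable_set_coord2 R n x)).
    congr fine; apply: ae_eq_integral => //.
    - by apply/measurable_EFinP; apply: measurable_funM.
    - by apply/measurable_EFinP; apply: measurable_funM.
    - apply: filterS (csign_sqr_ae R) => y y1 _ /=; congr EFin.
      have z1 := zs n (ltnSn n); rewrite mulrC.
      have [e|ne] := eqVneq (csign y) (csign (z n)).
        congr (_ * _); apply: phis => i; rewrite /set_coord.
        by case: eqP.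
      rewrite (_ : psi y = 0) ?mulr0 ?mul0r// /psi.
      have : (csign y - csign (z n)) * (csign y + csign (z n)) = 0.
        by rewrite -subr_sqr y1 z1 subrr.
      move=> /eqP; rewrite mulf_eq0 subr_eq0 (negbTE ne) /= addr_eq0 => /eqP ->.
      by rewrite mulNr -expr2 z1 subrr.
  have ipsi : haar.-integrable setT (EFin \o psi) := bounded_integrable haar mpsi psi2.
  rewrite RintegralZl// /psi RintegralD//; last 2 first.
  - exact: finite_measure_integrable_cst.
  - rewrite (_ : EFin \o _ = EFin \o (fun y => csign (z n) * csign y)).
      exact: (integrableZl measurableT (csign (z n)) (csign_integrable R)).
    by apply/funext => y /=; rewrite mulrC.
  rewrite (@eq_Rintegral _ _ _ _ setT (fun y => csign (z n) * csign y)
    (fun y => csign y * csign (z n))); last by move=> y _; rewrite mulrC.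
  rewrite RintegralZl ?csign_mean0 ?mulr0 ?addr0//; last exact: csign_integrable.
  by rewrite /Rintegral haar_integral_cst mulr1.
rewrite IH//.
- apply: eq_Rintegral => x _; rewrite /phi'; congr phi; apply/funext => i.
  by rewrite /set_coord /mix [in RHS]ltnS [in RHS]leq_eqVlt; case: eqP => [->|].
- by move=> x; exact: phiM.
- by move=> x x' xx'; apply: phis => i; rewrite /set_coord; case: eqP.
- by move=> i /ltnW; exact: zs.
Qed.

Lemma csign_coord_sqr_ae i : {ae P, forall x, csign (x i) ^+ 2 = 1}.
Proof.
have [A [mA A0 sA]] := csign_sqr_ae R.
exists ((fun x : torus => x i) @^-1` A); split.
- by have := @measurable_coord R i measurableT A mA; rewrite setTI.
- by rewrite (coord_law HP).
- by move=> x nx; apply: sA.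
Qed.

Lemma dyadic_product_integrable n f phi (M : R) : P.-integrable setT (EFin \o f) ->
  measurable_fun setT phi -> (forall x, `|phi x| <= M) ->
  (P \x P)%E.-integrable setT
    (EFin \o (fun xz => phi xz.1 * dyadic_kernel n xz.1 xz.2 * f xz.2)).
Proof.
move=> fi mphi phiM.
have fi2 := product_law_integrable (@measurable_snd _ _ torus torus)
  (@mix_law R P HP pred0) fi.
apply: (integrable_mulb (M := M * 2 ^+ n) _ _ fi2).
  apply: measurable_funM; last exact: measurable_dyadic_kernel2.
  exact: (measurableT_comp mphi measurable_fst).
by move=> xz; rewrite normrM ler_pM ?dyadic_kernel_le.
Qed.

Lemma integrable_dyadic_mean n f : P.-integrable setT (EFin \o f) ->
  P.-integrable setT (EFin \o dyadic_mean P n f).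
Proof.
move=> fi.
have := prod_inner_integrable (dyadic_product_integrable n fi
  (@measurable_cst _ _ torus R setT 1) (fun=> lexx `|1|)).
congr (_.-integrable _ _); apply/funext => x; congr EFin; apply: eq_Rintegral => z _.
by rewrite mul1r.
Qed.

(** By Fubini's theorem the left-hand side is the mean over z of f(z) times
    the mean over x of phi(x) K(x, z). The latter replaces the first n
    coordinates of x by those of z, which f does not see, and the mixture of x
    and z has law P. *)
Lemma dyadic_mean_test n f phi (M : R) : P.-integrable setT (EFin \o f) ->
  measurable_fun setT phi -> (forall x, `|phi x| <= M) ->
  (forall x x', (forall i, csign (x i) = csign (x' i)) -> phi x = phi x') ->
  (forall x z, (forall i, (i < n)%N -> x i = z i) -> f x = f z) ->
  \int[P]_x (phi x * dyadic_mean P n f x) = \int[P]_x (phi x * f x).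
Proof.
move=> fi mphi phiM phis fn.
have Fi := dyadic_product_integrable n fi mphi phiM.
have gi := integrable_mulb mphi phiM fi.
transitivity (\int[P]_x \int[P]_z (phi x * dyadic_kernel n x z * f z)).
  apply: eq_Rintegral => x _.
  rewrite (@eq_Rintegral _ _ _ _ setT (fun z => phi x * (dyadic_kernel n x z * f z))).
    by rewrite RintegralZl//; exact: dyadic_integrand_integrable.
  by move=> z _; rewrite mulrA.
rewrite (Rintegral_swap Fi) /=.
rewrite (product_law_Rintegral (@measurable_mix R (fun i => (i < n)%N))
  (@mix_law R P HP (fun i => (i < n)%N)) gi).
have mlhs : measurable_fun setT
    (fun z => \int[P]_x (phi x * dyadic_kernel n x z * f z)).
  apply: (measurableT_comp (fine_measurable _)) => //.
  exact: (measurable_fubini_G Fi).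
have hi := product_law_integrable (@measurable_mix R (fun i => (i < n)%N))
  (@mix_law R P HP (fun i => (i < n)%N)) gi.
have /measurable_int/measurable_EFinP mrhs := prod_inner_integrable hi.
apply: ae_eq_Rintegral => //.
have : {ae P, forall z : torus, forall i : nat, csign (z i) ^+ 2 = 1}.
  by apply/ae_foralln => i; exact: csign_coord_sqr_ae.
apply: filterS => z zs.
have ik : P.-integrable setT (EFin \o (fun x => phi x * dyadic_kernel n x z)).
  apply: (bounded_integrable P (M := M * 2 ^+ n)).
    apply: measurable_funM => //.
    rewrite (_ : (fun x => _) = dyadic_kernel n z); first exact: measurable_dyadic_kernel.
    by apply/funext => x; rewrite dyadic_kernelC.
  by move=> x; rewrite normrM ler_pM ?dyadic_kernel_le.
have im : P.-integrable setT (EFin \o (fun x => phi (mix (fun i => (i < n)%N) z x))).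
  apply: (bounded_integrable P (M := M)) => //; apply: (measurableT_comp mphi).
  apply: measurable_to_torus => i; rewrite /mix; case: (i < n)%N.
    exact: measurable_cst.
  exact: measurable_coord.
transitivity (f z * \int[P]_x (phi x * dyadic_kernel n x z)).
  by rewrite -RintegralZl//; apply: eq_Rintegral => x _; rewrite mulrC.
rewrite (dyadic_kernel_mix mphi phiM phis) => [|i _]; last exact: zs.
rewrite -RintegralZl//; apply: eq_Rintegral => x _ /=.
rewrite mulrC; congr (_ * _); apply: fn => i ni.
by rewrite /mix ni.
Qed.

Lemma is_cond_exp_dyadic n f : P.-integrable setT (EFin \o f) ->
  (forall x z, (forall i, (i < n)%N -> x i = z i) -> f x = f z) ->
  is_cond_exp P dyadic (EFin \o f) (EFin \o dyadic_mean P n f).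
Proof.
move=> fi fn; have mi := integrable_dyadic_mean n fi.
have mf : measurable_fun setT f by have /measurable_int/measurable_EFinP := fi.
have mm : measurable_fun setT (dyadic_mean P n f).
  by have /measurable_int/measurable_EFinP := mi.
split; first by apply/measurable_EFinP; exact: dyadic_mean_measurable.
move=> A DA; have mA := dyadic_measurable DA.
have m1 : measurable_fun setT (\1_A : torus -> R) by exact: measurable_indic.
have b1 (x : torus) : `|\1_A x : R| <= 1.
  by rewrite indicE; case: (_ \in _); rewrite /= ?normr1 ?normr0.
rewrite (integral_indic_mul P _ mA) [RHS](integral_indic_mul P _ mA).
have := dyadic_mean_test fi m1 b1 _ fn; rewrite /Rintegral.
have f1 : (\int[P]_x (\1_A x * dyadic_mean P n f x)%:E)%E \is a fin_num.
  exact: (integrable_fin_num measurableT (integrable_mulb m1 b1 mi)).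
have f2 : (\int[P]_x (\1_A x * f x)%:E)%E \is a fin_num.
  exact: (integrable_fin_num measurableT (integrable_mulb m1 b1 fi)).
move=> h; rewrite -(fineK f1) -(fineK f2) h// => x x' xx'.
rewrite !indicE; congr (_%:R); congr nat_of_bool; apply/idP/idP; rewrite !inE.
  exact: dyadic_set_invariant.
by apply: dyadic_set_invariant => // i; rewrite xx'.
Qed.

Definition cdyadic_mean n (f : torus -> R[i]) x : R[i] :=
  dyadic_mean P n (fun z => Re (f z)) x +i* dyadic_mean P n (fun z => Im (f z)) x.

(** Jensen's inequality for the Euclidean norm: pairing the vector c of
    averages with itself gives |c|^2 as an average of inner products, each at
    most |c| times the norm of f(z). *)
Lemma dyadic_mean_norm n (I : Type) (r : seq I) (f : I -> torus -> R[i]) x :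
  (forall i, cintegrable P (f i)) ->
  P.-integrable setT (EFin \o (fun z => enorm r (f ^~ z))) ->
  enorm r (fun i => cdyadic_mean n (f i) x) <=
  dyadic_mean P n (fun z => enorm r (f ^~ z)) x.
Proof.
move=> fi Ni; set c := fun i => cdyadic_mean n (f i) x.
set S := enorm r c; set D := dyadic_mean _ _ _ _.
have S0 : 0 <= S := enorm_ge0 r c.
have key : S ^+ 2 <= S * D.
  pose g i z := Re (c i) * (dyadic_kernel n x z * Re (f i z)) +
                Im (c i) * (dyadic_kernel n x z * Im (f i z)).
  have gi1 i : P.-integrable setT
      (EFin \o (fun z => Re (c i) * (dyadic_kernel n x z * Re (f i z)))).
    exact: (integrableZl measurableT _ (dyadic_integrand_integrable n x (fi i).1)).
  have gi2 i : P.-integrable setT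
      (EFin \o (fun z => Im (c i) * (dyadic_kernel n x z * Im (f i z)))).
    exact: (integrableZl measurableT _ (dyadic_integrand_integrable n x (fi i).2)).
  have gi i : P.-integrable setT (EFin \o g i).
    exact: (integrableD measurableT (gi1 i) (gi2 i)).
  have gE i : \int[P]_z g i z = abs2 (c i).
    have j1 := dyadic_integrand_integrable n x (fi i).1.
    have j2 := dyadic_integrand_integrable n x (fi i).2.
    by rewrite RintegralD// !RintegralZl// /abs2 !expr2.
  have [gs ->] : P.-integrable setT (EFin \o (fun z => \sum_(i <- r) g i z)) /\
      S ^+ 2 = \int[P]_z (\sum_(i <- r) g i z).
    rewrite enorm_sqr; elim: r {S S0 D Ni} => [|i r [IH1 IH2]].
      split; last by rewrite big_nil (@eq_Rintegral _ _ _ _ setT (cst 0)) ?Rintegral_cst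
        ?mul0r// => z _; rewrite big_nil.
      rewrite (_ : EFin \o _ = EFin \o cst 0); first exact: finite_measure_integrable_cst.
      by apply/funext => z; rewrite /= big_nil.
    have -> : (fun z => \sum_(j <- i :: r) g j z) =
        (fun z => g i z + \sum_(j <- r) g j z).
      by apply/funext => z; rewrite big_cons.
    split; first exact: (integrableD measurableT (gi i) IH1).
    by rewrite big_cons RintegralD// gE IH2.
  rewrite -RintegralZl//; last exact: dyadic_integrand_integrable.
  apply: le_Rintegral => //.
    exact: (integrableZl measurableT S (dyadic_integrand_integrable n x Ni)).
  move=> z _.
  rewrite [leLHS](_ : _ = dyadic_kernel n x z *
      \sum_(i <- r) (Re (c i) * Re (f i z) + Im (c i) * Im (f i z))); last first.
    by rewrite mulr_sumr; apply: eq_bigr => i _; rewrite /g; ring.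
  rewrite mulrCA ler_wpM2l ?dyadic_kernel_ge0//.
  exact: enorm_cauchy_schwarz.
have [S00|Sn] := eqVneq S 0.
  rewrite S00; apply: Rintegral_ge0 => z _.
  by rewrite mulr_ge0 ?dyadic_kernel_ge0 ?enorm_ge0.
by rewrite -(@ler_pM2l _ S) -?expr2// lt0r Sn.
Qed.

End dyadic_expectation.

(** * Interpolation between previsible norms *)

Section sqrt_sums.
Variable R : realType.
Local Open Scope ereal_scope.

Lemma sqrte_le_twice (x y : \bar R) (t : R) : 0 <= y -> (0 <= t)%R ->
  x <= 2%:E * (y + (t ^+ 2)%:E) -> sqrte x <= 2%:E * (sqrte y + t%:E).
Proof.
move=> y0 t0 xy; apply: (@le_trans _ _ (sqrte (2%:E * (y + (t ^+ 2)%:E)))).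
  by rewrite lee_sqrt// mule_ge0// adde_ge0// lee_fin sqr_ge0.
case: y y0 {xy} => [s| |]//; last by rewrite /= !addye// gt0_muley ?lte_fin// leey.
rewrite !lee_fin => s0.
rewrite -[leRHS](@ger0_norm) ?mulr_ge0 ?addr_ge0 ?sqrtr_ge0//.
rewrite -sqrtr_sqr ler_wsqrtr//; have := sqr_sqrtr s0; have := sqrtr_ge0 s.
by move: (Num.sqrt s) => u u0 <-; have := mulr_ge0 u0 t0; nra.
Qed.

(** The square root is 0 on negative values, so it is a power of the positive
    part. *)
Lemma measurable_sqrte d (T : measurableType d) (f : T -> \bar R) :
  measurable_fun setT f -> measurable_fun setT (fun x => sqrte (f x)).
Proof.
move=> mf; rewrite (_ : (fun x => _) = (fun x => maxe (f x) 0 `^ 2^-1)).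
  by apply: (measurableT_comp (measurable_poweR _)); exact: measurable_maxe.
apply/funext => x; rewrite poweR12_sqrt ?le_max ?lexx ?orbT//.
case: (f x) => [s| |] //=; last by rewrite maxNye /= sqrtr0.
rewrite -EFin_max /=; have [s0|//] := leP s 0%R.
by rewrite sqrtr0 ler0_sqrtr.
Qed.

Lemma enorm_le_sqrte I (r : seq I) (a : I -> R[i]) (g : I -> \bar R) :
  (forall i, (abs2 (a i))%:E <= g i) -> (enorm r a)%:E <= sqrte (\sum_(i <- r) g i).
Proof.
move=> ag; rewrite (_ : (enorm r a)%:E = sqrte (\sum_(i <- r) (abs2 (a i))%:E)).
  rewrite lee_sqrt ?lee_sum// sume_ge0// => i _.
  by rewrite (le_trans _ (ag i))// lee_fin abs2_ge0.
by rewrite sumEFin.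
Qed.

End sqrt_sums.

Section interpolation.
Context d (T : measurableType d) (R : realType) (P : probability T R).
Variables (I : Type) (r : seq I) (L A g : I -> T -> \bar R) (a b : I -> T -> R[i]).
Local Open Scope ereal_scope.
Hypothesis mL : forall i, measurable_fun setT (L i).
Hypothesis mA : forall i, measurable_fun setT (A i).
Hypothesis mg : forall i, measurable_fun setT (g i).
Hypothesis L0 : forall i x, 0 <= L i x.
Hypothesis A0 : forall i x, 0 <= A i x.
Hypothesis g0 : forall i x, 0 <= g i x.
Hypothesis mb : forall i, cmeas (b i).
Hypothesis aA : {ae P, forall x, forall i,
  (Re (a i x) ^+ 2 + Im (a i x - b i x)%R ^+ 2)%R%:E <= A i x}.
Hypothesis LA : {ae P, forall x, forall i,
  L i x <= 2%:E * (A i x + (Re (b i x) ^+ 2)%R%:E)}.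
Hypothesis Ag : {ae P, forall x, forall i,
  A i x <= 2%:E * (g i x + (abs2 (b i x))%:E)}.
Hypothesis ag : {ae P, forall x, forall i, (abs2 (a i x))%:E <= g i x}.

Let N x : R := enorm r (a^~ x).
Let M x : R := enorm r (b^~ x).
Let p x : R := enorm r (fun i => (Re (b i x))%:C%C).
Let q x : R := enorm r (fun i => (Im (b i x))%:C%C).
Hypothesis iN : P.-integrable setT (EFin \o N).
Hypothesis iM : P.-integrable setT (EFin \o M).
Hypothesis MN : (\int[P]_x M x <= \int[P]_x N x)%R.

Local Notation norm F := (\int[P]_x sqrte (\sum_(i <- r) F i x)).

Let msq (F : I -> T -> \bar R) : (forall i, measurable_fun setT (F i)) ->
  measurable_fun setT (fun x => sqrte (\sum_(i <- r) F i x)).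
Proof. by move=> mF; apply: measurable_sqrte; exact: emeasurable_sum. Qed.

Let menorm (f : I -> T -> R[i]) : (forall i, cmeas (f i)) ->
  measurable_fun setT (fun x => enorm r (f^~ x)).
Proof.
move=> mf; apply: (measurableT_comp (continuous_measurable_fun (@sqrt_continuous R))).
apply: measurable_sum => i; apply: measurable_funD; apply: measurable_funX.
  exact: (mf i).1.
exact: (mf i).2.
Qed.

Let mp : measurable_fun setT p.
Proof.
by apply: menorm => i; split; [exact: (mb i).1|exact: measurable_cst].
Qed.

Let mq : measurable_fun setT q.
Proof.
by apply: menorm => i; split; [exact: (mb i).2|exact: measurable_cst].
Qed.

Let p2q2 x : (M x ^+ 2 = p x ^+ 2 + q x ^+ 2)%R.
Proof.
rewrite !enorm_sqr -big_split /=; apply: eq_bigr => i _.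
by rewrite /abs2 /= expr0n /= !addr0.
Qed.

Let pM x : (p x <= M x)%R.
Proof. by apply: ler_enorm => i; rewrite /abs2 /= expr0n addr0 lerDl sqr_ge0. Qed.

Let qM x : (q x <= M x)%R.
Proof. by apply: ler_enorm => i; rewrite /abs2 /= expr0n addr0 lerDr sqr_ge0. Qed.

Let ip : P.-integrable setT (EFin \o p).
Proof.
apply: le_integrable iM => //; first exact/measurable_EFinP.
by move=> x _ /=; rewrite lee_fin !ger0_norm ?enorm_ge0.
Qed.

Let iq : P.-integrable setT (EFin \o q).
Proof.
apply: le_integrable iM => //; first exact/measurable_EFinP.
by move=> x _ /=; rewrite lee_fin !ger0_norm ?enorm_ge0.
Qed.

Let EFin_int (f : T -> R) : P.-integrable setT (EFin \o f) ->
  \int[P]_x (f x)%:E = (\int[P]_x f x)%R%:E.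
Proof. by move=> fi; rewrite fineK//; exact: integrable_fin_num. Qed.

Let int_le_twice (F G : I -> T -> \bar R) (u : I -> T -> R) (t : T -> R) :
  (forall i x, 0 <= F i x) -> (forall i x, 0 <= G i x) ->
  (forall i, measurable_fun setT (F i)) -> (forall i, measurable_fun setT (G i)) ->
  (forall i x, (0 <= u i x)%R) -> (forall x, (0 <= t x)%R) -> (forall x, t x ^+ 2 = \sum_(i <- r) u i x)%R ->
  P.-integrable setT (EFin \o t) ->
  {ae P, forall x, forall i, F i x <= 2%:E * (G i x + (u i x)%:E)} ->
  norm F <= 2%:E * (norm G + (\int[P]_x t x)%R%:E).
Proof.
move=> F0 G0 mF mG u0 t0 tu ti FG.
have mt : measurable_fun setT (EFin \o t) := measurable_int _ ti.
apply: (@le_trans _ _ (\int[P]_x (2%:E * (sqrte (\sum_(i <- r) G i x) + (t x)%:E)))).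
  apply: ae_ge0_le_integral => //.
  - by move=> x _; exact: sqrte_ge0.
  - exact: msq.
  - by move=> x _; rewrite mule_ge0// adde_ge0 ?sqrte_ge0 ?lee_fin.
  - by apply: measurable_funeM; apply: emeasurable_funD => //; exact: msq.
  apply: filterS FG => x FGx _; apply: sqrte_le_twice => //; first exact: sume_ge0.
  rewrite tu -sumEFin -big_split /= ge0_sume_distrr => [|i _].
    by apply: lee_sum => i _; exact: FGx.
  by rewrite adde_ge0// lee_fin.
rewrite ge0_integralZl// ?lee_fin//; last 2 first.
- by apply: emeasurable_funD => //; exact: msq.
- by move=> x _; rewrite adde_ge0 ?sqrte_ge0 ?lee_fin.
rewrite ge0_integralD//; last 3 first.
- by move=> x _; exact: sqrte_ge0.
- exact: msq.
- by move=> x _; rewrite lee_fin.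
by rewrite EFin_int.
Qed.

Let norm_ge0 (F : I -> T -> \bar R) : 0 <= norm F.
Proof. by apply: integral_ge0 => x _; exact: sqrte_ge0. Qed.

Let N_le_g : (\int[P]_x N x)%R%:E <= norm g.
Proof.
rewrite -EFin_int//; apply: ae_ge0_le_integral => //.
- by move=> x _; rewrite lee_fin enorm_ge0.
- exact: (measurable_int _ iN).
- by move=> x _; exact: sqrte_ge0.
- exact: msq.
by apply: filterS ag => x agx _; exact: enorm_le_sqrte.
Qed.

Let A_le_g : norm A <= 4%:E * norm g.
Proof.
have MM x : (M x ^+ 2 = \sum_(i <- r) abs2 (b i x))%R by exact: enorm_sqr.
have := int_le_twice A0 g0 mA mg (fun i x => abs2_ge0 _) (fun x => enorm_ge0 r _) MM iM Ag.
move=> /le_trans; apply; rewrite (_ : 4%:E = 2%:E * (1 + 1))%E; last first.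
  by rewrite -EFinD -EFinM; congr EFin; lra.
rewrite -muleA lee_wpmul2l ?lee_fin// ge0_muleDl// mul1e leeD2l//.
by rewrite (le_trans _ N_le_g)// lee_fin.
Qed.

Let L_le : norm L <= 2%:E * (norm A + (\int[P]_x p x)%R%:E).
Proof.
apply: (int_le_twice L0 A0 mL mA (fun i x => sqr_ge0 _) (fun x => enorm_ge0 r _) _ ip LA) => x.
by rewrite enorm_sqr; apply: eq_bigr => i _; rewrite /abs2 /= expr0n addr0.
Qed.

Let N_le_qA : (\int[P]_x N x)%R%:E <= (\int[P]_x q x)%R%:E + norm A.
Proof.
rewrite -!EFin_int// -ge0_integralD//; last 4 first.
- by move=> x _; rewrite lee_fin enorm_ge0.
- exact: (measurable_int _ iq).
- by move=> x _; exact: sqrte_ge0.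
- exact: msq.
apply: ae_ge0_le_integral => //.
- by move=> x _; rewrite lee_fin enorm_ge0.
- exact: (measurable_int _ iN).
- by move=> x _; rewrite adde_ge0 ?sqrte_ge0 ?lee_fin ?enorm_ge0.
- by apply: emeasurable_funD; [exact: (measurable_int _ iq)|exact: msq].
apply: filterS aA => x aAx _.
pose c i : R[i] := Complex (Re (a i x)) (Im (a i x - b i x)%R).
have := enormD r (fun i => Complex 0%R (Im (b i x))) c.
rewrite (_ : enorm r (fun i => _ + _)%R = N x); last first.
  by congr Num.sqrt; apply: eq_bigr => i _; rewrite /abs2 /= cImD cImN add0r addrCA subrr addr0.
rewrite (_ : enorm r (fun i => Complex _ _) = q x); last first.
  by congr Num.sqrt; apply: eq_bigr => i _; rewrite /abs2 /= expr0n add0r addr0.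
rewrite -lee_fin EFinD => /le_trans; apply; rewrite leeD2l//.
by apply: enorm_le_sqrte => i; exact: aAx.
Qed.

Let p_sqr : ((\int[P]_x p x) ^+ 2 <=
  (\int[P]_x N x - \int[P]_x q x) * (\int[P]_x N x *+ 2))%R.
Proof.
(* Since M^2 = p^2 + q^2, p is the product of the roots of M - q and M + q. *)
pose u x := Num.sqrt (M x - q x)%R; pose v x := Num.sqrt (M x + q x)%R.
have mM : measurable_fun setT M by have /measurable_int/measurable_EFinP := iM.
have u2 x : (u x ^+ 2 = M x - q x)%R by rewrite sqr_sqrtr// subr_ge0.
have v2 x : (v x ^+ 2 = M x + q x)%R by rewrite sqr_sqrtr// addr_ge0 ?enorm_ge0.
have uv x : (p x = u x * v x)%R.
  apply/eqP; rewrite -(@eqrXn2 _ 2) ?enorm_ge0 ?mulr_ge0 ?sqrtr_ge0// exprMn u2 v2.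
  by rewrite -subr_sqr p2q2 addrK.
have ms := continuous_measurable_fun (@sqrt_continuous R).
have mu : measurable_fun setT u.
  exact: (measurableT_comp ms (measurable_funB mM mq)).
have mv : measurable_fun setT v.
  exact: (measurableT_comp ms (measurable_funD mM mq)).
have iu : P.-integrable setT (EFin \o (fun x => u x ^+ 2)%R).
  by under eq_fun do rewrite /= u2; exact: (integrableB measurableT iM iq).
have iv : P.-integrable setT (EFin \o (fun x => v x ^+ 2)%R).
  by under eq_fun do rewrite /= v2; exact: (integrableD measurableT iM iq).
have := Rintegral_cauchy_schwarz mu mv iu iv.
rewrite (@eq_Rintegral _ _ _ _ setT p); last by move=> x _; rewrite uv.
rewrite (_ : \int[P]_x (u x ^+ 2) = \int[P]_x (M x - q x))%R; last first.
  by apply: eq_Rintegral => x _; exact: u2.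
rewrite (_ : \int[P]_x (v x ^+ 2) = \int[P]_x (M x + q x))%R; last first.
  by apply: eq_Rintegral => x _; exact: v2.
rewrite RintegralB// RintegralD// => /le_trans; apply.
have qM' : (\int[P]_x q x <= \int[P]_x M x)%R by apply: le_Rintegral => // x _; exact: qM.
have q0 : (0 <= \int[P]_x q x)%R by apply: Rintegral_ge0 => x _; exact: enorm_ge0.
by apply: ler_pM; move: MN qM' q0; lra.
Qed.

(** Let N, M, p, q be the Euclidean norms of a, b, Re b, Im b. The hypotheses
    give E M <= E N <= norm g, norm L <= 2 (norm A + E p), norm A <= 4 norm g
    and E N - E q <= norm A, while (E p)^2 <= E (M - q) E (M + q) <= norm A
    times 2 norm g. The constant 8 leaves room for these factors. If norm g is
    infinite and norm A = 0, the right-hand side is 0, but then E p = 0 as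
    well. *)
Lemma interpolation_estimate :
  norm L <= 8%:E * norm A `^ (1 / 2) * norm g `^ (1 / 2).
Proof.
have := N_le_qA; have := A_le_g; have := L_le; have := N_le_g; have := p_sqr.
have := norm_ge0 L; have := norm_ge0 A; have := norm_ge0 g.
have : (0 <= \int[P]_x p x)%R by apply: Rintegral_ge0 => x _; exact: enorm_ge0.
have : (0 <= \int[P]_x N x)%R by apply: Rintegral_ge0 => x _; exact: enorm_ge0.
move: (norm L) (norm A) (norm g) (\int[P]_x p x)%R (\int[P]_x N x)%R (\int[P]_x q x)%R.
move=> l [A'| |]// [g'| |]// s t w t0 s0.
- rewrite !lee_fin => g0' A0' _ s2 tg ll Ag' tw.
  apply: (le_trans ll); rewrite !poweR_EFin.
  change ((2 * (A' + s))%:E <= (8 * A' `^ (1 / 2) * g' `^ (1 / 2))%:E); rewrite lee_fin.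
  rewrite div1r !powR12_sqrt//.
  set x := Num.sqrt A'; set y := Num.sqrt g'.
  have x2 : (x ^+ 2 = A')%R by rewrite sqr_sqrtr.
  have y2 : (y ^+ 2 = g')%R by rewrite sqr_sqrtr.
  have x0 : (0 <= x)%R := sqrtr_ge0 _.
  have y0 : (0 <= y)%R := sqrtr_ge0 _.
  have xy : (x <= 2 * y)%R.
    by rewrite -ler_sqr ?nnegrE ?mulr_ge0// exprMn x2 y2; lra.
  have sxy : (s <= 2 * (x * y))%R.
    rewrite -ler_sqr ?nnegrE ?mulr_ge0// (le_trans s2)// !exprMn x2 y2.
    have A'g' : (0 <= A' * g')%R by rewrite mulr_ge0.
    have [tw0|tw0] := leP 0%R (t - w)%R.
      have : ((t - w) * (t *+ 2) <= A' * (g' *+ 2))%R.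
        by apply: ler_pM => //; [rewrite mulrn_wge0|lra|rewrite lerMn2r].
      lra.
    have : ((t - w) * (t *+ 2) <= 0)%R by rewrite nmulr_rle0// mulrn_wge0.
    lra.
  have : (A' <= 2 * (x * y))%R by rewrite -x2 expr2; nra.
  nra.
- move=> _ A0' l0 s2 _ ll _ tw.
  have [A'0|A'0] := eqVneq A' 0%R.
    have s00 : s = 0%R.
      apply/eqP; rewrite -sqrf_eq0 eq_le sqr_ge0 andbT (le_trans s2)//.
      move: tw; rewrite A'0 => tw'; have {tw'} : (t <= w)%R by rewrite -lee_fin (le_trans tw')// adde0.
      by move=> tw'; have := @mulr_ge0 R (w - t)%R (t *+ 2)%R; rewrite subr_ge0 mulrn_wge0// => /(_ tw' isT); lra.
    move: ll; rewrite A'0 s00 adde0 mule0 => ll.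
    by rewrite (le_trans ll)// mule_ge0 ?poweR_ge0// mule_ge0 ?poweR_ge0.
  rewrite poweRyr ?div1r ?invr_eq0// gt0_muley ?leey// mule_gt0 ?lte_fin//.
  by rewrite powR_gt0// lt0r A'0 -lee_fin.
- move=> _ _ _ _ _ _ _ _; rewrite !poweRyr ?div1r ?invr_eq0//.
  by rewrite gt0_muley ?leey// gt0_muley.
Qed.

End interpolation.

(** * Differences of centered processes *)

(** For measurable functions this is measurability with respect to F_k; in
    this form it combines with pointwise substitutions of coordinates. *)
Definition first_coords (R : realType) (T : Type) (k : nat) (f : torus R -> T) :=
  forall x z : torus R, (forall i, (i < k)%N -> x i = z i) -> f x = f z.

Section processes.
Variable R : realType.
Local Notation torus := (torus R).
Local Notation haar := (haar R).
Local Notation dyadic := (@dyadic R).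
Local Notation Fil := (@coord_filtration R).
Variable P : probability torus R.
Hypothesis HP : product_haar P.
Implicit Types (x z : torus) (f : torus -> R[i]) (F : nat -> torus -> R[i]).

Lemma set_coordK x m (y z : circle R) :
  set_coord (set_coord x m z) m y = set_coord x m y.
Proof. by apply/funext => i; rewrite /set_coord; case: eqP. Qed.

Lemma set_coord_same x m (y : circle R) : set_coord x m y m = y.
Proof. by rewrite /set_coord eqxx. Qed.

Lemma first_coords_le (T : Type) k m (f : torus -> T) : (k <= m)%N ->
  first_coords k f -> first_coords m f.
Proof. by move=> km fk x z xz; apply: fk => i ik; exact/xz/(leq_trans ik). Qed.

Lemma first_coords_set (T : Type) k m (f : torus -> T) x (y : circle R) :
  first_coords k f -> (k <= m)%N -> f (set_coord x m y) = f x.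
Proof.
move=> fk km; apply: fk => i ik; rewrite /set_coord ltn_eqF//.
exact: leq_trans km.
Qed.

Lemma first_coords_comp (T T' : Type) k (f : torus -> T) (g : T -> T') :
  first_coords k f -> first_coords k (fun x => g (f x)).
Proof. by move=> fk x z /fk ->. Qed.

Lemma ae_eq_cintegral f g : cmeas f -> cmeas g -> {ae P, forall x, f x = g x} ->
  cintegral P f = cintegral P g.
Proof.
move=> [mRf mIf] [mRg mIg] fg; rewrite /cintegral; congr (_ +i* _).
  by apply: ae_eq_Rintegral => //; apply: filterS fg => x ->.
by apply: ae_eq_Rintegral => //; apply: filterS fg => x ->.
Qed.

Lemma cdyadic_mean_cst n (c : R[i]) x : cdyadic_mean P n (fun=> c) x = c.
Proof. by apply: complex_ext; exact: dyadic_mean_cst. Qed.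

Lemma cdyadic_meanB n f g x : cintegrable P f -> cintegrable P g ->
  cdyadic_mean P n (fun z => f z - g z) x =
  cdyadic_mean P n f x - cdyadic_mean P n g x.
Proof.
move=> [fR fI] [gR gI]; apply: complex_ext; rewrite !partsE /= /dyadic_mean.
  rewrite -RintegralB//; [|exact: dyadic_integrand_integrable..].
  by apply: eq_Rintegral => z _; rewrite !partsE mulrBr.
rewrite -RintegralB//; [|exact: dyadic_integrand_integrable..].
by apply: eq_Rintegral => z _; rewrite !partsE mulrBr.
Qed.

Lemma integrable_cdyadic_mean n f : cintegrable P f -> cintegrable P (cdyadic_mean P n f).
Proof. by move=> [fR fI]; split; exact: (integrable_dyadic_mean HP). Qed.

Lemma dyadic_mean_total n (f : torus -> R) : P.-integrable setT (EFin \o f) ->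
  first_coords n f -> \int[P]_x dyadic_mean P n f x = \int[P]_x f x.
Proof.
move=> fi fn.
have := dyadic_mean_test HP (n := n) fi (@measurable_cst _ _ torus R setT 1)
  (fun=> lexx `|1|) (fun _ _ _ => erefl) fn.
rewrite (@eq_Rintegral _ _ _ _ setT (dyadic_mean P n f)); last first.
  by move=> x _; rewrite mul1r.
move=> ->; by apply: eq_Rintegral => x _; rewrite mul1r.
Qed.

Lemma cdyadic_mean_total n f : cintegrable P f -> first_coords n f ->
  cintegral P (cdyadic_mean P n f) = cintegral P f.
Proof.
move=> [fR fI] fn; apply: complex_ext; rewrite /= dyadic_mean_total//.
  exact: first_coords_comp.
exact: first_coords_comp.
Qed.

Lemma ccond_exp_dyadic n f : cintegrable P f -> first_coords n f ->
  {ae P, forall x, ccond_exp P dyadic f x = cdyadic_mean P n f x}.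
Proof.
move=> [fR fI] fn.
have cR := is_cond_exp_dyadic HP fR (first_coords_comp (@Re R) fn).
have cI := is_cond_exp_dyadic HP fI (first_coords_comp (@Im R) fn).
have aR := cond_exp_ae (@dyadic_sigma R) (@dyadic_measurable R) cR.
have aI := cond_exp_ae (@dyadic_sigma R) (@dyadic_measurable R) cI.
by apply: filterS2 aR aI => x eR eI; rewrite /ccond_exp eR eI.
Qed.

Lemma cmeas_ccond_exp n f : cintegrable P f -> first_coords n f ->
  cmeas (ccond_exp P dyadic f).
Proof.
move=> [fR fI] fn.
have cR := is_cond_exp_dyadic HP fR (first_coords_comp (@Re R) fn).
have cI := is_cond_exp_dyadic HP fI (first_coords_comp (@Im R) fn).
have mR := measurable_cond_exp (@dyadic_sigma R) (@dyadic_measurable R) cR.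
have mI := measurable_cond_exp (@dyadic_sigma R) (@dyadic_measurable R) cI.
split; apply: (measurableT_comp (fine_measurable _)) => //.
Qed.

Section centered_process.
Variables (n : nat) (F : nat -> torus -> R[i]).
Hypothesis iF : forall k, (1 <= k <= n)%N -> cintegrable P (F k).
Hypothesis Fk : forall k, (1 <= k <= n)%N -> first_coords k (F k).

Local Notation centered := (F - dyadic_expectation P F)%R.

Let Fn k : (1 <= k <= n)%N -> first_coords n (F k).
Proof. by move=> kn; apply: first_coords_le (Fk kn); case/andP: kn. Qed.

Lemma cmeas_centered k : (1 <= k <= n)%N -> cmeas (centered k).
Proof.
move=> kn; apply: cmeasD; first exact: cintegrable_cmeas (iF kn).
by apply: cmeasN; exact: cmeas_ccond_exp (iF kn) (Fn kn).
Qed.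

Lemma centered_mean k : (1 <= k <= n)%N ->
  {ae P, forall x, centered k x = F k x - cdyadic_mean P n (F k) x}.
Proof.
move=> kn; apply: filterS (ccond_exp_dyadic (iF kn) (Fn kn)) => x e.
by rewrite -e.
Qed.

Lemma cintegral_centered : (0 < n)%N -> cintegral P (centered 1) = 0.
Proof.
move=> n0; have kn : (1 <= 1 <= n)%N by rewrite n0.
have iD := integrable_cdyadic_mean n (iF kn).
rewrite (ae_eq_cintegral (cmeas_centered kn) _ (centered_mean kn)); last first.
  exact: (cintegrable_cmeas (cintegrableB (iF kn) iD)).
rewrite (cintegralB (iF kn) iD) cdyadic_mean_total ?subrr//.
  exact: iF.
exact: Fn.
Qed.

Lemma with_start_int k : (k <= n)%N -> cintegrable P (with_start P F k).
Proof.
by case: k => [|k] kn; [exact: cintegrable_cst|exact: iF].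
Qed.

Lemma with_start_first k : (k <= n)%N -> first_coords k (with_start P F k).
Proof. by case: k => [|k] kn; [|exact: Fk]. Qed.

Lemma mdiff_int k : (1 <= k <= n)%N -> cintegrable P (mdiff P F k).
Proof.
move=> /andP[k1 kn]; apply: cintegrableB; apply: with_start_int => //.
by rewrite (leq_trans (leq_pred k)).
Qed.

Lemma mdiff_first k : (1 <= k <= n)%N -> first_coords k (mdiff P F k).
Proof.
move=> /andP[k1 kn] x z xz; rewrite /mdiff (with_start_first kn xz).
congr (_ - _); apply: (@with_start_first k.-1); first exact: leq_trans (leq_pred k) kn.
by move=> i ik; apply: xz; exact: leq_trans ik (leq_pred k).
Qed.

Lemma cmeas_mdiff_centered k : (1 <= k <= n)%N -> cmeas (mdiff P centered k).
Proof.
case: k => [//|[|k]] kn; apply: cmeasD; rewrite /with_start.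
- exact: cmeas_centered.
- by apply: cmeasN; exact: cmeas_cst.
- exact: cmeas_centered.
- by apply: cmeasN; apply: cmeas_centered; move: kn => /= /ltnW.
Qed.

(** For k = 1 the difference is taken from the mean of the first term, which
    vanishes for a process centered at its dyadic expectation. *)
Lemma mdiff_centered k : (1 <= k <= n)%N -> {ae P, forall x,
  mdiff P centered k x = mdiff P F k x - cdyadic_mean P n (mdiff P F k) x}.
Proof.
move=> kn; have /andP[k1 kn'] := kn.
have ki : (k.-1 <= n)%N by rewrite (leq_trans (leq_pred k)).
have e x : cdyadic_mean P n (mdiff P F k) x =
    cdyadic_mean P n (with_start P F k) x - cdyadic_mean P n (with_start P F k.-1) x.
  by rewrite -cdyadic_meanB//; exact: with_start_int.
case: k k1 kn kn' ki e => [//|[|k]] _ kn kn' ki e.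
  apply: filterS (centered_mean kn) => x c; rewrite e /mdiff /= c.
  by rewrite cintegral_centered// cdyadic_mean_cst; ring.
have kn1 : (1 <= k.+1 <= n)%N by move: kn => /= /ltnW.
apply: filterS2 (centered_mean kn) (centered_mean kn1) => x c1 c2.
by rewrite e /mdiff [with_start _ _ _ _]c1 [with_start _ _ _ _]c2 /=; ring.
Qed.

End centered_process.

Lemma cond_exp_section k (D H : torus -> R[i]) : cmeas D -> cmeas H ->
  {ae P, forall x, D x = H x} -> first_coords k.+1 H ->
  is_cond_exp P (Fil k) (fun x => (abs2 (D x))%:E)
    (fun x => cenergy (fun y => H (set_coord x k y))).
Proof.
move=> mD mH DH Hk.
have m2 (f : torus -> R[i]) : cmeas f -> measurable_fun setT (fun x => abs2 (f x)).
  by move=> [mR mI]; apply: measurable_funD; exact: measurable_funX.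
have m3 (f : torus -> R[i]) : cmeas f -> measurable_fun setT (fun x => (abs2 (f x))%:E).
  by move=> /m2 /measurable_EFinP.
apply: (is_cond_exp_congr (@Fil_measurable R k) (m3 D mD) (m3 H mH)).
- by apply: filterS DH => x ->.
- apply: (@is_cond_exp_Fil R P HP k (fun x => abs2 (H x))); first exact: m2.
    by move=> x; exact: abs2_ge0.
  by move=> x z /Hk ->.
Qed.

Lemma cmeas_section k (H : torus -> R[i]) : cmeas H ->
  measurable_fun setT (fun x => cenergy (fun y => H (set_coord x k y))).
Proof.
move=> [mR mI]; apply: (@measurable_section_integral R k (fun x => abs2 (H x))).
  by apply: measurable_funD; exact: measurable_funX.
by move=> x; exact: abs2_ge0.
Qed.

(** Each conditional expectation is computed by integrating one coordinate
    out, and uniqueness allows this version to replace the chosen one under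
    the integral. *)
Lemma previsible_norm_section n F (H : 'I_n -> torus -> R[i]) :
  (forall i : 'I_n, cmeas (mdiff P F i.+1)) -> (forall i, cmeas (H i)) ->
  (forall i : 'I_n, {ae P, forall x, mdiff P F i.+1 x = H i x}) ->
  (forall i : 'I_n, first_coords i.+1 (H i)) ->
  previsible_norm P n F = (\int[P]_x sqrte (\sum_i cenergy (fun y => H i (set_coord x i y))))%E.
Proof.
move=> mF mH FH Hi.
have ce i := cond_exp_section (mF i) (mH i) (FH i) (Hi i).
rewrite /previsible_norm (eq_integral (fun x => sqrte (\sum_(i < n)
    cond_exp P (Fil i) (fun y => (abs2 (mdiff P F i.+1 y))%:E) x)%E)); last first.
  by move=> x _; rewrite big_add1 big_mkord.
apply: ae_eq_integral => //.
- apply: measurable_sqrte; apply: emeasurable_sum => i.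
  exact: (measurable_cond_exp (@Fil_sigma R i) (@Fil_measurable R i) (ce i)).
- by apply: measurable_sqrte; apply: emeasurable_sum => i; exact: cmeas_section.
have : {ae P, forall x, forall i : 'I_n,
    cond_exp P (Fil i) (fun y => (abs2 (mdiff P F i.+1 y))%:E) x =
    cenergy (fun y => H i (set_coord x i y))}.
  apply: filter_forall => i.
  exact: (cond_exp_ae (@Fil_sigma R i) (@Fil_measurable R i) (ce i)).
apply: filterS => x e _; congr sqrte; apply: eq_bigr => i _; exact: e.
Qed.

End processes.

(** * Sign coefficients and even parts of increments *)

Section increments.
Variable R : realType.
Local Notation torus := (torus R).
Local Notation haar := (haar R).
Local Notation Fil := (@coord_filtration R).
Variable P : probability torus R.
Hypothesis HP : product_haar P.
Implicit Types (x z : torus) (v a : torus -> R[i]).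

Lemma cmeasurable_first k v : cmeasurable (Fil k) v -> first_coords k v.
Proof.
move=> [mR mI] x z xz; apply: complex_ext.
  exact: (Fil_fun_invariant mR xz).
exact: (Fil_fun_invariant mI xz).
Qed.

Lemma cmeasurable_cmeas k v : cmeasurable (Fil k) v -> cmeas v.
Proof. by move=> [mR mI]; split; exact: (@Fil_fun_measurable R k). Qed.

Definition coef m v x : R[i] := sign_coef (fun y => v (set_coord x m y)).

Lemma Re_coef m v x :
  Re (coef m v x) = \int[haar]_y (csign y * Re (v (set_coord x m y))).
Proof. by rewrite /coef /sign_coef /=; apply: eq_Rintegral => y _; rewrite Re_scale. Qed.

Lemma Im_coef m v x :
  Im (coef m v x) = \int[haar]_y (csign y * Im (v (set_coord x m y))).
Proof. by rewrite /coef /sign_coef /=; apply: eq_Rintegral => y _; rewrite Im_scale. Qed.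

Lemma coef_int m v : cintegrable P v -> cintegrable P (coef m v).
Proof.
have key (f : torus -> R) : P.-integrable setT (EFin \o f) ->
    P.-integrable setT (EFin \o (fun x => \int[haar]_y (csign y * f (set_coord x m y)))).
  move=> fi; have := resample_inner_integrable HP m (csign_coord_integrable m fi).
  congr (_.-integrable _ _); apply/funext => x; congr EFin; apply: eq_Rintegral => y _.
  by rewrite set_coord_same.
move=> [vR vI]; split.
  have := key _ vR; congr (_.-integrable _ _); apply/funext => x /=.
  by rewrite -Re_coef.
have := key _ vI; congr (_.-integrable _ _); apply/funext => x /=.
by rewrite -Im_coef.
Qed.

Lemma coef_first m v : first_coords m.+1 v -> first_coords m (coef m v).
Proof.
move=> vm x z xz; congr sign_coef; apply/funext => y; apply: vm => i.
rewrite ltnS leq_eqVlt /set_coord; case: eqP => //= _; exact: xz.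
Qed.

Lemma dyadic_mean_first m (f : torus -> R) : first_coords m (dyadic_mean P m f).
Proof.
move=> x z xz; apply: eq_Rintegral => t _; congr (_ * _); apply: eq_bigr => i _.
by rewrite xz.
Qed.

Lemma dyadic_mean_local n m (f : torus -> R) x : P.-integrable setT (EFin \o f) ->
  first_coords m f -> (m <= n)%N -> dyadic_mean P n f x = dyadic_mean P m f x.
Proof.
move=> fi fm mn; apply: (dyadic_mean_peels HP) => // k mk z y.
exact: (first_coords_set _ _ fm).
Qed.

Lemma cdyadic_mean_first n m a : cintegrable P a -> first_coords m a -> (m <= n)%N ->
  first_coords m (cdyadic_mean P n a).
Proof.
move=> [aR aI] am mn x z xz; apply: complex_ext => /=.
  have am' := first_coords_comp (@Re R) am.
  by rewrite !(dyadic_mean_local _ aR am' mn); exact: dyadic_mean_first.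
have am' := first_coords_comp (@Im R) am.
by rewrite !(dyadic_mean_local _ aI am' mn); exact: dyadic_mean_first.
Qed.

(** Averaging v over n signs only involves the first m + 1 of them, and
    averaging a only the first m, so that the identity for n = m + 1 suffices. *)
Lemma cdyadic_mean_diff n m v a x : (m < n)%N ->
  cintegrable P v -> first_coords m.+1 v -> cintegrable P a -> first_coords m a ->
  {ae P, forall z, cintegral haar (fun y => v (set_coord z m y)) = 0} ->
  {ae P, forall z, coef m v z = a z} ->
  cdyadic_mean P n v x = (csign (x m))%:C * cdyadic_mean P n a x.
Proof.
move=> mn [vR vI] vm [aR aI] am v0 va.
have key (f g : torus -> R) : P.-integrable setT (EFin \o f) -> first_coords m.+1 f ->
    P.-integrable setT (EFin \o g) -> first_coords m g ->
    {ae P, forall z, \int[haar]_y f (set_coord z m y) = 0} ->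
    {ae P, forall z, \int[haar]_y (csign y * f (set_coord z m y)) = g z} ->
    dyadic_mean P n f x = csign (x m) * dyadic_mean P n g x.
  move=> fi fm gi gm f0 fg; rewrite (dyadic_mean_local _ fi fm mn).
  rewrite (dyadic_mean_local _ gi gm (ltnW mn)); apply: (dyadic_mean_diff HP) => //.
  by have /measurable_int/measurable_EFinP := gi.
apply: complex_ext; rewrite ?Re_scale ?Im_scale; apply: key => //.
- exact: (first_coords_comp (@Re R) vm).
- exact: (first_coords_comp (@Re R) am).
- by apply: filterS v0 => z /(congr1 (@Re R)).
- by apply: filterS va => z <-; rewrite Re_coef.
- exact: (first_coords_comp (@Im R) vm).
- exact: (first_coords_comp (@Im R) am).
- by apply: filterS v0 => z /(congr1 (@Im R)).
- by apply: filterS va => z <-; rewrite Im_coef.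
Qed.

Definition reflect_coord m x : torus := set_coord x m (circle_conj (x m)).

Lemma reflect_section x m (y : circle R) :
  reflect_coord m (set_coord x m y) = set_coord x m (circle_conj y).
Proof. by rewrite /reflect_coord set_coordK set_coord_same. Qed.

Lemma measurable_reflect m : measurable_fun setT (reflect_coord m).
Proof.
apply: measurable_to_torus => i; rewrite /reflect_coord /set_coord; case: (i == m).
  exact: (measurableT_comp (@measurable_circle_conj R) (@measurable_coord R m)).
exact: measurable_coord.
Qed.

Lemma reflect_real_int m (f : torus -> R) : P.-integrable setT (EFin \o f) ->
  P.-integrable setT (EFin \o (fun x => f (reflect_coord m x))).
Proof.
move=> fi; have mf : measurable_fun setT f.
  by have /measurable_int/measurable_EFinP := fi.
have mfr : measurable_fun setT (fun x => f (reflect_coord m x)).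
  exact: (measurableT_comp mf (measurable_reflect m)).
have mabs (g : torus -> R) : measurable_fun setT g ->
    measurable_fun setT (fun x => `|(g x)%:E|%E).
  by move=> mg; apply: measurableT_comp => //; exact/measurable_EFinP.
apply/integrableP; split; first exact/measurable_EFinP.
have law := @set_coord_law R P HP m; have ms := @measurable_set_coord R m.
have /integrableP[_] := fi.
rewrite (product_law_ge0 ms law (mabs _ mf)) => [fin|x]; last exact: abse_ge0.
rewrite (product_law_ge0 ms law (mabs _ mfr)) => [|x]; last exact: abse_ge0.
apply: le_lt_trans fin; rewrite le_eqVlt; apply/orP; left; apply/eqP.
apply: eq_integral => x _.
rewrite (eq_integral (fun y => `|(f (set_coord x m (circle_conj y)))%:E|%E)) => [|y _].
  apply: (preserves_haar_ge0 (f := fun y => `|(f (set_coord x m y))%:E|%E)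
    (@measurable_circle_conj R) (@haar_conj R)) => //.
  exact: (measurableT_comp (mabs _ mf) (@measurable_set_coord2 R m x)).
by rewrite /= reflect_section.
Qed.

Lemma reflect_real_total m (f : torus -> R) : P.-integrable setT (EFin \o f) ->
  \int[P]_x f (reflect_coord m x) = \int[P]_x f x.
Proof.
move=> fi; have ri := reflect_real_int m fi.
rewrite (resample HP m ri) (resample HP m fi); apply: ae_eq_Rintegral.
- by have /measurable_int/measurable_EFinP := resample_inner_integrable HP m ri.
- by have /measurable_int/measurable_EFinP := resample_inner_integrable HP m fi.
apply: filterS (resample_section_integrable HP m fi) => x ix.
rewrite -(preserves_haar_Rintegral (@measurable_circle_conj R) (@haar_conj R) ix).
by apply: eq_Rintegral => y _; rewrite reflect_section.
Qed.

Lemma reflect_int m v : cintegrable P v -> cintegrable P (fun x => v (reflect_coord m x)).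
Proof.
move=> [vR vI]; split.
  exact: (@reflect_real_int m (fun x => Re (v x))).
exact: (@reflect_real_int m (fun x => Im (v x))).
Qed.

Lemma reflect_total m v : cintegrable P v ->
  cintegral P (fun x => v (reflect_coord m x)) = cintegral P v.
Proof.
move=> [vR vI]; rewrite /cintegral; congr (_ +i* _).
  exact: (@reflect_real_total m (fun x => Re (v x))).
exact: (@reflect_real_total m (fun x => Im (v x))).
Qed.

(** Applied with m = k - 1 to the k-th difference of G, this is the k-th
    difference of the cosine martingale. *)
Definition even_coord m v x : R[i] := 2^-1 * (v x + v (reflect_coord m x)).

Lemma even_coord_int m v : cintegrable P v -> cintegrable P (even_coord m v).
Proof. by move=> vi; apply/cintegrableZ/cintegrableD => //; exact: reflect_int. Qed.

Lemma even_coord_total m v : cintegrable P v ->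
  cintegral P (even_coord m v) = cintegral P v.
Proof.
move=> vi; have ri := reflect_int m vi.
rewrite (cintegralZ _ (cintegrableD vi ri)) cintegralD// reflect_total//.
by rewrite -mulr2n -[X in _ * X]mulr_natl mulKf.
Qed.

Lemma even_coord_section m v x :
  (fun y => even_coord m v (set_coord x m y)) = even_part (fun y => v (set_coord x m y)).
Proof. by apply/funext => y; rewrite /even_coord reflect_section. Qed.

Lemma even_coord_first m v : first_coords m.+1 v -> first_coords m.+1 (even_coord m v).
Proof.
move=> vm x z xz; rewrite /even_coord (vm _ _ xz); congr (_ * (_ + _)).
apply: vm => i im; rewrite /reflect_coord /set_coord; case: eqP => // _.
  by rewrite xz.
exact: xz.
Qed.

Lemma section_integrable m v : cintegrable P v ->
  {ae P, forall x, cintegrable haar (fun y => v (set_coord x m y))}.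
Proof.
move=> [vR vI].
have aR := resample_section_integrable HP m (f := fun x => Re (v x)) vR.
have aI := resample_section_integrable HP m (f := fun x => Im (v x)) vI.
by apply: filterS2 aR aI.
Qed.

Lemma coef_even_coord m v : cintegrable P v ->
  {ae P, forall x, coef m (even_coord m v) x = coef m v x}.
Proof.
move=> vi; apply: filterS (section_integrable m vi) => x ix.
by rewrite /coef even_coord_section sign_coef_even.
Qed.

Lemma even_coord_mean m v : cintegrable P v ->
  {ae P, forall x, cintegral haar (fun y => v (set_coord x m y)) = 0} ->
  {ae P, forall x, cintegral haar (fun y => even_coord m v (set_coord x m y)) = 0}.
Proof.
move=> vi; apply: filterS2 (section_integrable m vi) => x ix v0.
have jx : cintegrable haar (fun y => v (set_coord x m (circle_conj y))).
  have := even_part_integrable ix => /(cintegrableZ 2) /cintegrableB /(_ ix).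
  congr (cintegrable _ _); apply/funext => y.
  by rewrite /even_part mulVKf// addrAC subrr add0r.
rewrite even_coord_section /even_part (cintegralZ _ (cintegrableD ix jx)).
have e : cintegral haar (fun y => v (set_coord x m (circle_conj y))) = 0.
  by rewrite -[RHS]v0; exact: (cintegral_haar_conj ix).
by rewrite cintegralD// v0 e addr0 mulr0.
Qed.

End increments.

(** * The estimate for Hardy martingales *)

Section hardy.
Variable R : realType.
Local Notation torus := (torus R).
Local Notation haar := (haar R).
Local Notation Fil := (@coord_filtration R).
Variable P : probability torus R.
Hypothesis HP : product_haar P.
Implicit Types (x z : torus).
Variables (n : nat) (G : nat -> torus -> R[i]).
Hypothesis hG : hardy_martingale P n G.

Let iG k : (1 <= k <= n)%N -> cintegrable P (G k).
Proof. by move=> kn; have [[/(_ k kn)[]]] := hG. Qed.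

Let Gk k : (1 <= k <= n)%N -> first_coords k (G k).
Proof. by move=> kn; have [[/(_ k kn)[/cmeasurable_first]]] := hG. Qed.

Let ord_range (i : 'I_n) : (1 <= i.+1 <= n)%N.
Proof. exact: ltn_ord. Qed.

Let h i := mdiff P G i.+1.

Let ih (i : 'I_n) : cintegrable P (h i).
Proof. exact: (mdiff_int iG (ord_range i)). Qed.

Let hk (i : 'I_n) : first_coords i.+1 (h i).
Proof. exact: (mdiff_first P Gk (ord_range i)). Qed.

Let hardy_section (i : 'I_n) : {ae P, forall x, H10 (fun y => h i (set_coord x i y))}.
Proof. by have [_ /(_ _ (ord_range i))] := hG. Qed.

Let mean0 (i : 'I_n) : {ae P, forall x, cintegral haar (fun y => h i (set_coord x i y)) = 0}.
Proof. by apply: filterS (hardy_section i) => x []. Qed.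

Let alpha i := coef i (h i).

Let ialpha (i : 'I_n) : cintegrable P (alpha i).
Proof. exact: (coef_int HP i (ih i)). Qed.

Let alphak (i : 'I_n) : first_coords i (alpha i).
Proof. exact: (coef_first (@hk i)). Qed.

Let beta i := cdyadic_mean P n (alpha i).

Let ibeta (i : 'I_n) : cintegrable P (beta i).
Proof. exact: (integrable_cdyadic_mean HP n (ialpha i)). Qed.

Let betak (i : 'I_n) : first_coords i (beta i).
Proof. exact: (cdyadic_mean_first HP (ialpha i) (@alphak i) (ltnW (ltn_ord i))). Qed.

(* For v = h i and v = u i these are the differences of G - E(G | D) and U -
   E(U | D). *)
Let dev (v : torus -> R[i]) i x : R[i] := v x - (csign (x i))%:C * beta i x.

Let cmeas_csign i : cmeas (fun x : torus => (csign (x i))%:C).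
Proof. by split; [exact: measurable_csign_coord|exact: measurable_cst]. Qed.

Let cmeas_dev v (i : 'I_n) : cintegrable P v -> cmeas (dev v i).
Proof.
move=> vi; apply: cmeasD; first exact: cintegrable_cmeas vi.
by apply/cmeasN/cmeasM => //; exact: cintegrable_cmeas (ibeta i).
Qed.

Let dev_first v (i : 'I_n) : first_coords i.+1 v -> first_coords i.+1 (dev v i).
Proof.
move=> vi x z xz; rewrite /dev (vi _ _ xz) (xz i (ltnSn i)); congr (_ - _ * _).
by apply: betak => j ji; apply: xz; exact: ltnW.
Qed.

Let dev_section v (i : 'I_n) x y : dev v i (set_coord x i y) =
  v (set_coord x i y) - (csign y)%:C * beta i x.
Proof.
by rewrite /dev set_coord_same (first_coords_set x y (@betak i) (leqnn i)).
Qed.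

Let U := cosine_martingale P G.
Let u i := even_coord i (h i).

Let iu (i : 'I_n) : cintegrable P (u i).
Proof. exact: (even_coord_int HP i (ih i)). Qed.

Let uk (i : 'I_n) : first_coords i.+1 (u i).
Proof. exact: (even_coord_first (@hk i)). Qed.

Let US k x : U k.+1 x = U k x + u k x.
Proof. by rewrite /U /cosine_martingale big_nat_recr//= addrA. Qed.

Let U0 x : U 0 x = cintegral P (G 1).
Proof. by rewrite /U /cosine_martingale big_geq// addr0. Qed.

Let iU k : (k <= n)%N -> cintegrable P (U k).
Proof.
elim: k => [_|k IH kn].
  by rewrite (_ : U 0 = fun=> cintegral P (G 1)); [exact: cintegrable_cst|exact/funext/U0].
rewrite (_ : U k.+1 = fun x => U k x + u k x); last exact/funext/US.
by apply: cintegrableD; [apply: IH; exact: ltnW|exact: (iu (Ordinal kn))].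
Qed.

Let Uk k : (k <= n)%N -> first_coords k (U k).
Proof.
elim: k => [_ x z _|k IH kn x z xz]; first by rewrite !U0.
rewrite !US (@uk (Ordinal kn) _ _ xz); congr (_ + _); apply: IH; first exact: ltnW.
by move=> i ik; apply: xz; exact: ltnW.
Qed.

Let mdiff_U (i : 'I_n) x : mdiff P U i.+1 x = u i x.
Proof.
case: i => -[|i] /= im; rewrite /mdiff /=; last by rewrite US addrAC subrr add0r.
have n0 : (1 <= 1 <= n)%N by rewrite im.
have total0 : cintegral P (u 0) = 0.
  rewrite (even_coord_total HP 0 (ih (Ordinal im))) /h /mdiff /=.
  by rewrite (cintegralB (iG n0) (cintegrable_cst P _)) cintegral_cst subrr.
rewrite (_ : U 1 = fun x => U 0 x + u 0 x); last exact/funext/US.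
rewrite cintegralD; [|exact: iU|exact: (iu (Ordinal im))].
rewrite (_ : U 0 = fun=> cintegral P (G 1)); last exact/funext/U0.
by rewrite cintegral_cst total0; ring.
Qed.

Let mean_h (i : 'I_n) x : cdyadic_mean P n (h i) x = (csign (x i))%:C * beta i x.
Proof.
apply: (cdyadic_mean_diff HP x (ltn_ord i) (ih i) (@hk i) (ialpha i) (@alphak i)).
  exact: mean0.
exact: filterE.
Qed.

Let mean_u (i : 'I_n) x : cdyadic_mean P n (u i) x = (csign (x i))%:C * beta i x.
Proof.
apply: (cdyadic_mean_diff HP x (ltn_ord i) (iu i) (@uk i) (ialpha i) (@alphak i)).
  exact: even_coord_mean (ih i) (mean0 i).
exact: coef_even_coord.
Qed.

Let dG := (G - dyadic_expectation P G)%R.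
Let dU := (U - dyadic_expectation P U)%R.

Let mdiff_dG (i : 'I_n) : {ae P, forall x, mdiff P dG i.+1 x = dev (h i) i x}.
Proof.
apply: filterS (mdiff_centered HP iG Gk (ord_range i)) => x e.
by rewrite e mean_h.
Qed.

Let iU' k : (1 <= k <= n)%N -> cintegrable P (U k).
Proof. by case/andP => _; exact: iU. Qed.

Let Uk' k : (1 <= k <= n)%N -> first_coords k (U k).
Proof. by case/andP => _; exact: Uk. Qed.

Let mdiff_dU (i : 'I_n) : {ae P, forall x, mdiff P dU i.+1 x = dev (u i) i x}.
Proof.
apply: filterS (mdiff_centered HP iU' Uk' (ord_range i)) => x e.
rewrite e (_ : mdiff P U i.+1 = u i) ?mean_u//.
by apply/funext => z; exact: mdiff_U.
Qed.

Let norm_U : previsible_norm P n dU =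
  (\int[P]_x sqrte (\sum_(i < n) cenergy (fun y => dev (u i) i (set_coord x i y))))%E.
Proof.
apply: (@previsible_norm_section R P HP n dU (fun i : 'I_n => dev (u i) i)) => i.
- exact: (cmeas_mdiff_centered HP iU' Uk').
- exact: cmeas_dev.
- exact: mdiff_dU.
- exact: dev_first.
Qed.

Let norm_G : previsible_norm P n G =
  (\int[P]_x sqrte (\sum_(i < n) cenergy (fun y => h i (set_coord x i y))))%E.
Proof.
apply: (@previsible_norm_section R P HP n G (fun i : 'I_n => h i)) => i.
- exact: cintegrable_cmeas (ih i).
- exact: cintegrable_cmeas (ih i).
- exact: filterE.
- exact: hk.
Qed.

Variable W : nat -> torus -> R[i].
Hypothesis aW : adapted W.
Hypothesis W1 : forall k x, `|W k x| = 1.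

Let Wk k : first_coords k (W k). Proof. exact: cmeasurable_first (aW k). Qed.

Let mW k : cmeas (W k). Proof. exact: cmeasurable_cmeas (aW k). Qed.

Let T := transform P W dG.

Let TS k x : T k.+1 x = T k x + (Im (W k x * mdiff P dG k.+1 x))%:C.
Proof. by rewrite /T /transform big_nat_recr//= rmorphD. Qed.

Let T0 x : T 0 x = 0.
Proof. by rewrite /T /transform big_geq. Qed.

Let turned i x : R[i] := (Im (W i x * dev (h i) i x))%:C.

Let cmeas_ImC (f : torus -> R[i]) : cmeas f -> cmeas (fun x => (Im (f x))%:C).
Proof. by move=> [mR mI]; split; [exact: mI|exact: measurable_cst]. Qed.

Let cmeas_turned (i : 'I_n) : cmeas (turned i).
Proof. by apply/cmeas_ImC/cmeasM => //; exact: cmeas_dev. Qed.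

Let T1_total : (0 < n)%N -> cintegral P (T 1) = 0.
Proof.
move=> n0; pose i0 := Ordinal n0.
have mD : cmeas (mdiff P dG 1) := cmeas_mdiff_centered HP iG Gk (ord_range i0).
(* W 0 is constant because F_0 is trivial. *)
pose x0 : torus := fun=> expi 0.
have WE x : W 0 x = W 0 x0 by exact: Wk.
have iD : cintegrable P (fun x => h 0 x - cdyadic_mean P n (h 0) x).
  by apply: cintegrableB; [exact: (ih i0)|exact: integrable_cdyadic_mean (ih i0)].
have total0 : cintegral P (fun x => h 0 x - cdyadic_mean P n (h 0) x) = 0.
  rewrite (cintegralB (ih i0) (integrable_cdyadic_mean HP n (ih i0))).
  rewrite (cdyadic_mean_total HP (ih i0)) ?subrr//.
  exact: first_coords_le (@hk i0).
have eT : {ae P, forall x, T 1 x =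
    (Im (W 0 x0 * (h 0 x - cdyadic_mean P n (h 0) x)))%:C}.
  apply: filterS (mdiff_centered HP iG Gk (ord_range i0)) => x e.
  by rewrite TS T0 add0r -e WE.
rewrite (ae_eq_cintegral _ _ eT); last 2 first.
- rewrite (_ : T 1 = fun x => (Im (W 0 x * mdiff P dG 1 x))%:C).
    by apply/cmeas_ImC/cmeasM.
  by apply/funext => x; rewrite TS T0 add0r.
- by apply/cmeas_ImC/cmeasM; [exact: cmeas_cst|exact: cintegrable_cmeas iD].
have := cintegralZ (W 0 x0) iD; rewrite total0 mulr0 => /(congr1 (@Im R)) /= e.
by apply: complex_ext => //=; rewrite Rintegral_cst// mul0r.
Qed.

Let mdiff_T (i : 'I_n) x : mdiff P T i.+1 x = (Im (W i x * mdiff P dG i.+1 x))%:C.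
Proof.
case: i => -[|i] im /=; last by rewrite {1}/mdiff /= TS addrAC subrr add0r.
by rewrite {1}/mdiff /= T1_total// TS T0 add0r subr0.
Qed.

Let norm_T : previsible_norm P n T =
  (\int[P]_x sqrte (\sum_(i < n) cenergy (fun y => turned i (set_coord x i y))))%E.
Proof.
apply: (@previsible_norm_section R P HP n T (fun i : 'I_n => turned i)) => i.
- rewrite (_ : mdiff P T i.+1 = fun x => (Im (W i x * mdiff P dG i.+1 x))%:C).
    by apply/cmeas_ImC/cmeasM => //; exact: (cmeas_mdiff_centered HP iG Gk).
  by apply/funext => x; exact: mdiff_T.
- exact: cmeas_turned.
- by apply: filterS (mdiff_dG i) => x e; rewrite mdiff_T e.
- move=> x z xz; rewrite /turned (dev_first (@hk i) xz); congr (Im (_ * _))%:C.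
  by apply: Wk => j ji; apply: xz; exact: ltnW.
Qed.

Let turned_section (i : 'I_n) x : cenergy (fun y => turned i (set_coord x i y)) =
  energy (fun y => Im (W i x * (h i (set_coord x i y) - (csign y)%:C * beta i x))).
Proof.
apply: eq_integral => y _; rewrite /turned dev_section.
by rewrite (first_coords_set x y (Wk (k := i)) (leqnn i)) /abs2 /= expr0n addr0.
Qed.

Let norm_unit (a : 'I_n -> torus -> R[i]) x :
  enorm (index_enum 'I_n) (fun i => W i x * a i x) = enorm (index_enum 'I_n) (a^~ x).
Proof.
by congr Num.sqrt; apply: eq_bigr => i _; rewrite abs2M abs2_unit ?mul1r.
Qed.

Let ialphaN : P.-integrable setT
  (EFin \o (fun x => enorm (index_enum 'I_n) (fun i => alpha i x))).
Proof. exact: (enorm_integrable (index_enum 'I_n) ialpha). Qed.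

Let ibetaN : P.-integrable setT
  (EFin \o (fun x => enorm (index_enum 'I_n) (fun i => beta i x))).
Proof. exact: (enorm_integrable (index_enum 'I_n) ibeta). Qed.

Let beta_le_alpha : \int[P]_x enorm (index_enum 'I_n) (fun i => beta i x) <=
  \int[P]_x enorm (index_enum 'I_n) (fun i => alpha i x).
Proof.
rewrite -(dyadic_mean_total HP (n := n) ialphaN); last first.
  move=> x z xz; congr Num.sqrt; apply: eq_bigr => i _; congr abs2; apply: alphak => j ji.
  by apply: xz; exact: ltn_trans (ltn_ord i).
apply: le_Rintegral => //; first exact: (integrable_dyadic_mean HP n ialphaN).
by move=> x _; exact: (dyadic_mean_norm n x ialpha ialphaN).
Qed.

Let L (i : 'I_n) x := cenergy (fun y => dev (u i) i (set_coord x i y)).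
Let A (i : 'I_n) x := cenergy (fun y => turned i (set_coord x i y)).
Let g (i : 'I_n) x := cenergy (fun y => h i (set_coord x i y)).

Let L_section (i : 'I_n) x : L i x = cenergy (fun y =>
  even_part (fun y => h i (set_coord x i y)) y - (csign y)%:C * beta i x).
Proof.
congr cenergy; apply/funext => y; rewrite dev_section; congr (_ - _).
exact: (congr1 (@^~ y) (even_coord_section i (h i) x)).
Qed.

Let bounds (i : 'I_n) : {ae P, forall x,
  [/\ ((Re (W i x * alpha i x) ^+ 2 +
         Im (W i x * (alpha i x - beta i x)) ^+ 2)%:E <= A i x)%E,
      (L i x <= 2%:E * (A i x + (Re (W i x * beta i x) ^+ 2)%:E))%E,
      (A i x <= 2%:E * (g i x + (abs2 (beta i x))%:E))%E &
      ((abs2 (alpha i x))%:E <= g i x)%E]}.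
Proof.
apply: filterS (hardy_section i) => x hx; have [ix _ _] := hx.
have := one_variable_bounds (beta i x) ix (fun k => H10_moments k hx) (W1 i x).
by rewrite L_section /A turned_section.
Qed.

Let cenergy_ge0 (f : circle R -> R[i]) : (0 <= cenergy f)%E.
Proof. by apply: integral_ge0 => y _; rewrite lee_fin abs2_ge0. Qed.

Let Wa (i : 'I_n) x := W i x * alpha i x.
Let Wb (i : 'I_n) x := W i x * beta i x.

(** The bounds in one variable hold for almost every x and are summed by the
    interpolation estimate, applied to a = w alpha and b = w beta. *)
Lemma hardy_estimate : (previsible_norm P n dU <=
  8%:E * poweR (previsible_norm P n T) (1 / 2)%R *
         poweR (previsible_norm P n G) (1 / 2)%R)%E.
Proof.
rewrite norm_U norm_T norm_G.
have abs2W (i : 'I_n) x (z : R[i]) : abs2 (W i x * z) = abs2 z by rewrite abs2M abs2_unit ?mul1r.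
apply: (@interpolation_estimate _ _ R P _ (index_enum 'I_n) L A g Wa Wb).
- by move=> i; apply: (@cmeas_section R i (dev (u i) i)); exact: cmeas_dev.
- by move=> i; apply: (@cmeas_section R i (turned i)); exact: cmeas_turned.
- by move=> i; apply: (@cmeas_section R i (h i)); exact: cintegrable_cmeas (ih i).
- by move=> i x; exact: cenergy_ge0.
- by move=> i x; exact: cenergy_ge0.
- by move=> i x; exact: cenergy_ge0.
- by move=> i; apply: cmeasM => //; exact: cintegrable_cmeas (ibeta i).
- apply: filter_forall => i; apply: filterS (bounds i) => x [b _ _ _].
  by rewrite /Wa /Wb -mulrBr.
- by apply: filter_forall => i; apply: filterS (bounds i) => x [_ b _ _].
- apply: filter_forall => i; apply: filterS (bounds i) => x [_ _ b _].
  by rewrite abs2W.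
- apply: filter_forall => i; apply: filterS (bounds i) => x [_ _ _ b].
  by rewrite abs2W.
- have := ialphaN; congr (_.-integrable _ _); apply/funext => x; congr EFin.
  exact: esym (norm_unit (fun i : 'I_n => alpha i) x).
- have := ibetaN; congr (_.-integrable _ _); apply/funext => x; congr EFin.
  exact: esym (norm_unit (fun i : 'I_n => beta i) x).
- have := beta_le_alpha; congr (_ <= _); apply: eq_Rintegral => x _.
    exact: esym (norm_unit (fun i : 'I_n => beta i) x).
  exact: esym (norm_unit (fun i : 'I_n => alpha i) x).
Qed.

End hardy.

Theorem theorem3p1 (R : realType) :
  exists C : R, 0 < C /\
    forall P : probability (torus R) R, product_haar P ->
    forall (n : nat) (G : nat -> torus R -> R[i]), hardy_martingale P n G ->
    forall W : nat -> torus R -> R[i],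
      adapted W -> (forall k x, `|W k x| = 1) ->
    let U := cosine_martingale P G in
    (previsible_norm P n (U - dyadic_expectation P U)%R <=
     C%:E *
     poweR (previsible_norm P n
             (transform P W (G - dyadic_expectation P G)%R)) (1 / 2)%R *
     poweR (previsible_norm P n G) (1 / 2)%R)%E.
Proof.
exists 8; split=> // P HP n G hG W aW W1; exact: hardy_estimate.
Qed.
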